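(* Let $M=\{M_\gamma\}_{\gamma\in\Gamma}$ and $N=\{N_\omega\}_{\omega\in\Omega}$ be defining families of functions on $\mathbb{C}^{k_1}$ and $\mathbb{C}^{k_2}$ respectively, each satisfying conditions (I) and (II) given in the context. Let the bilinear mapping $\Phi\colon\mathcal{H}(M)\times\mathcal{H}(N)\to\mathcal{H}(M\otimes N)$ be defined by $\Phi(f,g)(x,y)=f(x)g(y)$ for $x\in\mathbb{C}^{k_1}$, $y\in\mathbb{C}^{k_2}$. Then $\Phi$ induces a topological isomorphism $\mathcal{H}(M)\widehat{\otimes}_\pi\mathcal{H}(N)\simeq\mathcal{H}(M\otimes N)$.
   Context: A defining family of functions on $\mathbb{C}^k$ is a family $M=\{M_\gamma\}_{\gamma\in\Gamma}$ of nonnegative measurable functions on $\mathbb{C}^k$ (identified with $\mathbb{R}^{2k}$) which are bounded on every bounded subset and satisfy: (a) for every $\gamma_1,\gamma_2\in\Gamma$, there are $\gamma\in\Gamma$ and $C>0$ such that $M_\gamma\ge C(M_{\gamma_1}+M_{\gamma_2})$; (b) there is a countable set $\Gamma'\subset\Gamma$ such that for every $\gamma\in\Gamma$ there are $\gamma'\in\Gamma'$ and $C>0$ with $CM_\gamma\le M_{\gamma'}$; (c) for every $z\in\mathbb{C}^k$, there are $\gamma\in\Gamma$, a neighborhood $O(z)$ of $z$, and $C>0$ such that $M_\gamma(z')\ge C$ for all $z'\in O(z)$. The space $\mathcal{H}(M)$ consists of all entire analytic functions $f$ on $\mathbb{C}^k$ for which all the seminorms $\|f\|_\gamma=\sup_{z\in\mathbb{C}^k}M_\gamma(z)|f(z)|$,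 $\gamma\in\Gamma$, are finite, with the topology determined by these seminorms. Conditions on a defining family $M$ on $\mathbb{C}^k$: (I) for every $\gamma\in\Gamma$, there are $\gamma'\in\Gamma$ and a summable (Lebesgue integrable) nonnegative function $L_{\gamma\gamma'}$ on $\mathbb{C}^k$ such that $M_\gamma\le L_{\gamma\gamma'}M_{\gamma'}$ and $L_{\gamma\gamma'}(z)\to0$ as $|z|\to\infty$; (II) for every $\gamma\in\Gamma$, there are $\gamma'\in\Gamma$, a neighborhood of the origin $B$ in $\mathbb{C}^k$, and $C>0$ such that $M_\gamma(z)\le CM_{\gamma'}(z+z')$ for any $z\in\mathbb{C}^k$ and $z'\in B$. $M\otimes N$ is the family of functions on $\mathbb{C}^{k_1+k_2}$, indexed by $(\gamma,\omega)\in\Gamma\times\Omega$, given by $(M\otimes N)_{\gamma\omega}(x,y)=M_\gamma(x)N_\omega(y)$; it is a defining family on $\mathbb{C}^{k_1+k_2}$. $F\widehat{\otimes}_\pi G$ is the completion of $F\otimes G$ endowed with the projective topology, i.e. the strongest locally convex topology for which $(f,g)\mapsto f\otimes g$ is continuous. $\Phi\colon F\times G\to H$ induces a topological isomorphism $F\widehat{\otimes}_\pi G\simeq H$ if the linear mapping $F\otimes_\pi G\to H$, $f\otimes g\mapsto\Phi(f,g)$, is continuous and its continuous extension to $F\widehat{\otimes}_\pi G$ is a topological isomorphism onto $H$. *)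

(* Defs.v *)
From HB Require Import structures.
From mathcomp Require Import all_boot all_order all_algebra.
From mathcomp Require Import interval_inference.
From mathcomp Require Import all_classical all_reals all_analysis.
From mathcomp Require Import measurable_realfun.
From mathcomp Require Import complex.

Set Implicit Arguments.
Unset Strict Implicit.
Unset Printing Implicit Defensive.

Import Order.TTheory GRing.Theory Num.Theory.
Import numFieldNormedType.Exports.

Local Open Scope classical_set_scope.
Local Open Scope ring_scope.

(* Complex numbers and matrices over them get their usual topology. *)
HB.instance Definition _ (R : realType) := NormedModule.copy R[i] R[i]^o.

Section TensorProduct.
Local Open Scope quotient_scope.
Context {K : fieldType} (F G : lmodType K).

Definition is_bilinear (W : lmodType K) (b : F -> G -> W) : Prop :=
  (forall g, linear (b^~ g)) /\ (forall f, linear (b f)).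

Definition tensor_sum (W : lmodType K) (b : F -> G -> W) (s : seq (F * G)) : W :=
  \sum_(p <- s) b p.1 p.2.

(* A finite sequence of pairs (f, g) stands for the sum of the f (x) g; two such
   sums are identified when no bilinear map separates them. *)
Definition tensor_rel (s t : seq (F * G)) : bool :=
  `[< forall (W : lmodType K) (b : F -> G -> W), is_bilinear b ->
        tensor_sum b s = tensor_sum b t >].

Lemma tensor_rel_equiv : equiv_class_of tensor_rel.
Proof.
split=> [s|s t|t s u].
- by apply/asboolP.
- by apply/asboolP/asboolP => h W b bb; rewrite h.
- by move=> /asboolP h1 /asboolP h2; apply/asboolP => W b bb; rewrite h1// h2.
Qed.

Canonical tensor_equiv := EquivRelPack tensor_rel_equiv.

Definition tensor : Type := {eq_quot tensor_equiv}.
HB.instance Definition _ := Choice.on tensor.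
HB.instance Definition _ := EqQuotient.on tensor.

Definition tens (f : F) (g : G) : tensor := \pi_tensor [:: (f, g)].

Definition tensor_lift (W : lmodType K) (b : F -> G -> W) (x : tensor) : W :=
  tensor_sum b (repr x).

Lemma tensor_lift_pi (W : lmodType K) (b : F -> G -> W) s :
  is_bilinear b -> tensor_lift b (\pi_tensor s) = tensor_sum b s.
Proof.
move=> bb; rewrite /tensor_lift.
have /eqmodP/asboolP h : repr (\pi_tensor s) = s %[mod tensor] by rewrite reprK.
exact: h.
Qed.

Lemma tensor_ext (x y : tensor) :
  (forall (W : lmodType K) (b : F -> G -> W), is_bilinear b ->
    tensor_lift b x = tensor_lift b y) -> x = y.
Proof.
move=> h; rewrite -[x]reprK -[y]reprK; apply/eqmodP/asboolP => W b bb.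
exact: h.
Qed.

Definition tensor_zero : tensor := \pi_tensor [::].
Definition tensor_add (x y : tensor) : tensor := \pi_tensor (repr x ++ repr y).
Definition tensor_scale (a : K) (x : tensor) : tensor :=
  \pi_tensor [seq (a *: p.1, p.2) | p <- repr x].
Definition tensor_opp (x : tensor) : tensor := tensor_scale (- 1) x.

Section Lift.
Context (W : lmodType K) (b : F -> G -> W) (bb : is_bilinear b).

Lemma tensor_lift0 : tensor_lift b tensor_zero = 0.
Proof. by rewrite tensor_lift_pi// /tensor_sum big_nil. Qed.

Lemma tensor_liftD x y :
  tensor_lift b (tensor_add x y) = tensor_lift b x + tensor_lift b y.
Proof. by rewrite tensor_lift_pi// /tensor_sum big_cat. Qed.

Lemma tensor_liftZ a x :
  tensor_lift b (tensor_scale a x) = a *: tensor_lift b x.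
Proof.
rewrite tensor_lift_pi// /tensor_sum big_map scaler_sumr; apply: eq_bigr => p _.
have b0 : b 0 p.2 = 0.
  have := bb.1 p.2 (-1) 0 0.
  by rewrite scaler0 addr0 scaleN1r addNr.
by have := bb.1 p.2 a p.1 0; rewrite /= !addr0 b0 addr0.
Qed.

Lemma tensor_lift_tens f g : tensor_lift b (tens f g) = b f g.
Proof. by rewrite tensor_lift_pi// /tensor_sum big_seq1. Qed.
End Lift.

Let tensor_addA : associative tensor_add.
Proof. by move=> x y z; apply: tensor_ext => W b bb; rewrite !tensor_liftD// addrA. Qed.
Let tensor_addC : commutative tensor_add.
Proof. by move=> x y; apply: tensor_ext => W b bb; rewrite !tensor_liftD// addrC. Qed.
Let tensor_add0 : left_id tensor_zero tensor_add.
Proof.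
by move=> x; apply: tensor_ext => W b bb; rewrite tensor_liftD// tensor_lift0// add0r.
Qed.
Let tensor_addN : left_inverse tensor_zero tensor_opp tensor_add.
Proof.
move=> x; apply: tensor_ext => W b bb.
by rewrite tensor_liftD// tensor_liftZ// tensor_lift0// scaleN1r addNr.
Qed.

HB.instance Definition _ := GRing.isZmodule.Build tensor
  tensor_addA tensor_addC tensor_add0 tensor_addN.

Let tensor_scaleA a b x : tensor_scale a (tensor_scale b x) = tensor_scale (a * b) x.
Proof. by apply: tensor_ext => W c bb; rewrite !tensor_liftZ// scalerA. Qed.
Let tensor_scale1 : left_id 1 tensor_scale.
Proof. by move=> x; apply: tensor_ext => W c bb; rewrite !tensor_liftZ// scale1r. Qed.
Let tensor_scaleDr : right_distributive tensor_scale +%R.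
Proof.
move=> a x y; apply: tensor_ext => W c bb.
by rewrite tensor_liftZ// !tensor_liftD// !tensor_liftZ// scalerDr.
Qed.
Let tensor_scaleDl x : {morph tensor_scale^~ x : a b / a + b}.
Proof.
move=> a b; apply: tensor_ext => W c bb.
by rewrite tensor_liftZ// !tensor_liftD// !tensor_liftZ// scalerDl.
Qed.

HB.instance Definition _ := GRing.Zmodule_isLmodule.Build K tensor
  tensor_scaleA tensor_scale1 tensor_scaleDr tensor_scaleDl.

Lemma tensor_lift_linear (W : lmodType K) (b : F -> G -> W) :
  is_bilinear b -> linear (tensor_lift b).
Proof.
by move=> bb a x y; rewrite (tensor_liftD bb) (tensor_liftZ bb).
Qed.

Lemma tens_bilinear : is_bilinear tens.
Proof.
split=> [g|f] a x y; apply: tensor_ext => W b bb;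
  rewrite (tensor_lift_linear bb) !tensor_lift_tens//.
  exact: bb.1.
exact: bb.2.
Qed.

Lemma tensorE (x : tensor) : x = \sum_(p <- repr x) tens p.1 p.2.
Proof.
apply: tensor_ext => W b bb.
transitivity (tensor_sum b (repr x)); first by [].
rewrite /tensor_sum; elim: (repr x) => [|p s IH]; first by rewrite !big_nil (tensor_lift0 bb).
by rewrite !big_cons (tensor_liftD bb) tensor_lift_tens// IH.
Qed.

Lemma tensor_lift_unique (W : lmodType K) (b : F -> G -> W) (u : tensor -> W) :
  linear u -> (forall f g, u (tens f g) = b f g) -> u =1 tensor_lift b.
Proof.
move=> lu ub x; rewrite {1}[x]tensorE /tensor_lift /tensor_sum.
have u0 : u 0 = 0.
  by have := lu (-1) 0 0; rewrite scaler0 addr0 scaleN1r addNr.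
elim: (repr x) => [|p s IH]; first by rewrite !big_nil.
by rewrite !big_cons -{1}[tens _ _]scale1r lu scale1r ub IH.
Qed.

End TensorProduct.

Section ProjectiveTensorProduct.
Local Open Scope convex_scope.
Context {K : numFieldType} (F G : tvsType K).

(* The projective topology, i.e. the strongest locally convex topology for which
   ptens is continuous: it is the supremum of the topologies pulled back along
   the linear maps u into locally convex spaces T such that u \o ptens is
   continuous (any locally convex topology on F (x) G for which ptens is
   continuous is of this form, with u the identity). See ptens_continuous and
   ptensor_universal. *)
Definition ptensor : Type := tensor F G.
HB.instance Definition _ := GRing.Lmodule.on ptensor.

Definition ptens (f : F) (g : G) : ptensor := tens f g.

Definition ptensor_admissible (T : tvsType K) (u : ptensor -> T) : Prop :=
  linear u /\ continuous (fun p : F * G => u (ptens p.1 p.2)).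

Definition ptensor_nbhs (x : ptensor) : set_system ptensor :=
  [set A | exists (T : tvsType K) (u : ptensor -> T), ptensor_admissible u /\
     exists2 U, nbhs (u x) U & u @^-1` U `<=` A].

HB.instance Definition _ := hasNbhs.Build ptensor ptensor_nbhs.

Let admissible_pair (T1 T2 : tvsType K) (u1 : ptensor -> T1) (u2 : ptensor -> T2) :
  ptensor_admissible u1 -> ptensor_admissible u2 ->
  ptensor_admissible (fun x => (u1 x, u2 x)).
Proof.
move=> [l1 c1] [l2 c2]; split=> [a x y|p]; first by rewrite l1 l2.
by apply: cvg_pair; [exact: c1|exact: c2].
Qed.

Let ptensor_nbhs_filter (x : ptensor) : ProperFilter (nbhs x).
Proof.
split.
  by move=> [T [u [_ [U /nbhs_singleton Ux UA]]]]; exact: (UA x).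
split.
- exists (K^o : tvsType K), (fun=> 0); split.
    by split=> [a y z|]; [rewrite scaler0 addr0|exact: cst_continuous].
  by exists setT => //; exact: filterT.
- move=> A B [T1 [u1 [a1 [U1 n1 s1]]]] [T2 [u2 [a2 [U2 n2 s2]]]].
  exists (T1 * T2)%type, (fun x => (u1 x, u2 x)); split.
    exact: admissible_pair.
  exists (U1 `*` U2); first by exists (U1, U2).
  by move=> y [/= h1 h2]; split; [exact: s1|exact: s2].
- move=> A B AB [T [u [a [U n s]]]]; exists T, u; split => //; exists U => //.
  exact: subset_trans AB.
Qed.

Let ptensor_nbhs_singleton (x : ptensor) A : nbhs x A -> A x.
Proof. by move=> [T [u [_ [U /nbhs_singleton Ux UA]]]]; exact: UA. Qed.

Let ptensor_nbhs_nbhs (x : ptensor) A : nbhs x A -> nbhs x (nbhs^~ A).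
Proof.
move=> [T [u [a [U n s]]]]; exists T, u; split => //.
exists (nbhs^~ U); first exact: nbhs_interior.
by move=> y /= ny; exists T, u; split => //; exists U.
Qed.

HB.instance Definition _ := Nbhs_isNbhsTopological.Build ptensor
  ptensor_nbhs_filter ptensor_nbhs_singleton ptensor_nbhs_nbhs.

Lemma ptensor_universal (T : tvsType K) (u : ptensor -> T) : linear u ->
  continuous (fun p : F * G => u (ptens p.1 p.2)) -> continuous u.
Proof. by move=> l c x U nU; exists T, u; split=> //; exists U. Qed.

Lemma ptens_continuous : continuous (fun p : F * G => ptens p.1 p.2).
Proof.
move=> p A [T [u [[_ c] [U n s]]]]; have cU := c p U n.
by apply: (@filterS _ _ (@nbhs_filter _ p) _ _ _ cU) => q; exact: s.
Qed.

Let ptensor_add_continuous : continuous (fun z : ptensor * ptensor => z.1 + z.2).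
Proof.
move=> [x y] A [T [u [[l c] [U /= n s]]]].
have uD a b : u (a + b) = u a + u b.
  by rewrite -{1}[a]scale1r l scale1r.
rewrite uD in n.
have [[/= V1 V2] [n1 n2] V] := @add_continuous T (u x, u y) U n.
exists (u @^-1` V1, u @^-1` V2).
  by split; exists T, u; split=> //; [exists V1|exists V2].
by move=> [a b] [/= ha hb]; apply: s; rewrite /= uD; exact: (V (u a, u b)).
Qed.

Let ptensor_scale_continuous : continuous (fun z : K^o * ptensor => z.1 *: z.2).
Proof.
move=> [k x] A [T [u [[l c] [U /= n s]]]].
have u0 : u 0 = 0.
  by have := l (-1) 0 0; rewrite scaler0 addr0 scaleN1r addNr.
have uZ a b : u (a *: b) = a *: u b by rewrite -[a *: b]addr0 l u0 addr0.
rewrite uZ in n.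
have [[/= V1 V2] [n1 n2] V] := @scale_continuous K T (k, u x) U n.
exists (V1, u @^-1` V2).
  by split=> //; exists T, u; split=> //; exists V2.
by move=> [a b] [/= ha hb]; apply: s; rewrite /= uZ; exact: (V (a, u b)).
Qed.

Let ptensor_locally_convex : exists2 B : set_system ptensor,
  (forall b, b \in B -> convex_set b) & basis B.
Proof.
exists [set b | open b /\ convex_set b]; first by move=> b; rewrite inE => -[].
split=> [b []//|x A [T [u [a [U n s]]]]].
have [B cB [oB bB]] := @locally_convex K T.
have [V [BV Vx] VU] := bB (u x) U n.
exists (u @^-1` V); last by move=> y /= /VU; exact: s.
split=> //; split.
  rewrite openE => y /= Vy; exists T, u; split => //; exists V => //.
  by apply: open_nbhs_nbhs; split=> //; exact: oB.
move=> y z k; rewrite !inE /= => Vy Vz.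
have -> : u (y <|k|> z) = (u y : convex_lmodType T) <| k |> u z.
  rewrite /conv/= /isConvexSpace.conv/=.
  have u0 : u 0 = 0.
    by have := a.1 (-1) 0 0; rewrite scaler0 addr0 scaleN1r addNr.
  have uZ c d : u (c *: d) = c *: u d by rewrite -[c *: d]addr0 a.1 u0 addr0.
  by rewrite a.1 uZ.
by apply/set_mem/cB; rewrite inE.
Qed.

HB.instance Definition _ := PreTopologicalLmod_isTvs.Build K ptensor
  ptensor_add_continuous ptensor_scale_continuous ptensor_locally_convex.
HB.instance Definition _ :=
  PreTopologicalNmodule_isTopologicalNmodule.Build ptensor ptensor_add_continuous.
HB.instance Definition _ :=
  TopologicalNmodule_isTopologicalLmodule.Build K ptensor ptensor_scale_continuous.
HB.instance Definition _ := Uniform_isTvs.Build K ptensor ptensor_locally_convex.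

End ProjectiveTensorProduct.

Section Completion.
Context {K : numFieldType}.

(* The uniformity of a tvsType is only required to be compatible with its
   topology, not to be translation invariant; hence the explicit formulation of
   Cauchy filters in terms of neighborhoods of 0. *)
Definition tvs_cauchy (E : tvsType K) (F : set_system E) : Prop :=
  forall U, nbhs (0 : E) U -> \forall x & y \near F, U (x - y).

Definition tvs_complete (E : tvsType K) : Prop :=
  forall F : set_system E, ProperFilter F -> tvs_cauchy F ->
    exists x : E, F --> x.

Definition top_embedding (S T : topologicalType) (i : S -> T) : Prop :=
  injective i /\
  forall (x : S) (A : set S),
    nbhs x A <-> exists2 U, nbhs (i x) U & i @^-1` U `<=` A.

Definition is_completion (E Ehat : tvsType K) (i : E -> Ehat) : Prop :=
  [/\ hausdorff_space Ehat, tvs_complete Ehat, linear i, top_embedding i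
    & dense (range i)].

Definition top_iso (E F : tvsType K) (u : E -> F) : Prop :=
  [/\ linear u, continuous u
    & exists v : F -> E, [/\ continuous v, cancel u v & cancel v u]].

(* The completion is only determined up to a unique isomorphism: the last clause
   is stated for every completion, and the existence of one is asserted so that
   this clause is not vacuous. The maps L and u are unique, as the elementary
   tensors span and the range of i is dense. *)
Definition induces_top_iso (F G H : tvsType K) (Phi : F -> G -> H) : Prop :=
  exists L : ptensor F G -> H,
    [/\ linear L, forall f g, L (ptens f g) = Phi f g, continuous L,
      exists (E : tvsType K) (i : ptensor F G -> E), is_completion i
      & forall (E : tvsType K) (i : ptensor F G -> E), is_completion i ->
          exists u : E -> H, (forall x, u (i x) = L x) /\ top_iso u].

End Completion.

Section LebesgueMeasure.
Context (R : realType).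

Definition tuple_snoc n
    (p : n.-tuple (measurableTypeR R) * measurableTypeR R) :
  n.+1.-tuple (measurableTypeR R) := [tuple of p.2 :: p.1].

Lemma measurable_tuple_snoc n : measurable_fun [set: _] (@tuple_snoc n).
Proof. exact: (measurable_cons (f := snd) (g := fst)). Qed.

(* Lebesgue measure on the Borel sets of R^n. The long constant is the library's
   bundling of pushforward as a measure: in the successor case it is the image
   of the product measure under tuple_snoc. *)
Fixpoint lebesgue_tuple n :
    {measure set (n.-tuple (measurableTypeR R)) -> \bar R} :=
  match n with
  | 0 => dirac [tuple]
  | m.+1 => measure_function_pushforward__canonical__measure_function_Measure
      (lebesgue_tuple m \x (@lebesgue_measure R))%E (@measurable_tuple_snoc m)
  end.

(* C^k is identified with R^2k by listing the real parts and then the imaginary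
   parts of the coordinates. *)
Definition complex_of_tuple k (x : (k + k).-tuple (measurableTypeR R)) :
    'rV[R[i]]_k :=
  \row_j (tnth x (lshift k j) +i* tnth x (rshift k j))%C.

(* Lebesgue (not merely Borel) measurability: preimages of Borel sets are in the
   completion of the Borel sigma-algebra. *)
Definition lebesgue_measurable_fun k (f : 'rV[R[i]]_k -> R) : Prop :=
  forall Y : set (measurableTypeR R), measurable Y ->
    completed_algebra_gen (lebesgue_tuple (k + k))
      ((f \o @complex_of_tuple k) @^-1` Y).

(* The integral of a nonnegative function is the supremum of the integrals of
   the Borel simple functions below it, which for a Lebesgue measurable function
   is also its integral for the completed measure. *)
Definition lebesgue_summable k (f : 'rV[R[i]]_k -> R) : Prop :=
  lebesgue_measurable_fun f /\
  (\int[lebesgue_tuple (k + k)]_x `|f (complex_of_tuple x)|%:E < +oo)%E.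

End LebesgueMeasure.

Section DefiningFamily.
Context {R : realType} {Gam : Type} {k : nat}.
Variable M : Gam -> 'rV[R[i]]_k -> {nonneg R}.

(* Nonnegativity is part of the type of M. *)
Record defining_family : Prop := DefiningFamily {
  df_measurable : forall c, lebesgue_measurable_fun (fun z => (M c z)%:num) ;
  df_bounded : forall c (A : set 'rV[R[i]]_k), bounded_set A ->
    exists b : R, forall z, A z -> (M c z)%:num <= b ;
  df_directed : forall c1 c2, exists c, exists2 a : R, 0 < a &
    forall z, a * ((M c1 z)%:num + (M c2 z)%:num) <= (M c z)%:num ;
  df_countable : exists2 G' : set Gam, countable G' &
    forall c, exists2 c', G' c' & exists2 a : R, 0 < a &
      forall z, a * (M c z)%:num <= (M c' z)%:num ;
  df_nondegenerate : forall z : 'rV[R[i]]_k,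
    exists c, exists2 O : set 'rV[R[i]]_k, nbhs z O &
    exists2 a : R, 0 < a & forall z', O z' -> a <= (M c z')%:num
}.

Definition condition_I : Prop :=
  forall c, exists c', exists L : 'rV[R[i]]_k -> {nonneg R},
    [/\ lebesgue_summable (fun z => (L z)%:num),
      forall z, (M c z)%:num <= (L z)%:num * (M c' z)%:num
      & forall e : R, 0 < e -> exists A : R,
          forall z : 'rV[R[i]]_k, A%:C%C < `|z| -> (L z)%:num < e].

Definition condition_II : Prop :=
  forall c, exists c', exists2 B : set 'rV[R[i]]_k, nbhs (0 : 'rV[R[i]]_k) B &
    exists2 a : R, 0 < a &
      forall z z', B z' -> (M c z)%:num <= a * (M c' (z + z'))%:num.

End DefiningFamily.

Section EntireFunctionSpace.
Context {R : realType}.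
Notation C := R[i].

(* Differentiability is over R[i], i.e. f is holomorphic on the whole of C^k. *)
Definition entire k (f : 'rV[C]_k -> C) : Prop := forall z, differentiable f z.

(* The norm of R[i] takes its values in R[i]. *)
Definition cmod (z : C) : R := complex.Re `|z|.

Lemma cmodE z : `|z| = (cmod z)%:C%C.
Proof. by rewrite /cmod normc_def. Qed.
Lemma cmod_ge0 z : 0 <= cmod z.
Proof. by rewrite -lecR -cmodE; exact: normr_ge0. Qed.
Lemma cmodD x y : cmod (x + y) <= cmod x + cmod y.
Proof. by rewrite -lecR rmorphD /= -!cmodE ler_normD. Qed.
Lemma cmodM x y : cmod (x * y) = cmod x * cmod y.
Proof. by apply: (@complexI R); rewrite rmorphM /= -!cmodE normrM. Qed.
Lemma cmod0 : cmod 0 = 0.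
Proof. by apply: (@complexI R); rewrite -cmodE normr0. Qed.

Section Space.
Context {Gam : Type} {k : nat} (M : Gam -> 'rV[C]_k -> {nonneg R}).

Definition hvalues (c : Gam) (f : 'rV[C]_k -> C) : set R := range (fun z => (M c z)%:num * cmod (f z)).

Definition hnorm (c : Gam) (f : 'rV[C]_k -> C) : R := sup (hvalues c f).

Definition in_hspace (f : 'rV[C]_k -> C) : Prop := entire f /\ forall c, has_ubound (hvalues c f).

Definition hpred : {pred 'rV[C]_k -> C} := fun f => `[< in_hspace f >].

Lemma hpred_submod : submod_closed hpred.
Proof.
split.
  apply/asboolP; split=> [z|c]; first exact: differentiable_cst.
  by exists 0 => _ [z _ <-]; rewrite cmod0 mulr0.
move=> a f g /asboolP[hf bf] /asboolP[hg bg]; apply/asboolP; split=> [z|c].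
  by apply: differentiableD; [exact: differentiableZ|].
have [A hA] := bf c; have [B hB] := bg c.
exists (cmod a * A + B) => _ [z _ <-].
apply: (@le_trans _ _ ((M c z)%:num * (cmod a * cmod (f z) + cmod (g z)))).
  by rewrite ler_wpM2l// -cmodM cmodD.
rewrite mulrDr lerD//; last by apply: hB; exists z.
rewrite mulrCA ler_wpM2l ?cmod_ge0//.
by apply: hA; exists z.
Qed.

HB.instance Definition _ :=
  GRing.isSubmodClosed.Build C ('rV[C]_k -> C) hpred hpred_submod.

Record hspace := HSpace { hfun :> 'rV[C]_k -> C ; hfunP : hfun \in hpred }.
HB.instance Definition _ := [isSub for hfun].
HB.instance Definition _ := [Choice of hspace by <:].
HB.instance Definition _ := [SubChoice_isSubLmodule of hspace by <:].

Lemma hspaceP (f : hspace) : in_hspace f.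
Proof. by have /asboolP := hfunP f. Qed.

Implicit Types (s : seq Gam) (f g h : hspace).

(* Finite families of seminorms are handled through their maximum. *)
Definition hseminorm s h : R := \big[Num.max/0]_(c <- s) hnorm c h.

Lemma hnorm_ub c h z : (M c z)%:num * cmod (h z) <= hnorm c h.
Proof. by apply: ub_le_sup; [have [_] := hspaceP h|exists z]. Qed.

Lemma hnorm_le c h B :
  (forall z, (M c z)%:num * cmod (h z) <= B) -> hnorm c h <= B.
Proof. by move=> hB; apply: ge_sup => [|_ [z _ <-]//]; exists ((M c 0)%:num * cmod (h 0)), 0. Qed.

Lemma hnormD c h1 h2 : hnorm c (h1 + h2) <= hnorm c h1 + hnorm c h2.
Proof.
apply: hnorm_le => z; apply: le_trans (lerD (hnorm_ub c h1 z) (hnorm_ub c h2 z)).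
by rewrite -mulrDr ler_wpM2l// cmodD.
Qed.

Lemma hnorm_ge0 c h : 0 <= hnorm c h.
Proof. by apply: le_trans (hnorm_ub c h 0); rewrite mulr_ge0// cmod_ge0. Qed.

Lemma hnormZ_le c a h : hnorm c (a *: h) <= cmod a * hnorm c h.
Proof.
apply: hnorm_le => z; rewrite cmodM mulrCA.
by rewrite ler_wpM2l ?cmod_ge0// hnorm_ub.
Qed.

Lemma hseminorm_ge0 s h : 0 <= hseminorm s h.
Proof.
by rewrite /hseminorm; elim/big_rec: _ => // c x _ x0; rewrite le_max x0 orbT.
Qed.

Lemma hseminormD s h1 h2 :
  hseminorm s (h1 + h2) <= hseminorm s h1 + hseminorm s h2.
Proof.
rewrite /hseminorm; elim: s => [|c s IH]; first by rewrite !big_nil addr0.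
rewrite !big_cons ge_max; apply/andP; split.
  by apply: (le_trans (hnormD _ _ _)); apply: lerD; rewrite le_max lexx.
by apply: (le_trans IH); apply: lerD; rewrite le_max lexx orbT.
Qed.

Lemma hseminormZ_le s a h : hseminorm s (a *: h) <= cmod a * hseminorm s h.
Proof.
rewrite /hseminorm; elim: s => [|c s IH]; first by rewrite !big_nil mulr0.
rewrite !big_cons maxr_pMr ?cmod_ge0// ge_max.
apply/andP; split; first by apply: (le_trans (hnormZ_le _ _ _)); rewrite le_max lexx.
by apply: (le_trans IH); rewrite le_max lexx orbT.
Qed.

Lemma hseminorm0 s : hseminorm s 0 = 0.
Proof.
apply/le_anti; rewrite hseminorm_ge0 andbT.
by have := hseminormZ_le s 0 0; rewrite scale0r cmod0 mul0r.
Qed.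

Lemma hseminorm_cat s t h :
  hseminorm (s ++ t) h = Num.max (hseminorm s h) (hseminorm t h).
Proof.
rewrite /hseminorm; elim: s => [|c s IH]; last by rewrite /= !big_cons IH maxA.
by rewrite big_nil /=; apply/esym/max_idPr; exact: hseminorm_ge0.
Qed.

Definition hball s (e : R) h : set hspace := [set g | hseminorm s (g - h) < e].

Definition hspace_nbhs h : set_system hspace :=
  [set A | exists s, exists2 e : R, 0 < e & hball s e h `<=` A].

HB.instance Definition _ := hasNbhs.Build hspace hspace_nbhs.

Lemma hballxx s e h : 0 < e -> hball s e h h.
Proof. by move=> e0; rewrite /hball /= subrr hseminorm0. Qed.

Lemma hball_sub s e h g : hball s e h g ->
  hball s (e - hseminorm s (g - h)) g `<=` hball s e h.
Proof.
move=> hg f; rewrite /hball /= ltrBrDr; apply: le_lt_trans.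
have -> : f - h = (f - g) + (g - h) by rewrite addrA subrK.
exact: hseminormD.
Qed.

Let hspace_nbhs_filter h : ProperFilter (nbhs h).
Proof.
split; first by move=> [s [e e0]] /(_ _ (hballxx s h e0)).
split.
- by exists [::], 1.
- move=> A B [s [e e0 sA]] [t [d d0 tB]].
  exists (s ++ t), (Num.min e d); first by rewrite lt_min e0.
  move=> g; rewrite /hball /= hseminorm_cat gt_max !lt_min.
  by move=> /andP[/andP[? _] /andP[_ ?]]; split; [exact: sA|exact: tB].
- move=> A B AB [s [e e0 sA]]; exists s, e => //; exact: subset_trans AB.
Qed.

Let hspace_nbhs_singleton h A : nbhs h A -> A h.
Proof. by move=> [s [e e0]]; apply; exact: hballxx. Qed.

Lemma hball_nbhs s e h g : hball s e h g -> nbhs g (hball s e h).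
Proof.
move=> hg; exists s, (e - hseminorm s (g - h)); first by rewrite subr_gt0.
exact: hball_sub.
Qed.

Let hspace_nbhs_nbhs h A : nbhs h A -> nbhs h (nbhs^~ A).
Proof.
move=> [s [e e0 sA]]; exists s, e => // g hg.
by have [t [d d0 hd]] := hball_nbhs hg; exists t, d => //; exact: subset_trans sA.
Qed.

HB.instance Definition _ := Nbhs_isNbhsTopological.Build hspace
  hspace_nbhs_filter hspace_nbhs_singleton hspace_nbhs_nbhs.

Let hspace_add_continuous : continuous (fun z : hspace * hspace => z.1 + z.2).
Proof.
move=> [x y] A [s [e e0 sA]].
have e20 : 0 < e / 2 by rewrite divr_gt0.
exists (hball s (e / 2) x, hball s (e / 2) y).
  by split; apply: hball_nbhs; exact: hballxx.
move=> [a b] [/= ha hb]; apply: sA; rewrite /hball /= opprD addrACA.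
by apply: (le_lt_trans (hseminormD _ _ _)); rewrite [e]splitr ltrD.
Qed.

Let hspace_scale_continuous : continuous (fun z : C^o * hspace => z.1 *: z.2).
Proof.
move=> [a x] A [s [e e0 sA]].
pose N := hseminorm s x + 1.
have N0 : 0 < N by rewrite ltr_pwDr// hseminorm_ge0.
pose d := Num.min 1 (e / 2 / N).
have d0 : 0 < d by rewrite lt_min ltr01 !divr_gt0.
pose m := cmod a + 1.
have m0 : 0 < m by rewrite ltr_pwDr// cmod_ge0.
exists (ball (a : C^o) d%:C%C, hball s (e / 2 / m) x).
  split; first by apply: nbhsx_ballx; rewrite ltcR.
  by apply: hball_nbhs; apply: hballxx; rewrite !divr_gt0.
move=> [b y] [/= hb hy]; apply: sA; rewrite /hball /=.
have {}hb : cmod (b - a) < d.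
  by move: hb; rewrite -ball_normE /ball_ /= distrC cmodE ltcR.
have -> : b *: y - a *: x = b *: (y - x) + (b - a) *: x.
  by rewrite scalerBr scalerBl addrA subrK.
apply: (le_lt_trans (hseminormD _ _ _)); rewrite [e]splitr ltr_leD//.
  apply: (le_lt_trans (hseminormZ_le _ _ _)).
  have hbm : cmod b <= m.
    have -> : b = a + (b - a) by rewrite addrC subrK.
    apply: (le_trans (cmodD _ _)); rewrite lerD2l.
    by apply/ltW/(lt_le_trans hb); rewrite ge_min lexx.
  apply: (@le_lt_trans _ _ (m * hseminorm s (y - x))).
    by rewrite ler_wpM2r// hseminorm_ge0.
  by rewrite mulrC -ltr_pdivlMr.
apply: (le_trans (hseminormZ_le _ _ _)).
apply: (@le_trans _ _ (d * N)); last first.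
  by rewrite -ler_pdivlMr// ge_min lexx orbT.
by apply: ler_pM; rewrite ?cmod_ge0 ?hseminorm_ge0 ?lerDl// ltW.
Qed.

Local Open Scope convex_scope.
Let hspace_locally_convex : exists2 B : set_system hspace,
  (forall b, b \in B -> convex_set b) & basis B.
Proof.
exists [set b | exists s e h, b = hball s e h].
  move=> b; rewrite inE => -[s [e [h ->]]] x y l; rewrite !inE /hball /= => hx hy.
  have l0 : 0 <= l%:num by [].
  have l1 : 0 <= 1 - l%:num by rewrite subr_ge0.
  have cl c : 0 <= c -> c = (cmod c)%:C%C by move=> c0; rewrite -cmodE ger0_norm.
  have -> : (x <|l|> y) - h = l%:num *: (x - h) + (1 - l%:num) *: (y - h).
    rewrite !scalerBr addrACA -opprD -scalerDl.
    by rewrite [l%:num + _]addrC subrK scale1r.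
  apply: (le_lt_trans (hseminormD _ _ _)).
  apply: (@le_lt_trans _ _ (cmod l%:num * hseminorm s (x - h) +
      cmod (1 - l%:num) * hseminorm s (y - h))).
    by apply: lerD; exact: hseminormZ_le.
  have l1E : cmod l%:num + cmod (1 - l%:num) = 1.
    apply: (@complexI R); rewrite rmorphD /= -!cl//.
    by rewrite addrC subrK.
  set a := hseminorm s (x - h) in hx *; set b' := hseminorm s (y - h) in hy *.
  apply: (@le_lt_trans _ _ (Num.max a b')); last by rewrite gt_max hx.
  rewrite -[leRHS]mul1r -l1E mulrDl.
  by apply: lerD; rewrite ler_wpM2l ?cmod_ge0// le_max lexx ?orbT.
split; first by move=> _ [s [e [h ->]]]; rewrite openE => g; exact: hball_nbhs.
move=> h A [s [e e0 sA]]; exists (hball s e h) => //.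
by split; [exists s, e, h|exact: hballxx].
Qed.

HB.instance Definition _ := PreTopologicalLmod_isTvs.Build C hspace
  hspace_add_continuous hspace_scale_continuous hspace_locally_convex.
HB.instance Definition _ :=
  PreTopologicalNmodule_isTopologicalNmodule.Build hspace hspace_add_continuous.
HB.instance Definition _ :=
  TopologicalNmodule_isTopologicalLmodule.Build C hspace hspace_scale_continuous.
HB.instance Definition _ := Uniform_isTvs.Build C hspace hspace_locally_convex.

End Space.

Context {Gam Om : Type} {k1 k2 : nat}.
Context (M : Gam -> 'rV[C]_k1 -> {nonneg R}) (N : Om -> 'rV[C]_k2 -> {nonneg R}).

Definition family_tensor (i : Gam * Om) (z : 'rV[C]_(k1 + k2)) : {nonneg R} :=
  ((M i.1 (lsubmx z))%:num * (N i.2 (rsubmx z))%:num)%:nng.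

Definition hprod_fun (f : hspace M) (g : hspace N) : 'rV[C]_(k1 + k2) -> C :=
  fun z => f (lsubmx z) * g (rsubmx z).

Lemma hprod_subproof f g : hprod_fun f g \in hpred family_tensor.
Proof.
have [ef bf] := hspaceP f; have [eg bg] := hspaceP g.
apply/asboolP; split=> [z|[c d]].
  apply: differentiableM.
    by apply: differentiable_comp; [exact: differentiable_lsubmx|exact: ef].
  by apply: differentiable_comp; [exact: differentiable_rsubmx|exact: eg].
exists (hnorm M c f * hnorm N d g) => _ [z _ <-].
rewrite /hprod_fun cmodM /= mulrACA.
by apply: ler_pM; rewrite ?mulr_ge0 ?cmod_ge0 ?hnorm_ub.
Qed.

Definition hprod (f : hspace M) (g : hspace N) : hspace family_tensor :=
  HSpace (hprod_subproof f g).

End EntireFunctionSpace.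

(* Main.v *)
(* The space H(M) is nuclear in the following concrete form.  On a small polydisc a
   holomorphic function is, up to an arbitrarily small error, the sum of its Newton
   interpolation terms, whose coefficients are finite combinations of values of
   the function and decay geometrically.  Doing this around the points of a lattice
   and using (II), (I), (II), one gets functionals psi_j, finite combinations of
   point evaluations, and summable weights w_j such that |psi_j f| <= w_j |f|_c' and
   |f|_c <= sum_j w_j |psi_j f|.
   For f in a finite-dimensional space, orthonormalising the vectors
   (sqrt(w_j) psi_j f)_j gives a finite-rank map sum_n phi_n(.) u_n which is the
   identity on that space modulo |.|_c, with sum_n |phi_n|_c' |u_n|_c bounded
   independently of the space.
   Applied to the f_i, it rewrites h = sum_i f_i (x) g_i as sum_n u_n (x) g'_n, where
   g'_n(y) = phi_n(h(., y)) has |g'_n|_d <= |phi_n|_c' |h|_(c', d): every neighborhood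
   of 0 for the projective topology contains a neighborhood for that of H(M (x) N).
   Applied to a finite net of the precompact set of the N_d(y) h(., y), it shows
   that the finite sums of products are dense.  As H(M (x) N) is complete and
   Hausdorff, it is a completion, and completions are unique. *)

Require Import Defs.
From HB Require Import structures.
From mathcomp Require Import all_boot all_order all_algebra.
From mathcomp Require Import interval_inference.
From mathcomp Require Import all_classical all_reals all_analysis.
From mathcomp Require Import measurable_realfun.
From mathcomp Require Import complex.
From mathcomp Require Import spectral.
From mathcomp Require Import sesquilinear.
From mathcomp Require Import ring lra.

Set Implicit Arguments.
Unset Strict Implicit.
Unset Printing Implicit Defensive.

Import Order.TTheory GRing.Theory Num.Theory.
Import numFieldNormedType.Exports.

Local Open Scope classical_set_scope.
Local Open Scope ring_scope.

Local Notation Re := complex.Re.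
Local Notation Im := complex.Im.

(** * Green's formula and the maximum principle *)

Section SegmentIntegral.
Context {R : realType}.
Implicit Types (f g : R -> R) (a b c : R).

(** The projective topology is given only through the linear maps that it makes continuous, so an
    approximate expansion of a tensor is hard to control in it. The maps built from nuclearity are
    therefore exact, up to vectors of zero seminorm, on the finitely many first factors at hand, and
    in return their bound must not depend on how many these are. Orthonormalisation achieves this:
    in a matrix with orthonormal rows every column has norm at most 1, whatever the number of rows.

    The functionals are finite combinations of point evaluations so that applying one to [h(., y)]
    visibly gives an entire function of [y], without integrals depending on a parameter. This is why
    divided differences take the place of Taylor coefficients. A divided difference is continuous at
    its node, but its differentiability there would be a theorem on removable singularities; so the
    maximum principle is proved for continuous functions that are differentiable outside a finite
    set. It rests on Goursat's bisection, as the derivative is not assumed continuous. *)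

Definition sint a b f : R := \int[lebesgue_measure]_(x in `[a, b]) f x.

Definition cont_on a b f := forall x, a <= x <= b -> {for x, continuous f}.

Lemma cont_on_integrable a b f : cont_on a b f ->
  lebesgue_measure.-integrable `[a, b] (EFin \o f).
Proof.
move=> cf; apply: continuous_compact_integrable; first exact: segment_compact.
apply: continuous_in_subspaceT => x; rewrite inE /= in_itv /= => hx.
exact: cf.
Qed.

Lemma cont_onS a b a' b' f : a <= a' -> b' <= b -> cont_on a b f -> cont_on a' b' f.
Proof.
by move=> aa bb cf x /andP[ax xb]; apply: cf; rewrite (le_trans aa)// (le_trans xb).
Qed.

Lemma cont_onB a b f g : cont_on a b f -> cont_on a b g ->
  cont_on a b (fun x => f x - g x).
Proof. by move=> cf cg x hx; apply: continuousB; [exact: cf|exact: cg]. Qed.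

Lemma sintB a b f g : cont_on a b f -> cont_on a b g ->
  sint a b (fun x => f x - g x) = sint a b f - sint a b g.
Proof. by move=> cf cg; apply: RintegralB => //; exact: cont_on_integrable. Qed.

Lemma sint_split a b c f : a <= c <= b -> cont_on a b f ->
  sint a b f = sint a c f + sint c b f.
Proof.
move=> /andP[ac cb] cf; rewrite /sint.
have itg : lebesgue_measure.-integrable `[a, b] (EFin \o f).
  exact: cont_on_integrable.
have := @Rintegral_itvB R f (BLeft a) (BRight b) c itg.
rewrite !bnd_simp => /(_ ac cb) E.
rewrite -(@Rintegral_itv_obnd_cbnd R c).
  by rewrite -E addrC subrK.
apply: (integrableS _ _ _ itg) => // x /=; rewrite !in_itv /= => /andP[h ->].
by rewrite (le_trans ac (ltW h)).
Qed.

Lemma sint_cst a b m : a <= b -> sint a b (fun=> m) = m * (b - a).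
Proof.
move=> ab; rewrite /sint Rintegral_cst//=.
by rewrite lebesgue_measure_itv /= lte_fin; case: ltgtP ab => //= [<- _]; rewrite subrr.
Qed.

Lemma sint_le a b f g : cont_on a b f -> cont_on a b g ->
  (forall x, a <= x <= b -> f x <= g x) -> sint a b f <= sint a b g.
Proof.
move=> cf cg fg; apply: le_Rintegral => //; try exact: cont_on_integrable.
Qed.

Lemma cont_on_cst a b (m : R) : cont_on a b (fun=> m).
Proof. by move=> x _; exact: cst_continuous. Qed.

Lemma sint_near a b f m e : a <= b -> cont_on a b f ->
  (forall x, a <= x <= b -> `|f x - m| <= e) ->
  `|sint a b f - m * (b - a)| <= e * (b - a).
Proof.
move=> ab cf h; rewrite ler_distl -mulrBl -mulrDl -!sint_cst//.
apply/andP; split; apply: sint_le => //; try exact: cont_on_cst.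
  by move=> x /h; rewrite ler_distl => /andP[].
by move=> x /h; rewrite ler_distl => /andP[].
Qed.

End SegmentIntegral.

(** * Green's formula on rectangles by Goursat's bisection *)

Section Green.
Context {R : realType} (u v : R -> R -> R).

(** The Cauchy-Riemann equation du/ds = dv/dt at (s, t), with common value [al], as a first-order
    estimate on the sides of the small rectangles that contain the point; no derivative at another
    point occurs. *)
Definition green_pt (s t : R) := exists al : R, forall e, 0 < e ->
  exists2 d : R, 0 < d & forall s1 s2 t1 t2,
    s1 <= s <= s2 -> t1 <= t <= t2 -> s2 - s1 <= d -> t2 - t1 <= d ->
    (forall t', t1 <= t' <= t2 ->
      `|u s2 t' - u s1 t' - al * (s2 - s1)| <= e * ((s2 - s1) + (t2 - t1))) /\
    (forall s', s1 <= s' <= s2 ->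
      `|v s' t2 - v s' t1 - al * (t2 - t1)| <= e * ((s2 - s1) + (t2 - t1))).

(** The imaginary part of the integral of (u + i v) dz along the boundary; formally the integral of
    du/ds - dv/dt over the rectangle. *)
Definition flux (a b c d : R) : R :=
  sint c d (fun t => u b t - u a t) - sint a b (fun s => v s d - v s c).

Definition green_rect a b c d := forall s t, a <= s <= b -> c <= t <= d ->
  [/\ {for t, continuous (u s)}, {for s, continuous (v^~ t)} & green_pt s t].

Lemma green_rectS a b c d a' b' c' d' : a <= a' -> b' <= b -> c <= c' -> d' <= d ->
  green_rect a b c d -> green_rect a' b' c' d'.
Proof.
move=> aa bb cc dd g s t /andP[s1 s2] /andP[t1 t2].
by apply: g; apply/andP; split; apply: le_trans; eassumption.
Qed.

Lemma flux_splitl a b c d m : a <= m <= b -> c <= d -> green_rect a b c d ->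
  flux a b c d = flux a m c d + flux m b c d.
Proof.
move=> /[dup] amb /andP[am mb] cd g; rewrite /flux.
have ab := le_trans am mb.
have cu s : a <= s <= b -> cont_on c d (u s) by move=> hs t ht; have [] := g s t hs ht.
have cv t : c <= t <= d -> cont_on a b (v^~ t) by move=> ht s hs; have [] := g s t hs ht.
rewrite (sint_split amb); last by apply: cont_onB; apply: cv; rewrite lexx ?cd.
rewrite !sintB; try by apply: cu; rewrite ?lexx ?am ?mb ?ab.
  ring.
all: apply: (@cont_onS _ a b); rewrite ?lexx//; apply: cv; by rewrite ?lexx ?cd.
Qed.

Lemma flux_splitr a b c d m : c <= m <= d -> a <= b -> green_rect a b c d ->
  flux a b c d = flux a b c m + flux a b m d.
Proof.
move=> /[dup] cmd /andP[cm md] ab g; rewrite /flux.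
have cd := le_trans cm md.
have cu s : a <= s <= b -> cont_on c d (u s) by move=> hs t ht; have [] := g s t hs ht.
have cv t : c <= t <= d -> cont_on a b (v^~ t) by move=> ht s hs; have [] := g s t hs ht.
rewrite (sint_split cmd); last by apply: cont_onB; apply: cu; rewrite lexx ?ab.
rewrite !sintB; try by apply: cv; rewrite ?lexx ?cm ?md ?cd.
  ring.
all: apply: (@cont_onS _ c d); rewrite ?lexx//; apply: cu; by rewrite ?lexx ?ab.
Qed.

(** The leading terms of the two integrals are both [al] times the area and cancel; what is left is
    the error of [green_pt] integrated over the sides. *)
Lemma flux_small a b c d s t e : a <= s <= b -> c <= t <= d ->
  green_rect a b c d -> green_pt s t -> 0 < e ->
  exists2 de : R, 0 < de & forall a' b' c' d',
    a <= a' -> b' <= b -> c <= c' -> d' <= d ->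
    a' <= s <= b' -> c' <= t <= d' -> b' - a' <= de -> d' - c' <= de ->
    `|flux a' b' c' d'| <= e * ((b' - a') + (d' - c')) ^+ 2.
Proof.
move=> hs ht g [al hal] e0; have [de de0 H] := hal e e0.
exists de => // a' b' c' d' aa bb cc dd hs' ht' wd hd.
have {}g := green_rectS aa bb cc dd g.
have ab : a' <= b' by case/andP: hs' => /le_trans h /h.
have cd : c' <= d' by case/andP: ht' => /le_trans h /h.
have [Hu Hv] := H _ _ _ _ hs' ht' wd hd.
have cu s' : a' <= s' <= b' -> cont_on c' d' (u s').
  by move=> hs1 t1 ht1; have [] := g s' t1 hs1 ht1.
have cv t' : c' <= t' <= d' -> cont_on a' b' (v^~ t').
  by move=> ht1 s1 hs1; have [] := g s1 t' hs1 ht1.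
have E1 := sint_near cd (cont_onB (cu b' _) (cu a' _)) Hu.
have E2 := sint_near ab (cont_onB (cv d' _) (cv c' _)) Hv.
rewrite !lexx ab in E1; rewrite !lexx cd in E2.
have {}E1 := E1 isT isT; have {}E2 := E2 isT isT.
set w := b' - a' in E1 E2 *; set h := d' - c' in E1 E2 *.
rewrite /flux.
set I1 := sint _ _ _ in E1 *; set I2 := sint _ _ _ in E2 *.
have -> : I1 - I2 = (I1 - al * w * h) - (I2 - al * h * w) by ring.
apply: (le_trans (ler_normB _ _)); apply: (le_trans (lerD E1 E2)).
by rewrite le_eqVlt; apply/orP; left; apply/eqP; ring.
Qed.

Lemma flux_quarter a w c h B : 0 <= w -> 0 <= h ->
  green_rect a (a + (w + w)) c (c + (h + h)) ->
  `|flux a (a + w) c (c + h)| <= B ->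
  `|flux a (a + w) (c + h) (c + h + h)| <= B ->
  `|flux (a + w) (a + w + w) c (c + h)| <= B ->
  `|flux (a + w) (a + w + w) (c + h) (c + h + h)| <= B ->
  `|flux a (a + (w + w)) c (c + (h + h))| <= 4 * B.
Proof.
move=> w0 h0; rewrite !addrA => g A1 A2 A3 A4.
have aw : a <= a + w by rewrite lerDl.
have aww : a + w <= a + w + w by rewrite lerDl.
have ch : c <= c + h by rewrite lerDl.
have chh : c + h <= c + h + h by rewrite lerDl.
rewrite (@flux_splitl _ _ _ _ (a + w))//; last 2 first.
- by rewrite aw.
- exact: le_trans chh.
rewrite (@flux_splitr a (a + w) _ _ (c + h))//; last 2 first.
- by rewrite ch.
- exact: green_rectS g.
rewrite (@flux_splitr (a + w) (a + w + w) _ _ (c + h))//; last 2 first.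
- by rewrite ch.
- exact: green_rectS g.
set x1 := flux _ _ _ _ in A1 *; set x2 := flux _ _ _ _ in A2 *.
set x3 := flux _ _ _ _ in A3 *; set x4 := flux _ _ _ _ in A4 *.
have T1 := ler_normD (x1 + x2) (x3 + x4).
have T2 := ler_normD x1 x2; have T3 := ler_normD x3 x4.
move: x1 x2 x3 x4 A1 A2 A3 A4 T1 T2 T3 => x1 x2 x3 x4.
clear; lra.
Qed.

Lemma green a b c d : a <= b -> c <= d -> green_rect a b c d -> flux a b c d = 0.
Proof.
move=> ab cd g; apply/eqP; rewrite -normr_le0 leNgt; apply/negP => f0.
(* With this constant the whole rectangle violates the bound of [flux_small]. The + 1 keeps the
   denominator positive for a degenerate rectangle. *)
set e := `|flux a b c d| / (2 * ((b - a) + (d - c) + 1) ^+ 2).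
have S0 : 0 < (b - a) + (d - c) + 1 by rewrite ltr_wpDl// addr_ge0 ?subr_ge0.
have e0 : 0 < e by rewrite divr_gt0// mulr_gt0// exprn_gt0.
pose w n : R := (b - a) / 2 ^+ n; pose h n : R := (d - c) / 2 ^+ n.
have w0 n : 0 <= w n by rewrite divr_ge0 ?subr_ge0 ?exprn_ge0.
have h0 n : 0 <= h n by rewrite divr_ge0 ?subr_ge0 ?exprn_ge0.
have wS n : w n = w n.+1 + w n.+1.
  by rewrite /w exprS; field; rewrite expf_neq0 ?pnatr_eq0.
have hS n : h n = h n.+1 + h n.+1.
  by rewrite /h exprS; field; rewrite expf_neq0 ?pnatr_eq0.
(* Rectangles that violate the bound. Its right side is quadratic in the size, so by [flux_quarter]
   one of the four quarters violates it again. *)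
pose ok n (p : R * R) := [/\ a <= p.1, p.1 + w n <= b, c <= p.2, p.2 + h n <= d
  & e * (w n + h n) ^+ 2 < `|flux p.1 (p.1 + w n) p.2 (p.2 + h n)|].
pose ch n (p q : R * R) := [/\ p.1 <= q.1, q.1 + w n.+1 <= p.1 + w n,
  p.2 <= q.2, q.2 + h n.+1 <= p.2 + h n & ok n.+1 q].
have step n p : ok n p -> exists q, ch n p q.
  move=> [a1 b1 c1 d1 H]; apply/not_existsP => nch.
  have gp : green_rect p.1 (p.1 + w n) p.2 (p.2 + h n) by exact: green_rectS g.
  have sm q : p.1 <= q.1 -> q.1 + w n.+1 <= p.1 + w n ->
      p.2 <= q.2 -> q.2 + h n.+1 <= p.2 + h n ->
      `|flux q.1 (q.1 + w n.+1) q.2 (q.2 + h n.+1)| <= e * (w n.+1 + h n.+1) ^+ 2.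
    move=> q1 q2 q3 q4; rewrite leNgt; apply/negP => Q; apply: (nch q).
    split=> //; split=> //; first exact: le_trans q1.
    - exact: le_trans b1.
    - exact: le_trans q3.
    - exact: le_trans d1.
  move: H gp sm; rewrite wS hS; have := w0 n.+1; have := h0 n.+1.
  move: (w n.+1) (h n.+1) => W Hh H0 W0 H gp sm.
  move: H; apply/negP; rewrite -leNgt.
  have -> : e * (W + W + (Hh + Hh)) ^+ 2 = 4 * (e * (W + Hh) ^+ 2) by ring.
  apply: flux_quarter => //.
  - by have := sm (p.1, p.2); rewrite /=; apply; rewrite // lerD2l lerDl.
  - by have := sm (p.1, p.2 + Hh); rewrite /= !addrA; apply; rewrite ?lerDl// lerD2l lerDl.
  - by have := sm (p.1 + W, p.2); rewrite /= !addrA; apply; rewrite ?lerDl// lerD2l lerDl.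
  - by have := sm (p.1 + W, p.2 + Hh); rewrite /= !addrA; apply; rewrite ?lerDl.
have w0E : w 0%N = b - a by rewrite /w expr0 divr1.
have h0E : h 0%N = d - c by rewrite /h expr0 divr1.
have ok0 : ok 0%N (a, c).
  rewrite /ok w0E h0E /= [a + _]addrC [c + _]addrC !subrK; split=> //.
  rewrite /e -mulrA -[ltRHS]mulr1 ltr_pM2l// ltr_pdivrMl ?mulr_gt0 ?exprn_gt0// mulr1.
  set x := (b - a) + (d - c); have x0 : 0 <= x by rewrite addr_ge0 ?subr_ge0.
  by clear -x0; nra.
pose nx n p := xget p [set q | ch n p q].
have nxP n p : ok n p -> ch n p (nx n p).
  by move=> /step[q chq]; rewrite /nx; case: xgetP => // /(_ q).
pose P := fix P n := if n is m.+1 then nx m (P m) else (a, c).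
have okP n : ok n (P n).
  by elim: n => [//|n IH] /=; have [] := nxP _ _ IH.
have chP n : ch n (P n) (P n.+1) by apply: nxP.
have mono n k : [/\ (P n).1 <= (P (n + k)%N).1, (P (n + k)%N).1 <= (P n).1 + w n,
    (P n).2 <= (P (n + k)%N).2 & (P (n + k)%N).2 <= (P n).2 + h n].
  suff : [/\ (P n).1 <= (P (n + k)%N).1, (P (n + k)%N).1 + w (n + k)%N <= (P n).1 + w n,
    (P n).2 <= (P (n + k)%N).2 & (P (n + k)%N).2 + h (n + k)%N <= (P n).2 + h n].
    move=> [i1 i2 i3 i4]; split=> //; first by apply: le_trans i2; rewrite lerDl.
    by apply: le_trans i4; rewrite lerDl.
  elim: k => [|k [i1 i2 i3 i4]]; first by rewrite addn0.
  rewrite addnS; have [j1 j2 j3 j4 _] := chP (n + k)%N.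
  by split; [exact: le_trans j1|exact: le_trans i2|exact: le_trans j3|exact: le_trans i4].
(* The lower left corners increase, so their suprema give a point common to all the rectangles;
   [flux_small] at this point contradicts a sufficiently late one. *)
pose s := sup (range (fun n => (P n).1)); pose t := sup (range (fun n => (P n).2)).
have sP n : (P n).1 <= s <= (P n).1 + w n.
  have ub k : (P k).1 <= (P n).1 + w n.
    case: (leqP n k) => [/subnKC <-|/ltnW/subnKC nk]; first by have [] := mono n (k - n)%N.
    by have [+ _ _ _] := mono k (n - k)%N; rewrite nk => /le_trans; apply; rewrite lerDl.
  apply/andP; split.
    by apply: ub_le_sup; [exists ((P n).1 + w n) => _ [k _ <-]|exists n].
  by apply: ge_sup; [exists (P n).1, n|move=> _ [k _ <-]].
have tP n : (P n).2 <= t <= (P n).2 + h n.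
  have ub k : (P k).2 <= (P n).2 + h n.
    case: (leqP n k) => [/subnKC <-|/ltnW/subnKC nk]; first by have [] := mono n (k - n)%N.
    by have [_ _ + _] := mono k (n - k)%N; rewrite nk => /le_trans; apply; rewrite lerDl.
  apply/andP; split.
    by apply: ub_le_sup; [exists ((P n).2 + h n) => _ [k _ <-]|exists n].
  by apply: ge_sup; [exists (P n).2, n|move=> _ [k _ <-]].
have hs : a <= s <= b.
  by have := sP 0%N; rewrite w0E /= [a + _]addrC subrK.
have ht : c <= t <= d.
  by have := tP 0%N; rewrite h0E /= [c + _]addrC subrK.
have [_ _ gst] := g s t hs ht.
have [de de0 D] := flux_small hs ht g gst e0.
have [n wn] : exists n, (b - a) + (d - c) < de * 2 ^+ n.
  exists (Num.bound (((b - a) + (d - c)) / de)).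
  rewrite mulrC -ltr_pdivrMr//.
  apply: (lt_le_trans (archi_boundP _)).
    by rewrite divr_ge0 ?(ltW de0)// addr_ge0 ?subr_ge0.
  by rewrite -natrX ler_nat ltnW// ltn_expl.
have [q1 q2 q3 q4 q5] := okP n.
have := D (P n).1 ((P n).1 + w n) (P n).2 ((P n).2 + h n) q1 q2 q3 q4 (sP n) (tP n).
have Ew x y : x + y - x = y :> R by ring.
rewrite !Ew => DD.
have wde : w n <= de.
  by rewrite ler_pdivrMr ?exprn_gt0//; apply: le_trans (ltW wn); rewrite lerDl subr_ge0.
have hde : h n <= de.
  by rewrite ler_pdivrMr ?exprn_gt0//; apply: le_trans (ltW wn); rewrite lerDr subr_ge0.
by have := DD wde hde; rewrite leNgt q5.
Qed.

End Green.

(** * The modulus with real values *)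

Section ComplexModulus.
Context {R : realType}.
Local Notation C := R[i].
Implicit Types (x y z w : C).

Lemma cmodN z : cmod (- z) = cmod z.
Proof. by rewrite /cmod normrN. Qed.
Lemma cmodBC x y : cmod (x - y) = cmod (y - x).
Proof. by rewrite -cmodN opprB. Qed.
Lemma cmodR (a : R) : cmod a%:C%C = `|a|.
Proof. by rewrite /cmod normc_def /= expr0n /= addr0 sqrtr_sqr. Qed.
Lemma cmod1 : cmod (1 : C) = 1.
Proof. by rewrite (cmodR 1) normr1. Qed.
Lemma cmodV z : cmod z^-1 = (cmod z)^-1.
Proof. by apply: (@complexI R); rewrite -cmodE normfV cmodE fmorphV. Qed.
Lemma cmodX z n : cmod (z ^+ n) = cmod z ^+ n.
Proof. by elim: n => [|n IH]; rewrite ?expr0 ?cmod1// !exprS cmodM IH. Qed.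
Lemma cmod_eq0 z : (cmod z == 0) = (z == 0).
Proof. by rewrite -(inj_eq (@complexI R)) -cmodE normr_eq0. Qed.
Lemma cmod_gt0 z : (0 < cmod z) = (z != 0).
Proof. by rewrite lt_def cmod_ge0 andbT cmod_eq0. Qed.
Lemma cmodB x y : cmod (x - y) <= cmod x + cmod y.
Proof. by rewrite -[cmod y]cmodN cmodD. Qed.
Lemma cmod_sqr z : cmod z ^+ 2 = Re z ^+ 2 + Im z ^+ 2.
Proof. by apply: (@complexI R); rewrite rmorphXn /= -cmodE -add_Re2_Im2. Qed.
Lemma Re_le_cmod z : `|Re z| <= cmod z.
Proof. by rewrite -lecR -cmodE normc_ge_Re. Qed.
Lemma Im_le_cmod z : `|Im z| <= cmod z.
Proof.
rewrite -(ler_pXn2r (isT : (0 < 2)%N)) ?nnegrE ?cmod_ge0// cmod_sqr real_normK ?num_real//.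
by rewrite lerDr sqr_ge0.
Qed.
Lemma cmod_le_ReIm z : cmod z <= `|Re z| + `|Im z|.
Proof.
have {1}-> : z = (Re z)%:C%C + 'i%C * (Im z)%:C%C by exact: complexE.
apply: (le_trans (cmodD _ _)); rewrite cmodM !cmodR.
suff -> : cmod ('i%C : C) = 1 by rewrite mul1r.
by apply/eqP; rewrite -(@eqrXn2 _ 2)// ?cmod_ge0// cmod_sqr /= expr0n expr1n add0r.
Qed.
Lemma cmod_sum I (r : seq I) (P : pred I) (F : I -> C) :
  cmod (\sum_(i <- r | P i) F i) <= \sum_(i <- r | P i) cmod (F i).
Proof.
elim/big_rec2: _ => [|i x y _ h]; first by rewrite cmod0.
by apply: (le_trans (cmodD _ _)); rewrite lerD2l.
Qed.
Lemma ReD x y : Re (x + y) = Re x + Re y. Proof. by case: x; case: y. Qed.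
Lemma ReB x y : Re (x - y) = Re x - Re y. Proof. by case: x; case: y. Qed.
Lemma ImB x y : Im (x - y) = Im x - Im y. Proof. by case: x; case: y. Qed.

End ComplexModulus.

(** * Complex differentiability and logarithmic polar coordinates *)

Section CDiff.
Context {R : realType}.
Local Notation C := R[i].

Definition cderiv (f : C -> C) (z d : C) := forall e : R, 0 < e ->
  exists2 de : R, 0 < de & forall h, cmod h < de ->
    cmod (f (z + h) - f z - d * h) <= e * cmod h.

Definition cdiff (f : C -> C) (z : C) := exists d : C, cderiv f z d.

Lemma cderiv_unique f z d d' : cderiv f z d -> cderiv f z d' -> d = d'.
Proof.
move=> H H'; apply/eqP; rewrite -subr_eq0 -cmod_eq0 eq_le cmod_ge0 andbT.
apply/ler_addgt0Pl => e e0; rewrite addr0; have e20 : 0 < e / 2 by rewrite divr_gt0.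
have [r r0 Hr] := H _ e20; have [r' r0' Hr'] := H' _ e20.
pose h : C := (Num.min r r' / 2)%:C%C.
have m0 : 0 < Num.min r r' by rewrite lt_min r0.
have hE : cmod h = Num.min r r' / 2 by rewrite cmodR ger0_norm// divr_ge0// ltW.
have : cmod h < Num.min r r' by rewrite hE; clear -m0; lra.
rewrite lt_min => /andP[/Hr h1 /Hr' h2].
have h0 : 0 < cmod h by rewrite hE divr_gt0.
rewrite -(ler_pM2r h0) -cmodM.
have -> : (d - d') * h = (f (z + h) - f z - d' * h) - (f (z + h) - f z - d * h) by ring.
by rewrite [e]splitr mulrDl; apply: (le_trans (cmodB _ _)); exact: lerD.
Qed.

Definition ccont (f : C -> C) (z : C) := forall e : R, 0 < e ->
  exists2 de : R, 0 < de & forall h, cmod h < de -> cmod (f (z + h) - f z) <= e.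

Lemma cdiff_ccont f z : cdiff f z -> ccont f z.
Proof.
move=> [d hd] e e0; have [de de0 H] := hd 1 ltr01.
have K0 : 0 < 1 + cmod d by rewrite ltr_pwDl// cmod_ge0.
exists (Num.min de (e / (1 + cmod d))); first by rewrite lt_min de0 divr_gt0.
move=> h; rewrite lt_min ltr_pdivlMr// => /andP[/H {}H h2].
have -> : f (z + h) - f z = (f (z + h) - f z - d * h) + d * h by rewrite subrK.
apply: (le_trans (cmodD _ _)); apply: le_trans (ltW h2).
by rewrite cmodM mulrDr mulr1 [_ * cmod d]mulrC lerD2r -[leRHS]mul1r.
Qed.

Definition cis_exp (s t : R) : C := (expR s * cos t +i* (expR s * sin t))%C.

Lemma cis_expD s t s' t' : cis_exp (s + s') (t + t') = cis_exp s t * cis_exp s' t'.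
Proof. rewrite /cis_exp; simpc; rewrite expRD cosD sinD; congr (_ +i* _)%C; ring. Qed.

Lemma cmod_cis_exp s t : cmod (cis_exp s t) = expR s.
Proof.
apply/eqP; rewrite -(@eqrXn2 _ 2)// ?cmod_ge0 ?expR_ge0// cmod_sqr /=.
by rewrite !exprMn -mulrDr cos2Dsin2 mulr1.
Qed.

Lemma is_derive_small (f : R -> R) (x l : R) : is_derive x 1 f l ->
  forall e, 0 < e -> exists2 de : R, 0 < de &
    forall h, `|h| < de -> `|f (x + h) - f x - l * h| <= e * `|h|.
Proof.
move=> [df <-] e e0.
have /cvgrPdist_le /(_ e e0) := df.
move=> [/= de de0 H]; exists de => // h hd.
have [->|h0] := eqVneq h 0; first by rewrite addr0 subrr mulr0 subrr normr0 mulr0.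
have := H h; rewrite /= sub0r normrN => /(_ hd h0).
rewrite /derive.derive /= distrC => H1.
have -> : f (x + h) - f x - 'D_1 f x * h =
   (h^-1 *: (f (h *: 1 + x) - f x) - 'D_1 f x) * h.
  by rewrite mulrBl /GRing.scale /= mulr1 [h + x]addrC [h^-1 * _ * h]mulrAC mulVf// mul1r.
by rewrite normrM ler_wpM2r.
Qed.

Lemma cis_exp_small e : 0 < e -> exists2 de : R, 0 < de & forall s t,
  `|s| < de -> `|t| < de ->
  cmod (cis_exp s t - 1 - (s +i* t)%C) <= e * (`|s| + `|t|).
Proof.
(* With |s| < e1 <= 1 one has expR s <= 3, and the error terms add up to at most 8 * e1 * (|s| +
   |t|). *)
move=> e0; pose e1 := Num.min 1 (e / 8).
have e10 : 0 < e1 by rewrite lt_min ltr01 divr_gt0.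
have e11 : e1 <= 1 by rewrite ge_min lexx.
have e1e : 8 * e1 <= e by rewrite mulrC -ler_pdivlMr// ge_min lexx orbT.
move: e1 e10 e11 e1e => e1 e10 e11 e1e.
have [d1 d10 H1] := is_derive_small (is_derive_expR (0 : R)) e10.
have [d2 d20 H2] := is_derive_small (is_derive_cos (0 : R)) e10.
have [d3 d30 H3] := is_derive_small (is_derive_sin (0 : R)) e10.
exists (Num.min (Num.min d1 e1) (Num.min d2 d3)).
  by rewrite !lt_min d10 e10 d20 d30.
move=> s t; rewrite !lt_min => /andP[/andP[s1 s2] _] /andP[_ /andP[t2 t3]].
have {H1} := H1 _ s1; have {H2} := H2 _ t2; have {H3} := H3 _ t3.
rewrite !add0r expR0 cos0 sin0 oppr0 mul0r !subr0 addr0 !mul1r => HS HC HE.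
apply: (le_trans (cmod_le_ReIm _)).
rewrite !ReB !ImB /= subr0.
have -> : expR s * cos t - 1 - s = expR s * (cos t - 1) + (expR s - 1 - s) by ring.
have -> : expR s * sin t - t = expR s * (sin t - t) + (expR s - 1) * t by ring.
have eB : `|expR s - 1| <= 2 * e1.
  have -> : expR s - 1 = (expR s - 1 - s) + s by rewrite subrK.
  apply: (le_trans (ler_normD _ _)); apply: (le_trans (lerD HE (ltW s2))).
  have : e1 * `|s| <= e1 by rewrite ler_piMr ?(ltW e10)// (le_trans (ltW s2)).
  by clear; lra.
have eA : expR s <= 3.
  have := ler_norm (expR s - 1); clear -e11 eB; lra.
apply: (@le_trans _ _ ((3 * (e1 * `|t|) + e1 * `|s|) + (3 * (e1 * `|t|) + 2 * e1 * `|t|))).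
  apply: lerD; apply: (le_trans (ler_normD _ _)); apply: lerD => //; rewrite normrM.
  - by rewrite ger0_norm ?expR_ge0// ler_pM ?expR_ge0.
  - by rewrite ger0_norm ?expR_ge0// ler_pM ?expR_ge0.
  - by rewrite ler_wpM2r.
apply: (@le_trans _ _ (8 * e1 * (`|s| + `|t|))); last first.
  by rewrite ler_wpM2r// addr_ge0.
have : 0 <= e1 * `|s| by rewrite mulr_ge0// ltW.
by clear; lra.
Qed.

(* In the coordinates z0 + exp (s + i t) the increments of g at (s, t) agree to
   first order with those of D (s + i t), where D = g'(z) exp (s + i t). *)
Lemma polar_small g z0 s t : cdiff g (z0 + cis_exp s t) ->
  exists D : C, forall e : R, 0 < e -> exists2 de : R, 0 < de & forall x y,
    `|x| < de -> `|y| < de ->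
    cmod (g (z0 + cis_exp (s + x) (t + y)) - g (z0 + cis_exp s t) - D * (x +i* y)%C)
      <= e * (`|x| + `|y|).
Proof.
move=> [d hd]; exists (d * cis_exp s t) => e e0.
set E := expR s; have E0 : 0 < E := expR_gt0 s.
have m0 := cmod_ge0 d.
pose e1 := Num.min 1 (e / (2 * E * (cmod d + 1))).
have dE0 : 0 < 2 * E * (cmod d + 1) by rewrite mulr_gt0 ?mulr_gt0// ltr_wpDl.
have e10 : 0 < e1 by rewrite lt_min ltr01 divr_gt0.
have e11 : e1 <= 1 by rewrite ge_min lexx.
have e1e : e1 * (2 * E * (cmod d + 1)) <= e.
  by rewrite -ler_pdivlMr// ge_min lexx orbT.
move: e1 e10 e11 e1e => e1 e10 e11 e1e.
have [d1 d10 H1] := cis_exp_small e10.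
pose e2 := e / (2 * (2 * E)).
have e20 : 0 < e2 by rewrite !divr_gt0// !mulr_gt0.
have [d2 d20 H2] := hd e2 e20.
exists (Num.min d1 (d2 / (4 * E))).
  by rewrite lt_min d10 divr_gt0// mulr_gt0.
move=> x y; rewrite !lt_min !ltr_pdivlMr ?mulr_gt0// => /andP[x1 x2] /andP[y1 y2].
have {H1} := H1 _ _ x1 y1.
set q := cis_exp x y - 1 - _ => Hq.
pose h := cis_exp s t * (cis_exp x y - 1).
have xy : cmod (x +i* y)%C <= `|x| + `|y| by exact: cmod_le_ReIm.
have hE : cmod h <= 2 * E * (`|x| + `|y|).
  rewrite /h cmodM cmod_cis_exp -/E -mulrA [2 * _]mulrC -mulrA ler_wpM2l ?(ltW E0)//.
  have -> : cis_exp x y - 1 = q + (x +i* y)%C by rewrite /q subrK.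
  apply: (le_trans (cmodD _ _)); apply: (le_trans (lerD Hq xy)).
  by rewrite [leRHS]mulr_natr mulr2n lerD2r ler_piMl// addr_ge0.
have hd2 : cmod h < d2.
  apply: (le_lt_trans hE); clear -x2 y2; lra.
have := H2 h hd2.
have -> : z0 + cis_exp s t + h = z0 + cis_exp (s + x) (t + y).
  by rewrite cis_expD /h mulrBr mulr1 -addrA [cis_exp s t + _]addrC subrK.
move=> H.
rewrite -(mulrA d) .
have -> : forall a b : C, a - b - d * (cis_exp s t * (x +i* y)%C) =
    (a - b - d * h) + d * (cis_exp s t * q).
  by move=> a b; rewrite /h /q; ring.
apply: (le_trans (cmodD _ _)).
apply: (@le_trans _ _ (e / 2 * (`|x| + `|y|) + e / 2 * (`|x| + `|y|))); last first.
  by rewrite -mulrDl -splitr.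
apply: lerD.
  apply: (le_trans H); rewrite /e2 -[leLHS]mulrA.
  apply: (@le_trans _ _ (e * ((2 * (2 * E))^-1 * (2 * E * (`|x| + `|y|))))).
    by rewrite ler_wpM2l ?(ltW e0)// ler_wpM2l// invr_ge0 !mulr_ge0// ltW.
  by rewrite le_eqVlt; apply/orP; left; apply/eqP; field; rewrite gt_eqF.
rewrite !cmodM cmod_cis_exp -/E.
apply: (@le_trans _ _ (cmod d * (E * (e1 * (`|x| + `|y|))))).
  by rewrite ler_wpM2l// ler_wpM2l// ltW.
rewrite !mulrA ler_wpM2r ?addr_ge0//.
have : 0 <= e1 * E by rewrite mulr_ge0// ltW.
by clear -e1e; lra.
Qed.

End CDiff.

(** * The maximum principle with finitely many exceptional points *)

Section MaximumPrinciple.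
Context {R : realType}.
Local Notation C := R[i].

Lemma ccontD (f g : C -> C) z : ccont f z -> ccont g z -> ccont (fun w => f w + g w) z.
Proof.
move=> cf cg e e0; have e20 : 0 < e / 2 by rewrite divr_gt0.
have [d1 d10 H1] := cf _ e20; have [d2 d20 H2] := cg _ e20.
exists (Num.min d1 d2); first by rewrite lt_min d10.
move=> h; rewrite lt_min => /andP[/H1 {}H1 /H2 {}H2].
by rewrite opprD addrACA [e]splitr; apply: (le_trans (cmodD _ _)); apply: lerD.
Qed.

Lemma cdiffD (f g : C -> C) z : cdiff f z -> cdiff g z -> cdiff (fun w => f w + g w) z.
Proof.
move=> [a cf] [b cg]; exists (a + b) => e e0.
have e20 : 0 < e / 2 by rewrite divr_gt0.
have [d1 d10 H1] := cf _ e20; have [d2 d20 H2] := cg _ e20.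
exists (Num.min d1 d2); first by rewrite lt_min d10.
move=> h; rewrite lt_min => /andP[/H1 {}H1 /H2 {}H2].
rewrite (_ : _ - _ = (f (z + h) - f z - a * h) + (g (z + h) - g z - b * h)); last by ring.
rewrite [e]splitr mulrDl; apply: (le_trans (cmodD _ _)); exact: lerD.
Qed.

Lemma polar_cont (g : C -> C) z0 s t : cdiff g (z0 + cis_exp s t) ->
  forall e : R, 0 < e -> exists2 de : R, 0 < de & forall x y,
    `|x| < de -> `|y| < de ->
    cmod (g (z0 + cis_exp (s + x) (t + y)) - g (z0 + cis_exp s t)) <= e.
Proof.
move=> /polar_small[D HD] e e0; have [de de0 H] := HD 1 ltr01.
have K0 : 0 < 2 * (1 + cmod D) by rewrite mulr_gt0// ltr_pwDl// cmod_ge0.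
exists (Num.min de (e / (2 * (1 + cmod D)))); first by rewrite lt_min de0 divr_gt0.
move=> x y; rewrite !lt_min !ltr_pdivlMr// => /andP[x1 x2] /andP[y1 y2].
have {H} := H _ _ x1 y1; rewrite mul1r => H.
rewrite -[X in cmod X](subrK (D * (x +i* y)%C)).
apply: (le_trans (cmodD _ _)); rewrite cmodM.
apply: (le_trans (lerD H (ler_wpM2l (cmod_ge0 _) (cmod_le_ReIm _)))) => /=.
by clear -x2 y2; lra.
Qed.

Lemma polar_green_rect (g : C -> C) z0 s1 s2 t1 t2 :
  (forall s t, s1 <= s <= s2 -> cdiff g (z0 + cis_exp s t)) ->
  green_rect (fun s t => Re (g (z0 + cis_exp s t)))
             (fun s t => Im (g (z0 + cis_exp s t))) s1 s2 t1 t2.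
Proof.
move=> dg s t hs ht; have cg := polar_cont (dg s t hs).
split.
- apply/cvgrPdist_le => e e0; have [de de0 H] := cg e e0.
  exists de => // y /= hy; rewrite -ReB; apply: (le_trans (Re_le_cmod _)).
  rewrite cmodBC; have := H 0 (y - t); rewrite addr0 normr0 [t + _]addrC subrK.
  by apply=> //; rewrite distrC.
- apply/cvgrPdist_le => e e0; have [de de0 H] := cg e e0.
  exists de => // y /= hy; rewrite -ImB; apply: (le_trans (Im_le_cmod _)).
  rewrite cmodBC; have := H (y - s) 0; rewrite addr0 normr0 [s + _]addrC subrK.
  by apply=> //; rewrite distrC.
have [D HD] := polar_small (dg s t hs).
exists (Re D) => e e0; have [de de0 H] := HD (e / 2) (divr_gt0 e0 (ltr0Sn _ _)).
exists (de / 2) => [|a1 a2 b1 b2 /andP[a1s sa2] /andP[b1t tb2] da db]; first exact: divr_gt0.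
have near_s x : a1 <= x <= a2 -> `|x - s| <= a2 - a1.
  by move=> /andP[x1 x2]; rewrite ler_norml; apply/andP; split; clear -x1 x2 a1s sa2; lra.
have near_t x : b1 <= x <= b2 -> `|x - t| <= b2 - b1.
  by move=> /andP[x1 x2]; rewrite ler_norml; apply/andP; split; clear -x1 x2 b1t tb2; lra.
have key x y : a1 <= x <= a2 -> b1 <= y <= b2 ->
    cmod (g (z0 + cis_exp x y) - g (z0 + cis_exp s t) - D * ((x - s) +i* (y - t))%C)
    <= e / 2 * ((a2 - a1) + (b2 - b1)).
  move=> /near_s hx /near_t hy; have := H (x - s) (y - t).
  rewrite [s + _]addrC [t + _]addrC !subrK => h.
  apply: (le_trans (h _ _)); rewrite ?ler_wpM2l ?divr_ge0 ?(ltW e0)//.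
  - by apply: (le_lt_trans hx); apply: (le_lt_trans da); clear -de0; lra.
  - by apply: (le_lt_trans hy); apply: (le_lt_trans db); clear -de0; lra.
  - exact: lerD.
have a12 : a1 <= a2 := le_trans a1s sa2.
have b12 : b1 <= b2 := le_trans b1t tb2.
split=> [y hy|x hx].
  have k1 := key a1 y _ hy; have k2 := key a2 y _ hy.
  rewrite !lexx a12 in k1 k2; have {}k1 := k1 isT; have {}k2 := k2 isT.
  rewrite -ReB.
  have -> : Re D * (a2 - a1) = Re (D * ((a2 - a1) +i* 0)%C).
    by case: (D) => p q /=; rewrite mulr0 subr0.
  rewrite -ReB; apply: (le_trans (Re_le_cmod _)).
  have -> : ((a2 - a1) +i* 0)%C = ((a2 - s) +i* (y - t))%C - ((a1 - s) +i* (y - t))%C.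
    by apply/eqP; rewrite eq_complex /=; apply/andP; split; apply/eqP; ring.
  rewrite mulrBr.
  set p1 := g _ in k1 *; set p2 := g _ in k2 *.
  have alg : forall p a b : C, p2 - p1 - (a - b) = (p2 - p - a) - (p1 - p - b).
    by move=> p a b; ring.
  rewrite (alg (g (z0 + cis_exp s t))).
  rewrite [e]splitr mulrDl; apply: (le_trans (cmodB _ _)); apply: lerD; [exact: k2|exact: k1].
have k1 := key x b1 hx; have k2 := key x b2 hx.
rewrite !lexx b12 in k1 k2; have {}k1 := k1 isT; have {}k2 := k2 isT.
rewrite -ImB.
have -> : Re D * (b2 - b1) = Im (D * (0 +i* (b2 - b1))%C).
  by case: (D) => p q /=; rewrite mulr0 addr0.
rewrite -ImB; apply: (le_trans (Im_le_cmod _)).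
have -> : (0 +i* (b2 - b1))%C = ((x - s) +i* (b2 - t))%C - ((x - s) +i* (b1 - t))%C.
  by apply/eqP; rewrite eq_complex /=; apply/andP; split; apply/eqP; ring.
rewrite mulrBr.
set p1 := g _ in k1 *; set p2 := g _ in k2 *.
have alg : forall p a b : C, p2 - p1 - (a - b) = (p2 - p - a) - (p1 - p - b).
  by move=> p a b; ring.
rewrite (alg (g (z0 + cis_exp s t))).
rewrite [e]splitr mulrDl; apply: (le_trans (cmodB _ _)); apply: lerD; [exact: k2|exact: k1].
Qed.

Lemma cis_exp_period : exists2 T : R, 0 < T & forall s, cis_exp s T = cis_exp s 0.
Proof.
exists (pi *+ 2); first by rewrite pmulrn_lgt0//; exact: pi_gt0.
by move=> s; rewrite /cis_exp cos2pi sin2pi cos0 sin0.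
Qed.

(** In the coordinates z0 + exp (s + i t) the rectangle [ln r1, ln r] x [0, T] covers an annulus,
    and its sides t = 0 and t = T cancel by periodicity. So Re g has the same mean on both circles,
    and the inner one may be taken so small that continuity at z0 finishes the proof. *)
Lemma sub_mean (g : C -> C) z0 (r0 r m : R) : 0 < r < r0 -> ccont g z0 ->
  (forall h, 0 < cmod h < r0 -> cdiff g (z0 + h)) ->
  (forall h, cmod h = r -> Re (g (z0 + h)) <= m) -> Re (g z0) <= m.
Proof.
move=> /andP[rp rr0] cg dg gm; apply/ler_addgt0Pl => e e0.
have [de de0 H] := cg e e0.
pose r1 := Num.min r (de / 2).
have r1p : 0 < r1 by rewrite lt_min rp divr_gt0.
have r1r : r1 <= r by rewrite ge_min lexx.
have r1d : r1 < de.
  by apply: (@le_lt_trans _ _ (de / 2)); [rewrite ge_min lexx orbT|clear -de0; lra].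
have s12 : ln r1 <= ln r by rewrite ler_ln.
have [T T0 per] := cis_exp_period.
have pi0 := ltW T0.
have GR : green_rect (fun s t => Re (g (z0 + cis_exp s t)))
             (fun s t => Im (g (z0 + cis_exp s t))) (ln r1) (ln r) 0 T.
  apply: polar_green_rect => s t /andP[_ sr]; apply: dg.
  by rewrite cmod_cis_exp expR_gt0 /= (le_lt_trans _ rr0)// -[leRHS](lnK rp) ler_expR.
have cu s : ln r1 <= s <= ln r -> cont_on 0 T (fun t => Re (g (z0 + cis_exp s t))).
  by move=> hs t ht; have [] := GR s t hs ht.
have := green s12 pi0 GR.
rewrite /flux sintB; try by apply: cu; rewrite lexx s12.
have -> : sint (ln r1) (ln r) (fun s => Im (g (z0 + cis_exp s T))
    - Im (g (z0 + cis_exp s 0))) = 0.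
  rewrite -[RHS](mul0r (ln r - ln r1)) -sint_cst//; congr sint; apply/funext => s.
  by rewrite per subrr.
rewrite subr0 => /eqP; rewrite subr_eq0 => /eqP E.
have U : sint 0 T (fun t => Re (g (z0 + cis_exp (ln r) t))) <= m * (T - 0).
  rewrite -(sint_cst m pi0); apply: sint_le.
  - by apply: cu; rewrite lexx s12.
  - exact: cont_on_cst.
  - by move=> t _; apply: gm; rewrite cmod_cis_exp lnK.
have L : (Re (g z0) - e) * (T - 0) <=
    sint 0 T (fun t => Re (g (z0 + cis_exp (ln r1) t))).
  rewrite -(sint_cst _ pi0); apply: sint_le.
  - exact: cont_on_cst.
  - by apply: cu; rewrite lexx s12.
  move=> t _; rewrite lerBlDl -lerBlDr -ReB.
  apply: (le_trans (ler_norm _)); apply: (le_trans (Re_le_cmod _)).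
  by rewrite cmodBC; apply: H; rewrite cmod_cis_exp lnK.
have := L; rewrite -E => /le_trans/(_ U).
by clear -T0; rewrite subr0 (ler_pM2r T0) lerBlDl.
Qed.

Lemma continuous_sumsq : continuous (fun p : R * R => p.1 ^+ 2 + p.2 ^+ 2).
Proof.
rewrite (_ : (fun p => _) = fun p : R * R => p.1 * p.1 + p.2 * p.2).
  by move=> p; apply: cvgD; apply: cvgM; (exact: cvg_fst || exact: cvg_snd).
by apply/funext => q; rewrite !expr2.
Qed.

Lemma compact_disc (rho : R) : compact [set p : R * R | p.1 ^+ 2 + p.2 ^+ 2 <= rho ^+ 2].
Proof.
apply: (@subclosed_compact _ _ (`[- `|rho|, `|rho|] `*` `[- `|rho|, `|rho|])).
- have -> : [set p : R * R | p.1 ^+ 2 + p.2 ^+ 2 <= rho ^+ 2] =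
     (fun p : R * R => p.1 ^+ 2 + p.2 ^+ 2) @^-1` [set x | x <= rho ^+ 2] by [].
  apply: preimage_closed; last exact: closed_le.
  by move=> p _; exact: continuous_sumsq.
- by apply: compact_setX; exact: segment_compact.
move=> [x y] /= h; split; rewrite /= in_itv /= -ler_norml -(ler_pXn2r (isT : (0 < 2)%N))
  ?nnegrE// !real_normK ?num_real//; apply: le_trans h.
  by rewrite lerDl sqr_ge0.
by rewrite lerDr sqr_ge0.
Qed.

(** Adding e |z|^2 to Re g makes it strictly subharmonic, which forces its maximum on the disc to
    lie on the circle; the cost is at most e rho^2, an arbitrarily small number. *)
Lemma max_re (g : C -> C) (S : seq C) (rho B : R) : 0 < rho ->
  (forall z, ccont g z) -> (forall z, z \notin S -> cdiff g z) ->
  (forall w, cmod w = rho -> Re (g w) <= B) ->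
  forall z, cmod z <= rho -> Re (g z) <= B.
Proof.
move=> rho0 cg dg gB z hz; apply/ler_addgt0Pl => e0 e00.
pose e := e0 / rho ^+ 2.
have e_gt0 : 0 < e by rewrite divr_gt0// exprn_gt0.
pose K := [set p : R * R | p.1 ^+ 2 + p.2 ^+ 2 <= rho ^+ 2].
pose q (p : R * R) := Re (g (p.1 +i* p.2)%C) + e * (p.1 ^+ 2 + p.2 ^+ 2).
have qE (w : C) : q (Re w, Im w) = Re (g w) + e * cmod w ^+ 2.
  by rewrite /q cmod_sqr; case: w.
have KE (w : C) : K (Re w, Im w) <-> cmod w <= rho.
  by rewrite /K /= -cmod_sqr ler_pXn2r// nnegrE ?cmod_ge0// ltW.
have cq : continuous q.
  move=> p; apply: cvgD; last by apply: cvgM; [exact: cvg_cst|exact: continuous_sumsq].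
  apply/cvgrPdist_le => d d0; have [de de0 H] := cg (p.1 +i* p.2)%C d d0.
  exists (ball p.1 (de / 2), ball p.2 (de / 2)).
    by split; apply: nbhsx_ballx; rewrite divr_gt0.
  move=> [x y] [/= hx hy]; rewrite -ReB; apply: (le_trans (Re_le_cmod _)).
  rewrite cmodBC; have := H ((x +i* y)%C - (p.1 +i* p.2)%C).
  rewrite [_ + (_ - _)]addrC subrK; apply; apply: (le_lt_trans (cmod_le_ReIm _)).
  rewrite /= distrC [`|y + _|]distrC [ltRHS]splitr; exact: ltrD.
have K0 : K !=set0.
  by exists (0, 0); rewrite /K /= expr0n addr0 sqr_ge0.
have [[x y] /set_mem Kw wmax] :=
  compact_EVT_max K0 (@compact_disc rho) (continuous_subspaceT cq).
pose w : C := (x +i* y)%C.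
have {}wmax v : cmod v <= rho -> Re (g v) + e * cmod v ^+ 2 <= Re (g w) + e * cmod w ^+ 2.
  by rewrite -!qE => /KE hv; apply: wmax; rewrite inE.
have {}Kw : cmod w <= rho by apply/KE.
suff wrho : cmod w = rho.
  have := wmax z hz; rewrite wrho /e divfK ?gt_eqF ?exprn_gt0// => H.
  have := gB w wrho; have : 0 <= e * cmod z ^+ 2.
    by rewrite mulr_ge0 ?exprn_ge0 ?cmod_ge0// ltW.
  by rewrite /e; clear -H; lra.
apply/eqP; rewrite eq_le Kw /= leNgt; apply/negP => wlt.
(* Since |w + h|^2 = |w|^2 + 2 Re (conj w h) + |h|^2, maximality at [w] reads Re G (w + h) <= Re g w
   - e |h|^2: the linear term is absorbed as the real part of a holomorphic function, and [sub_mean]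
   applies to [G]. *)
pose G v := g v + (2 * e)%:C%C * ((x -i* y)%C * (v - w)).
(* A punctured disc around [w] free of exceptional points; [w] itself may be one. *)
have [r0 r00 r0S] : exists2 r0 : R, 0 < r0 & forall h, 0 < cmod h < r0 -> w + h \notin S.
  elim: (S) => [|s t [r1 r10 IH]]; first by exists 1.
  have [->|sw] := eqVneq s w.
    exists r1 => // h hh; rewrite inE negb_or IH// andbT.
    by rewrite -subr_eq0 addrC addKr -cmod_gt0; case/andP: hh.
  have sw0 : 0 < cmod (s - w) by rewrite cmod_gt0 subr_eq0.
  exists (Num.min r1 (cmod (s - w))); first by rewrite lt_min r10.
  move=> h; rewrite lt_min => /andP[h0 /andP[h1 h2]].
  rewrite inE negb_or IH ?h0// andbT; apply: contraTneq h2 => <-.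
  by rewrite addrC addKr ltxx.
pose r := Num.min r0 (rho - cmod w) / 2.
have m0 : 0 < Num.min r0 (rho - cmod w) by rewrite lt_min r00 subr_gt0.
have r_gt0 : 0 < r by rewrite divr_gt0.
have r_lt : r < Num.min r0 (rho - cmod w) by rewrite /r; clear -m0; lra.
move: r_lt; rewrite lt_min => /andP[rr0 rrho].
have linG : forall v, cdiff (fun v => (2 * e)%:C%C * ((x -i* y)%C * (v - w))) v.
  move=> v; exists ((2 * e)%:C%C * (x -i* y)%C) => d d0; exists 1 => // h _.
  rewrite (_ : _ - _ = 0) ?cmod0 ?mulr_ge0 ?cmod_ge0 ?(ltW d0)//; ring.
have GE : Re (G w) <= Re (g w) - e * r ^+ 2.
  apply: (@sub_mean G w r0 r); first by rewrite r_gt0.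
  - exact: ccontD (cg w) (cdiff_ccont (linG w)).
  - by move=> h /r0S hS; apply: cdiffD; [exact: dg|exact: linG].
  move=> h hr; have hv : cmod (w + h) <= rho.
    by apply: (le_trans (cmodD _ _)); rewrite hr; clear -rrho; lra.
  have := wmax _ hv; rewrite /G ReD -hr !cmod_sqr.
  rewrite (_ : w + h - w = h); last by rewrite addrC addKr.
  rewrite ReD; move: (Re (g (w + h))) (Re (g w)) => p1 p2; case: (h) => a b /=.
  by clear; lra.
move: GE; rewrite /G subrr !mulr0 addr0.
have : 0 < e * r ^+ 2 by rewrite mulr_gt0// exprn_gt0.
by clear; lra.
Qed.

(** A unimodular factor makes g z real and nonnegative, which reduces the claim to [max_re]. *)
Lemma max_modulus (g : C -> C) (S : seq C) (rho B : R) : 0 < rho ->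
  (forall z, ccont g z) -> (forall z, z \notin S -> cdiff g z) ->
  (forall w, cmod w = rho -> cmod (g w) <= B) ->
  forall z, cmod z <= rho -> cmod (g z) <= B.
Proof.
move=> rho0 cg dg gB z hz.
have [->|g0] := eqVneq (g z) 0.
  by rewrite cmod0; apply: le_trans (gB rho%:C%C _); rewrite ?cmod_ge0// cmodR gtr0_norm.
pose c := (cmod (g z))%:C%C / g z.
have c1 : cmod c = 1.
  by rewrite cmodM cmodV cmodR ger0_norm ?cmod_ge0// divff// cmod_eq0.
have := @max_re (fun v => c * g v) S rho B rho0.
have -> : cmod (g z) = Re (c * g z) by rewrite /c divfK.
apply=> //.
- move=> v d d0; have [de de0 H] := cg v d d0; exists de => // h /H.
  by rewrite -mulrBr cmodM c1 mul1r.
- move=> v /dg [D HD]; exists (c * D) => d d0; have [de de0 H] := HD d d0.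
  by exists de => // h /H; rewrite -mulrA -!mulrBr cmodM c1 mul1r.
- move=> w /gB; apply: le_trans; apply: (le_trans (ler_norm _)).
  by apply: (le_trans (Re_le_cmod _)); rewrite cmodM c1 mul1r.
Qed.

End MaximumPrinciple.

(** * Newton interpolation *)

Section Newton.
Context {R : realType}.
Local Notation C := R[i].

Lemma gt0_cmod (e : C) : 0 < e -> 0 < cmod e /\ e = (cmod e)%:C%C.
Proof.
move=> e0; rewrite cmod_gt0 gt_eqF//; split => //.
by rewrite -cmodE gtr0_norm.
Qed.

Lemma ccontP (f : C -> C) (z : C) : ccont f z <-> {for z, continuous f}.
Proof.
split=> [cf|cf e e0].
  apply/(@cvgrPdist_le _ _ _ (nbhs z) _ f (f z)) => e /gt0_cmod[e0 ->]; have [d d0 H] := cf _ e0.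
  exists d%:C%C; first by rewrite /= ltcR.
  move=> w; rewrite /= !cmodE ltcR lecR => hw.
  by rewrite cmodBC; have := H (w - z); rewrite [z + _]addrC subrK; apply; rewrite cmodBC.
have /(@cvgrPdist_le _ _ _ (nbhs z) _ f (f z)) /(_ e%:C%C) := cf; rewrite ltcR => /(_ e0) [d /= /gt0_cmod[d0 dE] H].
exists (cmod d) => // h hd; have := H (z + h); rewrite /= opprD addNKr.
by rewrite normrN dE !cmodE ltcR lecR cmodBC; apply.
Qed.

(** Caratheodory's form of differentiability: it reduces the calculus of difference quotients to
    continuity. *)
Lemma cdiffP (f : C -> C) (z : C) : cdiff f z <->
  exists2 phi : C -> C, ccont phi z & forall w, f w - f z = phi w * (w - z).
Proof.
split=> [[d H]|[phi cphi fE]].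
  exists (fun w => if w == z then d else (f w - f z) / (w - z)).
    move=> e e0; have [de de0 {}H] := H e e0; exists de => // h hd; rewrite eqxx.
    have [->|h0] := eqVneq h 0; first by rewrite addr0 eqxx subrr cmod0 ltW.
    have := H _ hd; have zh : z + h != z by rewrite -subr_eq0 addrC addKr.
    rewrite (negPf zh) [z + h - z]addrC addKr => H1.
    rewrite -(ler_pM2r (_ : 0 < cmod h)) ?cmod_gt0// -cmodM mulrBl divfK//.

  move=> w; case: eqVneq => [->|wz]; first by rewrite !subrr mulr0.
  by rewrite divfK// subr_eq0.
exists (phi z) => e e0; have [de de0 H] := cphi e e0; exists de => // h hd.
rewrite fE [z + h - z]addrC addKr -mulrBl cmodM ler_wpM2r ?cmod_ge0//.
exact: H.
Qed.

Lemma ccontM (f g : C -> C) z : ccont f z -> ccont g z -> ccont (fun w => f w * g w) z.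
Proof. by rewrite !ccontP; exact: continuousM. Qed.

Lemma ccont_cst (c z : C) : ccont (fun=> c) z.
Proof. by move=> e e0; exists 1 => // h _; rewrite subrr cmod0 ltW. Qed.

Lemma ccont_id (z : C) : ccont id z.
Proof. by move=> e e0; exists e => // h /ltW; rewrite [z + h]addrC addrK. Qed.

Lemma ccontV (f : C -> C) z : f z != 0 -> ccont f z -> ccont (fun w => (f w)^-1) z.
Proof. by move=> f0; rewrite !ccontP; exact: continuousV. Qed.

Lemma ccont_near (f g : C -> C) z (r : R) : 0 < r ->
  (forall h, cmod h < r -> f (z + h) = g (z + h)) -> ccont f z -> ccont g z.
Proof.
move=> r0 fg cf; have fz : f z = g z by have := fg 0; rewrite addr0 cmod0; apply.
move=> e /cf[de de0 H]; exists (Num.min r de); first by rewrite lt_min r0.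
move=> h; rewrite lt_min => /andP[hr /H]; by rewrite fg// fz; apply.
Qed.

(** [G] is the Caratheodory slope of [g] at [t]. Its bound holds on the circle, where |z - t| >= rho
    - tau and |g z - g t| <= 2 B, and passes inside by the maximum principle. The node [t] joins the
    exceptional points. *)
Lemma divided_difference (g : C -> C) (S : seq C) (t : C) (rho tau B : R) :
  (forall z, ccont g z) -> (forall z, z \notin S -> cdiff g z) -> t \notin S ->
  cmod t <= tau -> tau < rho -> (forall z, cmod z <= rho -> cmod (g z) <= B) ->
  exists G : C -> C, [/\ forall z, ccont G z, forall z, z \notin t :: S -> cdiff G z,
    forall z, g z = g t + G z * (z - t)
  & forall z, cmod z <= rho -> cmod (G z) <= 2 * B / (rho - tau)].
Proof.
move=> cg dg tS ht trho gB; have tau0 := le_trans (cmod_ge0 t) ht.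
have rho0 := le_lt_trans tau0 trho.
have /cdiffP[phi cphi phiE] := dg t tS.
have subK (z w : C) : z + (w - z) = w by rewrite addrC subrK.
have cG z : ccont phi z.
  have [->//|zt] := eqVneq z t.
  have zt0 : 0 < cmod (z - t) by rewrite cmod_gt0 subr_eq0.
  apply: (@ccont_near (fun w => (g w - g t) * (w - t)^-1) _ _ _ zt0).
    move=> h hz; rewrite phiE mulfK// subr_eq0; apply: contraTneq hz => <-.
    by rewrite opprD addNKr cmodN ltxx.
  apply: ccontM; first by apply: ccontD => //; exact: ccont_cst.
  apply: ccontV; first by rewrite subr_eq0.
  by apply: ccontD; [exact: ccont_id|exact: ccont_cst].
have dG z : z \notin t :: S -> cdiff phi z.
  rewrite inE negb_or => /andP[zt zS].
  have /cdiffP[psi cpsi psiE] := dg z zS.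
  apply/cdiffP; exists (fun w => if w == t then (phi t - phi z) / (t - z)
    else (psi w - phi z) / (w - t)).
    have zt0 : 0 < cmod (z - t) by rewrite cmod_gt0 subr_eq0.
    apply: (@ccont_near (fun w => (psi w - phi z) * (w - t)^-1) _ _ _ zt0).
      move=> h hz; case: eqVneq => // E; move: hz.
      by rewrite -E opprD addNKr cmodN ltxx.
    apply: ccontM; first by apply: ccontD => //; exact: ccont_cst.
    apply: ccontV; first by rewrite subr_eq0.
    by apply: ccontD; [exact: ccont_id|exact: ccont_cst].
  move=> w; case: eqVneq => [->|wt]; first by rewrite divfK// subr_eq0 eq_sym.
  have wt0 : w - t != 0 by rewrite subr_eq0.
  apply: (mulIf wt0); rewrite mulrAC divfK//.
  have := phiE w; have := phiE z; have := psiE w => E1 E2 E3.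
  rewrite mulrBl -E3 mulrBl -E1.
  have -> : phi z * (w - t) = phi z * (z - t) + phi z * (w - z) by ring.
  rewrite -E2; ring.
exists phi; split=> //.
  by move=> z; rewrite -phiE subK.
move=> z hz; apply: (@max_modulus _ _ (t :: S) rho _ rho0) hz => // w hw.
have wt : rho - tau <= cmod (w - t).
  rewrite lerBlDr -hw; have {1}-> : w = (w - t) + t by rewrite subrK.
  by apply: (le_trans (cmodD _ _)); rewrite lerD2l.
rewrite ler_pdivlMr ?subr_gt0//.
apply: (@le_trans _ _ (cmod (phi w) * cmod (w - t))).
  by rewrite ler_wpM2l ?cmod_ge0.
rewrite -cmodM -phiE; apply: (le_trans (cmodB _ _)).
have := gB w; rewrite hw lexx => /(_ isT) h1.
have := gB t (le_trans ht (ltW trho)) => h2.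
by clear -h1 h2; lra.
Qed.

(** Constants that depend only on the bound [B] are what survives in a limit of functions, see
    [entire_filter_lim]. *)
Lemma taylor2 (phi : C -> C) (B : R) : (forall z, cdiff phi z) ->
  (forall z, cmod z <= 1 -> cmod (phi z) <= B) ->
  exists d, cmod d <= 2 * B /\
    forall z, cmod z <= 1 -> cmod (phi z - phi 0 - d * z) <= 8 * B * cmod z ^+ 2.
Proof.
move=> dphi phiB.
have cphi z : ccont phi z by exact: cdiff_ccont.
have [G [cG dG GE GB]] := @divided_difference phi [::] 0 1 0 B cphi (fun z _ => dphi z)
  isT (eq_ind_r (fun x => x <= 0) (lexx 0) cmod0) ltr01 phiB.
rewrite subr0 divr1 in GB.
have B0 : 0 <= B by apply: le_trans (phiB 0 _); rewrite ?cmod_ge0// cmod0.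
exists (G 0); split; first by apply: GB; rewrite cmod0.
move=> z hz; rewrite {1}GE subr0 [phi 0 + _]addrC addrK -mulrBl cmodM expr2 mulrA.
rewrite ler_wpM2r ?cmod_ge0//; apply/ler_addgt0Pl => e e0.
(* The slope [G] at 0 is not known to be differentiable at 0, so it is divided at a nearby point
   [s0] instead, with bound 2 (2 B) / (1 - 1/2) = 8 B; then [s0] tends to 0. *)
have [de de0 H] := cG 0 (e / 2) (divr_gt0 e0 (ltr0Sn _ _)).
pose e1 := e / (16 * B + 1).
have e10 : 0 < e1 by rewrite divr_gt0// ltr_wpDl// mulr_ge0.
pose s0 := Num.min (Num.min (de / 2) (1 / 2)) e1.
have s00 : 0 < s0 by rewrite !lt_min e10 andbT !divr_gt0.
have s0d : s0 < de.
  apply: (@le_lt_trans _ _ (de / 2)); first by rewrite !ge_min lexx.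
  by clear -de0; lra.
have s0h : s0 <= 1 / 2 by rewrite !ge_min lexx orbT.
have s0e : 8 * B * s0 <= e / 2.
  have : s0 <= e1 by rewrite !ge_min lexx orbT.
  move=> /(ler_wpM2l (mulr_ge0 (ler0n _ 8) B0))/le_trans; apply.
  rewrite /e1 mulrA ler_pdivrMr ?ltr_wpDl ?mulr_ge0//.
  have : 0 <= e * B by rewrite mulr_ge0// ltW.
  by clear -e0; lra.
move: s0 s00 s0d s0h s0e => s0 s00 s0d s0h s0e.
have cs : cmod (s0%:C%C : C) = s0 by rewrite cmodR gtr0_norm.
have [F [_ _ FE FB]] := @divided_difference G [:: 0] s0%:C%C 1 (1 / 2) (2 * B) cG dG
  ltac:(by rewrite inE -cmod_eq0 cs gt_eqF) ltac:(by rewrite cs) ltac:(by clear; lra) GB.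
have {}FB w : cmod w <= 1 -> cmod (F w) <= 8 * B.
  move=> /FB/le_trans; apply; rewrite (_ : 1 - 1 / 2 = 2^-1 :> R); last by field.
  by rewrite invrK; clear; lra.
have -> : G z - G 0 = F z * (z - s0%:C%C) + (G (0 + s0%:C%C) - G 0).
  by rewrite add0r (FE z); ring.
apply: (le_trans (cmodD _ _)).
have h1 : cmod (G (0 + s0%:C%C) - G 0) <= e / 2 by apply: H; rewrite cs.
have h2 : cmod (F z * (z - s0%:C%C)) <= 8 * B * (cmod z + s0).
  rewrite cmodM ler_pM ?cmod_ge0 ?FB//.
  by apply: (le_trans (cmodB _ _)); rewrite cs.
by clear -h1 h2 s0e; lra.
Qed.

(* Divided differences at distinct nodes rather than Taylor coefficients: they are
   finite combinations of values of phi. *)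
Fixpoint newton (t : nat -> C) (j : nat) (phi : C -> C) : C -> C :=
  if j is i.+1 then fun z => (newton t i phi z - newton t i phi (t i)) / (z - t i)
  else phi.

(** At an earlier node [newton] divides by 0 and has a meaningless value; [G] is continuous and
    replaces it there. Injectivity keeps the next node out of the exceptional set, and each division
    costs a factor 2 / (rho - tau). *)
Lemma newton_ext (t : nat -> C) (tau rho S : R) (phi : C -> C) :
  injective t -> (forall j, cmod (t j) <= tau) -> tau < rho ->
  (forall z, cdiff phi z) -> (forall z, cmod z <= rho -> cmod (phi z) <= S) ->
  forall n, exists G : C -> C, [/\ forall z, ccont G z,
    forall z, z \notin map t (iota 0 n) -> cdiff G z,
    forall z, cmod z <= rho -> cmod (G z) <= (2 / (rho - tau)) ^+ n * S,
    forall z, z \notin map t (iota 0 n) -> G z = newton t n phi z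
  & forall z, phi z = \sum_(j < n) newton t j phi (t j) * \prod_(i < j) (z - t i) +
      G z * \prod_(i < n) (z - t i)].
Proof.
move=> tI ht trho dphi phiS; elim=> [|n [g [cg dg gB gE gS]]].
  exists phi; split=> [z|z _|z /phiS|//|z]; [exact: cdiff_ccont|exact: dphi| |].
    by rewrite expr0 mul1r.
  by rewrite !big_ord0 add0r mulr1.
have tn : t n \notin map t (iota 0 n) by rewrite mem_map// mem_iota ltnn.
have mem z : (z \notin map t (iota 0 n.+1)) = (z \notin t n :: map t (iota 0 n)).
  by rewrite -addn1 iotaD map_cat /= add0n mem_cat !inE orbC.
have [G [cG dG GE GB]] := divided_difference cg dg tn (ht n) trho gB.
exists G; split=> //.
- by move=> z; rewrite mem; exact: dG.
- move=> z /GB/le_trans; apply; rewrite exprS le_eqVlt; apply/orP; left; apply/eqP.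
  by ring.
- move=> z; rewrite mem inE negb_or => /andP[zt zS] /=.
  rewrite -gE// -gE// GE [g (t n) + _]addrC addrK mulfK// subr_eq0//.
- move=> z; rewrite gS GE !big_ord_recr /= (gE _ tn); ring.
Qed.

End Newton.

(** * Entire functions and the spaces H(M) *)

Section FilterLimit.
Context {R : realType}.
Local Notation C := R[i].

(** The limit is the supremum of the eventual lower bounds. *)
Lemma real_filter_lim (I : Type) (F : set_system I) {FF : ProperFilter F} (v : I -> R) :
  (forall e : R, 0 < e -> exists2 A, F A & forall i j, A i -> A j -> `|v i - v j| <= e) ->
  exists l, forall e : R, 0 < e -> exists2 A, F A & forall i, A i -> `|v i - l| <= e.
Proof.
move=> cv; pose E := [set x | exists2 A, F A & forall i, A i -> x <= v i].
exists (sup E) => e e0; have [A FA HA] := cv (e / 2) (divr_gt0 e0 (ltr0Sn _ _)).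
exists A => // i Ai.
have Ei : E (v i - e / 2).
  by exists A => // j Aj; have := HA i j Ai Aj; rewrite ler_distl => /andP[h1 h2]; clear -h1 h2; lra.
have ub : ubound E (v i + e / 2).
  move=> x [B FB HB]; have [j [Aj Bj]] := filter_ex (filterI FA FB).
  apply: (le_trans (HB j Bj)); have := HA i j Ai Aj.
  by rewrite ler_distl => /andP[h1 h2]; clear -h1 h2; lra.
have h1 : v i - e / 2 <= sup E by apply: ub_le_sup Ei; exists (v i + e / 2).
have h2 : sup E <= v i + e / 2 by apply: ge_sup => //; exists (v i - e / 2).
by rewrite ler_distl; apply/andP; split; clear -h1 h2 e0; lra.
Qed.

Lemma complex_filter_lim (I : Type) (F : set_system I) {FF : ProperFilter F} (v : I -> C) :
  (forall e : R, 0 < e -> exists2 A, F A & forall i j, A i -> A j -> cmod (v i - v j) <= e) ->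
  exists l, forall e : R, 0 < e -> exists2 A, F A & forall i, A i -> cmod (v i - l) <= e.
Proof.
move=> cv.
have [|a Ha] := @real_filter_lim _ F FF (fun i => Re (v i)).
  move=> e /cv[A FA HA]; exists A => // i j Ai Aj; rewrite -ReB.
  exact: le_trans (Re_le_cmod _) (HA _ _ Ai Aj).
have [|b Hb] := @real_filter_lim _ F FF (fun i => Im (v i)).
  move=> e /cv[A FA HA]; exists A => // i j Ai Aj; rewrite -ImB.
  exact: le_trans (Im_le_cmod _) (HA _ _ Ai Aj).
exists (a +i* b)%C => e e0; have e20 : 0 < e / 2 by rewrite divr_gt0.
have [A FA HA] := Ha _ e20; have [B FB HB] := Hb _ e20.
exists (A `&` B); first exact: filterI.
move=> i [/HA ha /HB hb]; apply: (le_trans (cmod_le_ReIm _)).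
by rewrite ReB ImB [e]splitr; apply: lerD.
Qed.

End FilterLimit.

(** * Holomorphy in several variables and locally uniform limits *)

Section Vectors.
Context {R : realType} {k : nat}.
Local Notation C := R[i].
Implicit Types (u w z : 'rV[C]_k).

Definition vnorm u : R := Re `|u|.

Lemma vnormE u : `|u| = (vnorm u)%:C%C.
Proof. by rewrite /vnorm RRe_real// ger0_real. Qed.
Lemma vnorm_ge0 u : 0 <= vnorm u.
Proof. by rewrite -lecR -vnormE normr_ge0. Qed.
Lemma vnormD u w : vnorm (u + w) <= vnorm u + vnorm w.
Proof. by rewrite -lecR rmorphD /= -!vnormE ler_normD. Qed.
Lemma vnormZ (a : C) u : vnorm (a *: u) = cmod a * vnorm u.
Proof. by apply: (@complexI R); rewrite rmorphM /= -!vnormE normrZ cmodE. Qed.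
Lemma vnormN u : vnorm (- u) = vnorm u.
Proof. by rewrite /vnorm normrN. Qed.
Lemma vnorm0 : vnorm 0 = 0.
Proof. by rewrite /vnorm normr0. Qed.

Lemma vnorm_lt u (r : R) : 0 < r -> vnorm u < r <-> forall j, cmod (u 0 j) < r.
Proof.
move=> r0; have := congr1 (fun b => b (0 : 'rV[C]_k) r%:C%C u) (@mx_norm_ball C 1 k).
rewrite /= sub0r normrN vnormE ltcR => E; split=> [|h].
  rewrite -E => -[_ H] j; have := H 0 j.
  by rewrite -ball_normE /= mxE sub0r normrN cmodE ltcR.
rewrite -E; split; first by rewrite ltcR.
by move=> i j; rewrite ord1 -ball_normE /= mxE sub0r normrN cmodE ltcR.
Qed.

Lemma vnorm_nbhs z (A : set 'rV[C]_k) : nbhs z A <->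
  exists2 r : R, 0 < r & forall w, vnorm (w - z) < r -> A w.
Proof.
split.
  move=> /nbhs_ballP[e /gt0_cmod[e0 eE] H]; exists (cmod e) => // w hw; apply: H.
  by rewrite mx_norm_ball /ball_ /= -normrN opprB vnormE eE ltcR.
move=> [r r0 H]; apply/nbhs_ballP; exists r%:C%C; first by rewrite /= ltcR.
by move=> w; rewrite mx_norm_ball /ball_ /= -normrN opprB vnormE ltcR; exact: H.
Qed.

Lemma vnorm_nbhs0 (A : set 'rV[C]_k) : nbhs (0 : 'rV[C]_k) A <->
  exists2 r : R, 0 < r & forall w, vnorm w < r -> A w.
Proof.
rewrite vnorm_nbhs.
by split=> -[r r0 H]; exists r => // w; have := H w; rewrite subr0.
Qed.

Lemma diff_small (f : 'rV[C]_k -> C) z : differentiable f z ->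
  forall e : R, 0 < e -> exists2 r : R, 0 < r & forall w, vnorm w < r ->
    cmod (f (z + w) - f z - 'd f z w) <= e * vnorm w.
Proof.
move=> /diff_locally /eqaddoP df e e0.
have /vnorm_nbhs0[r r0 H] := df e%:C%C ltac:(by rewrite ltcR).
exists r => // w /H; rewrite -[(_ - _) w]/(f (w + z) - (f z + 'd f z w)) cmodE vnormE.
by rewrite -rmorphM lecR /= opprD addrA [w + z]addrC.
Qed.

Lemma small_diff (f : 'rV[C]_k -> C) z (c : 'cV[C]_k) :
  (forall e : R, 0 < e -> exists2 r : R, 0 < r & forall w, vnorm w < r ->
    cmod (f (z + w) - f z - (w *m c) 0 0) <= e * vnorm w) -> differentiable f z.
Proof.
move=> H; pose l (w : 'rV[C]_k) : C := (w *m c) 0 0.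
have ll : linear l by move=> a x y; rewrite /l mulmxDl -scalemxAl !mxE.
pose L : {linear 'rV[C]_k -> C} := HB.pack l (GRing.isLinear.Build _ _ _ _ l ll).
have cL : continuous L.
  move=> x; rewrite /= /l.
  have -> : (fun w : 'rV[C]_k => (w *m c) 0 0) = \sum_(j < k) (fun w : 'rV[C]_k => w 0 j * c j 0).
    by apply/funext => w; rewrite mxE fct_sumE.
  apply: (big_ind (fun g : 'rV[C]_k -> C => {for x, continuous g})) => [|g h cg ch|j _].
  - exact: cst_continuous.
  - exact: (cvgD cg ch).
  - apply: (@cvgM _ _ (nbhs x) _ (fun w : 'rV[C]_k => w 0 j) (fun=> c j 0)).
      exact: coord_continuous.
    exact: cvg_cst.
have E : f \o shift z = cst (f z) + L +o_ (0 : 'rV[C]_k) id.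
  apply/eqaddoP => e /gt0_cmod[e0 ->]; apply/vnorm_nbhs0.
  have [r r0 Hr] := H _ e0; exists r => // w /Hr.
  rewrite -[(_ - _) w]/(f (w + z) - (f z + (w *m c) 0 0)) cmodE vnormE.
  by rewrite -rmorphM lecR /= opprD addrA [w + z]addrC.
by apply/diff_locallyP; rewrite (diff_unique cL E).
Qed.

Lemma diff_line (f : 'rV[C]_k -> C) z u t : differentiable f (z + t *: u) ->
  cderiv (fun s => f (z + s *: u)) t ('d f (z + t *: u) u).
Proof.
move=> /diff_small H e e0; have u1 : 0 < vnorm u + 1 by rewrite ltr_wpDl ?vnorm_ge0.
have [r r0 Hr] := H (e / (vnorm u + 1)) (divr_gt0 e0 u1).
exists (r / (vnorm u + 1)); first exact: divr_gt0.
move=> h; rewrite ltr_pdivlMr// => hr.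
have hu : cmod h * vnorm u <= cmod h * (vnorm u + 1).
  by rewrite ler_wpM2l ?cmod_ge0// lerDl.
have := Hr (h *: u); rewrite vnormZ => /(_ (le_lt_trans hu hr)).
rewrite linearZ /= scalerDl addrA -[h *: 'd f _ u]/(h * 'd f _ u) [h * _]mulrC.
move=> /le_trans; apply.
by rewrite -mulrA ler_wpM2l ?(ltW e0)// mulrC ler_pdivrMr.
Qed.

Lemma entire_taylor2 (f : 'rV[C]_k -> C) z u (B : R) : entire f ->
  (forall t : C, cmod t <= 1 -> cmod (f (z + t *: u)) <= B) ->
  cmod ('d f z u) <= 2 * B /\ forall t : C, cmod t <= 1 ->
    cmod (f (z + t *: u) - f z - t * 'd f z u) <= 8 * B * cmod t ^+ 2.
Proof.
move=> ef fB.
have dphi s : cdiff (fun s => f (z + s *: u)) s by eexists; exact: diff_line.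
have [d [dB dT]] := taylor2 dphi fB; rewrite scale0r addr0 in dT.
have dl : 'd f z u = d.
  apply: (@cderiv_unique _ (fun s => f (z + s *: u)) 0).
    by have := @diff_line f z u 0; rewrite scale0r addr0; apply.
  have B0 : 0 <= B by apply: le_trans (fB 0 _); rewrite ?cmod_ge0// cmod0.
  move=> e e0; have B1 : 0 < 8 * B + 1 by rewrite ltr_wpDl// mulr_ge0.
  exists (Num.min 1 (e / (8 * B + 1))); first by rewrite lt_min ltr01 divr_gt0.
  move=> h; rewrite lt_min => /andP[h1 h2]; rewrite add0r scale0r addr0.
  apply: (le_trans (dT h (ltW h1))); rewrite expr2 mulrA ler_wpM2r ?cmod_ge0//.
  move: h2; rewrite ltr_pdivlMr// => h2; have := cmod_ge0 h.
  by clear -h2; lra.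
by rewrite dl; split=> // t ht; rewrite mulrC; exact: dT.
Qed.

(** Applied to differences, it makes the partial derivatives of a uniformly Cauchy family Cauchy. *)
Lemma entire_diff_le (f : 'rV[C]_k -> C) z u (B K : R) : entire f -> 0 < K ->
  (forall t : C, cmod t <= 1 -> cmod (f (z + t *: (K^-1%:C%C *: u))) <= B) ->
  cmod ('d f z u) <= K * (2 * B).
Proof.
move=> ef K0 fB; have [+ _] := entire_taylor2 ef fB.
have linZ (l : {linear 'rV[C]_k -> C}) a v : l (a *: v) = a * l v by rewrite linearZ.
rewrite linZ cmodM cmodR ger0_norm ?invr_ge0 ?(ltW K0)//.
by rewrite ler_pdivrMl.
Qed.

Lemma vnorm_coord u j : cmod (u 0 j) <= vnorm u.
Proof.
apply/ler_addgt0Pr => e e0; apply/ltW.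
have ue : 0 < vnorm u + e by rewrite ltr_wpDl ?vnorm_ge0.
by have /(vnorm_lt _ ue) : vnorm u < vnorm u + e by rewrite ltrDl.
Qed.

Lemma row_sum_coord (l : {linear 'rV[C]_k -> C}) u :
  l u = \sum_(j < k) u 0 j * l (delta_mx 0 j).
Proof.
rewrite {1}[u]row_sum_delta linear_sum; apply: eq_bigr => j _.
by rewrite linearZ.
Qed.

(** Weierstrass's theorem along a filter. The partial derivatives converge by [entire_diff_le], and
    the constant in [entire_taylor2] depends only on a common bound of the functions, so the
    second-order estimate holds in the limit. *)
Lemma entire_filter_lim (I : Type) (F : set_system I) {FF : ProperFilter F}
    (h : I -> 'rV[C]_k -> C) (f : 'rV[C]_k -> C) z (r0 : R) : 0 < r0 ->
  (forall i, entire (h i)) ->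
  (forall e : R, 0 < e -> exists2 A, F A & forall i, A i -> forall w, vnorm (w - z) < r0 ->
     cmod (h i w - f w) <= e) ->
  differentiable f z.
Proof.
move=> r00 eh hf.
have [A1 FA1 H1] := hf 1 ltr01; have [i1 Ai1] := filter_ex FA1.
(* One function is bounded near [z] because it is differentiable there; closeness to [f] extends the
   bound to all the functions of [A1]. *)
have [r1 r10 Hr1] : exists2 r, 0 < r & forall w, vnorm w < r ->
    cmod (h i1 (z + w)) <= cmod (h i1 z) + 1 + cmod ('d (h i1) z w).
  have [r rp Hr] := diff_small (eh i1 z) ltr01; exists (Num.min r 1).
    by rewrite lt_min rp ltr01.
  move=> w; rewrite lt_min => /andP[/Hr {}Hr w1].
  rewrite mul1r in Hr; have := le_trans Hr (ltW w1).
  set a := h i1 (z + w); set b := h i1 z; set c := 'd _ _ _ => habc.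
  have -> : a = (a - b - c) + b + c by ring.
  apply: (le_trans (cmodD _ _)); rewrite lerD2r; apply: (le_trans (cmodD _ _)).
  by rewrite addrC lerD2l.
pose D := \sum_(j < k) cmod ('d (h i1) z (delta_mx 0 j)).
have D0 : 0 <= D by apply: sumr_ge0 => j _; exact: cmod_ge0.
have dD w : cmod ('d (h i1) z w) <= D * vnorm w.
  rewrite row_sum_coord; apply: (le_trans (cmod_sum _ _ _)).
  rewrite mulr_suml; apply: ler_sum => j _.
  by rewrite cmodM mulrC ler_wpM2l ?cmod_ge0// vnorm_coord.
pose r := Num.min (Num.min r0 r1) 1 / 2.
have rm : 0 < Num.min (Num.min r0 r1) 1 by rewrite !lt_min r00 r10 ltr01.
have r_gt0 : 0 < r by rewrite divr_gt0.
have [rr0 rr1 r_le1] : [/\ r < r0, r < r1 & r < 1].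
  have : r < Num.min (Num.min r0 r1) 1 by rewrite /r; clear -rm; lra.
  by rewrite !lt_min => /andP[/andP[-> ->] ->].
move: r r_gt0 rr0 rr1 r_le1 {rm} => r r_gt0 rr0 rr1 r_le1.
pose B := cmod (h i1 z) + 1 + D + 2.
have B0 : 0 <= B by rewrite !addr_ge0// cmod_ge0.
have hB i w : A1 i -> vnorm w <= r -> cmod (h i (z + w)) <= B.
  move=> Ai wr.
  have wz x : vnorm x <= r -> vnorm (z + x - z) < r0.
    by move=> xr; rewrite addrAC subrr add0r (le_lt_trans xr).
  have := H1 i Ai _ (wz _ wr); have := H1 i1 Ai1 _ (wz _ wr).
  have := Hr1 w (le_lt_trans wr rr1); have := dD w.
  have : D * vnorm w <= D by rewrite ler_piMr// (le_trans wr)// ltW.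
  set a := h i1 _; set b := f _; set c := h i _ => h1 h2 h3 h4 h5.
  have -> : c = (c - b) + (a - (a - b)) by ring.
  apply: (le_trans (cmodD _ _)); have := cmodB a (a - b).
  by rewrite /B; clear -h1 h2 h3 h4 h5; lra.
have scl (u : 'rV[C]_k) : exists2 K : R, 0 < K & vnorm (K^-1%:C%C *: u) <= r.
  exists ((vnorm u + 1) / r); first by rewrite divr_gt0// ltr_wpDl// vnorm_ge0.
  have v0 := vnorm_ge0 u; have v1 : 0 < vnorm u + 1 by rewrite ltr_wpDl.
  rewrite vnormZ cmodR ger0_norm ?invr_ge0 ?divr_ge0 ?(ltW v1) ?(ltW r_gt0)//.
  rewrite invf_div mulrAC ler_pdivrMr// ler_wpM2l ?(ltW r_gt0)//.
  by rewrite lerDl.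
have [c cP] : exists c : 'cV[C]_k, forall j (e : R), 0 < e ->
    exists2 A, F A & forall i, A i -> cmod ('d (h i) z (delta_mx 0 j) - c j 0) <= e.
  have cj j : exists l, forall e : R, 0 < e ->
      exists2 A, F A & forall i, A i -> cmod ('d (h i) z (delta_mx 0 j) - l) <= e.
    apply: (@complex_filter_lim _ _ F FF (fun i => 'd (h i) z (delta_mx 0 j))) => e e0.
    have [K0 K00 KK] := scl (delta_mx 0 j).
    have d0 : 0 < e / (4 * K0) by rewrite divr_gt0// mulr_gt0.
    have [A FA HA] := hf _ d0; exists A => // i i' Ai Ai'.
    have eg : entire (h i - h i') by move=> w; apply: differentiableB; exact: eh.
    have dE := congr1 (fun l => l (delta_mx 0 j)) (diffB (eh i z) (eh i' z)).
    rewrite -[RHS]/('d (h i) z (delta_mx 0 j) - 'd (h i') z (delta_mx 0 j)) in dE.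
    rewrite -dE.
    have gB (t : C) : cmod t <= 1 ->
        cmod (h i (z + t *: (K0^-1%:C%C *: delta_mx 0 j)) -
              h i' (z + t *: (K0^-1%:C%C *: delta_mx 0 j))) <= 2 * (e / (4 * K0)).
      move=> t1; set w := z + _.
      have wr : vnorm (w - z) < r0.
        rewrite /w addrAC subrr add0r vnormZ; apply: le_lt_trans rr0.
        by apply: le_trans KK; rewrite ler_piMl ?vnorm_ge0.
      have -> : h i w - h i' w = (h i w - f w) - (h i' w - f w) by ring.
      have := HA i Ai w wr; have := HA i' Ai' w wr; have := cmodB (h i w - f w) (h i' w - f w).
      by clear; lra.
    have := @entire_diff_le (h i - h i') z _ _ _ eg K00 gB.
    move=> /le_trans; apply; rewrite le_eqVlt; apply/orP; left; apply/eqP; field.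
    by rewrite gt_eqF.
  have /choice[c cP] := cj.
  by exists (\col_j c j) => j e /(cP j)[A FA HA]; exists A => // i; rewrite mxE; exact: HA.
apply: (@small_diff _ _ c) => e e0.
pose L (w : 'rV[C]_k) := (w *m c) 0 0.
have LZ (a : C) w : L (a *: w) = a * L w by rewrite /L -scalemxAl mxE.
have lim w (d : R) : vnorm w <= r -> 0 < d -> exists2 A, F A & forall i, A i ->
    cmod ('d (h i) z w - L w) <= d.
  move=> wr d0; have d1 : 0 < d / k.+1%:R by rewrite divr_gt0.
  have /choice[A HA] : forall j, exists A : set I, F A /\ forall i, A i ->
      cmod ('d (h i) z (delta_mx 0 j) - c j 0) <= d / k.+1%:R.
    by move=> j; have [A FA HA] := cP j _ d1; exists A.
  exists [set i | forall j, A j i].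
    by apply: filter_forall => j; exact: (HA j).1.
  move=> i Ai; rewrite row_sum_coord /L mxE -sumrB.
  apply: (le_trans (cmod_sum _ _ _)).
  apply: (@le_trans _ _ (\sum_(j < k) d / k.+1%:R)).
    apply: ler_sum => j _; rewrite -mulrBr cmodM -[leRHS]mul1r.
    apply: ler_pM; rewrite ?cmod_ge0//; last by apply: (HA j).2; exact: Ai.
    by apply: (le_trans (vnorm_coord _ _)); apply: (le_trans wr); exact: ltW.
  rewrite sumr_const card_ord -[leLHS]mulr_natr -mulrA ler_piMr ?(ltW d0)//.
  by rewrite ler_pdivrMl// mulr1 ler_nat.
have T u (t : C) : vnorm u <= r -> cmod t <= 1 ->
    cmod (f (z + t *: u) - f z - t * L u) <= 8 * B * cmod t ^+ 2.
  move=> ur t1; apply/ler_addgt0Pl => d d0; have d30 : 0 < d / 3 by rewrite divr_gt0.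
  have tu : vnorm (t *: u) <= r.
    by rewrite vnormZ; apply: le_trans ur; rewrite ler_piMl ?vnorm_ge0.
  have wz x : vnorm x <= r -> vnorm (z + x - z) < r0.
    by move=> xr; rewrite addrAC subrr add0r (le_lt_trans xr).
  have [A2 FA2 HA2] := hf _ d30; have [A3 FA3 HA3] := lim u _ ur d30.
  have [i [[Ai1' Ai2] Ai3]] := filter_ex (filterI (filterI FA1 FA2) FA3).
  have gB (s : C) : cmod s <= 1 -> cmod (h i (z + s *: u)) <= B.
    move=> s1; apply: hB => //; rewrite vnormZ; apply: le_trans ur.
    by rewrite ler_piMl ?vnorm_ge0.
  have [_ /(_ t t1)] := entire_taylor2 (eh i) gB.
  have := HA2 i Ai2 _ (wz _ tu).
  have := HA2 i Ai2 z ltac:(by rewrite subrr vnorm0).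
  have := HA3 i Ai3.
  set a := h i (z + t *: u); set b := f (z + t *: u); set a' := h i z; set b' := f z.
  set p := 'd _ _ _; set q := L u => h1 h2 h3 h4.
  have -> : b - b' - t * q = (a - a' - t * p) - (a - b) + (a' - b') + t * (p - q) by ring.
  apply: (le_trans (cmodD _ _)); rewrite cmodM.
  have h5 : cmod t * cmod (p - q) <= d / 3.
    by rewrite -[leRHS]mul1r; apply: ler_pM; rewrite ?cmod_ge0.
  have := cmodD ((a - a' - t * p) - (a - b)) (a' - b').
  have := cmodB (a - a' - t * p) (a - b).
  by clear -h2 h3 h4 h5; lra.
pose Q := 8 * B / r ^+ 2.
have Q0 : 0 <= Q by rewrite divr_ge0 ?mulr_ge0 ?exprn_ge0 ?(ltW r_gt0).
have Q1 : 0 < Q + 1 by rewrite ltr_wpDl.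
exists (Num.min r (e / (Q + 1))); first by rewrite lt_min r_gt0 divr_gt0.
move=> w; rewrite lt_min ltr_pdivlMr// => /andP[wr we].
have [w0|w0] := eqVneq (vnorm w) 0.
  have -> : w = 0 by apply/normr0_eq0; rewrite vnormE w0.
  by rewrite addr0 subrr mul0mx mxE subrr cmod0 vnorm0 mulr0.
have vw : 0 < vnorm w by rewrite lt_def w0 vnorm_ge0.
(* Writing w = t u with vnorm u = r turns the estimate along lines into one of order vnorm w ^ 2. *)
pose t : C := (vnorm w / r)%:C%C.
have t0 : t != 0 by rewrite -cmod_eq0 cmodR normr_eq0 mulf_neq0// invr_eq0 gt_eqF.
have ct : cmod t = vnorm w / r by rewrite cmodR ger0_norm// divr_ge0// ltW.
have := T (t^-1 *: w) t; rewrite scalerA mulfV// scale1r LZ mulrA mulfV// mul1r.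
rewrite vnormZ cmodV ct invf_div divfK// lexx => /(_ isT).
rewrite ler_pdivrMr// mul1r => /(_ (ltW wr))/le_trans; apply.
rewrite exprMn exprVn mulrCA -/Q.
have -> : vnorm w ^+ 2 * (8 * B / r ^+ 2) = (vnorm w * Q) * vnorm w by rewrite /Q; ring.
rewrite ler_wpM2r ?vnorm_ge0//.
by clear -we vw; lra.
Qed.

End Vectors.

(** * Separation and completeness of H(M) *)

Section HspaceComplete.
Context {R : realType} {Gam : Type} {k : nat} (M : Gam -> 'rV[R[i]]_k -> {nonneg R}).
Local Notation C := R[i].

(** Condition (c) of a defining family by itself: it passes to [family_tensor] and yields separation
    and completeness. *)
Definition nondegenerate := forall z : 'rV[R[i]]_k,
    exists c, exists2 O : set 'rV[R[i]]_k, nbhs z O &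
    exists2 a : R, 0 < a & forall z', O z' -> a <= (M c z')%:num.

Hypothesis nd : nondegenerate.

Lemma nondegenerate_gt0 z : exists c, 0 < (M c z)%:num.
Proof.
have [c [U /nbhs_singleton Oz [a a0 H]]] := nd z; exists c.
exact: lt_le_trans (H _ Oz).
Qed.

Lemma hspace_ext (f g : hspace M) : (forall z, f z = g z) -> f = g.
Proof. by move=> fg; apply: val_inj; apply/funext => z; exact: fg. Qed.

Lemma hspaceBE (f g : hspace M) z : (f - g) z = f z - g z.
Proof. by []. Qed.

Lemma hseminorm1 c (f : hspace M) : hseminorm [:: c] f = hnorm M c f.
Proof. by rewrite /hseminorm big_cons big_nil; apply/max_idPl; exact: hnorm_ge0. Qed.

Lemma hspace_hausdorff : hausdorff_space (hspace M).
Proof.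
move=> p q pq; apply: hspace_ext => z; apply/eqP; apply/negPn/negP => pqz.
have [c c0] := nondegenerate_gt0 z.
pose e := (M c z)%:num * cmod (p z - q z) / 2.
have e0 : 0 < e by rewrite divr_gt0// mulr_gt0// cmod_gt0 subr_eq0.
have := pq (hball [:: c] e p) (hball [:: c] e q).
case; [exact/hball_nbhs/hballxx|exact/hball_nbhs/hballxx|].
move=> g []; rewrite /hball /= !hseminorm1 => gp gq.
have := hnorm_ub c (g - p) z; have := hnorm_ub c (g - q) z; rewrite !hspaceBE => h1 h2.
have : (M c z)%:num * cmod (p z - q z) <=
    (M c z)%:num * cmod (g z - q z) + (M c z)%:num * cmod (g z - p z).
  rewrite -mulrDr ler_wpM2l//.
  have -> : p z - q z = (g z - q z) - (g z - p z) by ring.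
  exact: cmodB.
have e2 : (M c z)%:num * cmod (p z - q z) = e + e by rewrite -splitr.
by rewrite e2; clear -gp gq h1 h2; lra.
Qed.

(** A Cauchy filter converges pointwise since some M_c is positive at each point, and uniformly near
    it since some M_c is bounded below there; so the limit is entire. *)
Lemma hspace_complete : tvs_complete (hspace M).
Proof.
move=> F FF cF.
have cF1 c (e : R) : 0 < e -> exists2 A, F A & forall g h : hspace M, A g -> A h ->
    forall z, (M c z)%:num * cmod (g z - h z) <= e.
  move=> e0; have [[A B] /= [FA FB] AB] := cF _ (hball_nbhs (hballxx [:: c] (0 : hspace M) e0)).
  have e20 : 0 < e / 2 by rewrite divr_gt0.
  have [[A' B'] /= [FA' FB'] AB'] := cF _ (hball_nbhs (hballxx [:: c] (0 : hspace M) e20)).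
  exists (A' `&` B'); first exact: filterI.
  move=> g h [Ag Bg] [Ah Bh] z.
  have := AB' (g, h) (conj Ag Bh).
  rewrite /hball /= subr0 hseminorm1 => H.
  have := hnorm_ub c (g - h) z; rewrite hspaceBE => /le_trans; apply.
  by apply: (le_trans (ltW H)); rewrite ler_pdivrMr// ler_peMr ?(ltW e0)// ler1n.
have lim z : exists l, forall e : R, 0 < e -> exists2 A, F A &
    forall g : hspace M, A g -> cmod (g z - l) <= e.
  have [c c0] := nondegenerate_gt0 z.
  apply: (@complex_filter_lim _ _ F FF (fun g : hspace M => g z)) => e e0.
  have [A FA HA] := cF1 c _ (mulr_gt0 c0 e0); exists A => // g h Ag Ah.
  by have := HA g h Ag Ah z; rewrite ler_pM2l.
have {lim} /choice[f fP] := lim.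
have unif c (e : R) : 0 < e -> exists2 A, F A & forall g : hspace M, A g ->
    forall z, (M c z)%:num * cmod (g z - f z) <= e.
  move=> e0; have [A FA HA] := cF1 c _ e0; exists A => // g Ag z.
  apply/ler_addgt0Pr => d d0; have m1 : 0 < (M c z)%:num + 1 by rewrite ltr_wpDl.
  have [B FB HB] := fP z _ (divr_gt0 d0 m1).
  have [h [Ah Bh]] := filter_ex (filterI FA FB).
  have -> : g z - f z = (g z - h z) + (h z - f z) by ring.
  apply: (@le_trans _ _ ((M c z)%:num * (cmod (g z - h z) + cmod (h z - f z)))).
    by rewrite ler_wpM2l// cmodD.
  rewrite mulrDr lerD//; first exact: HA.
  apply: (@le_trans _ _ ((M c z)%:num * (d / ((M c z)%:num + 1)))).
    by rewrite ler_wpM2l//; exact: HB.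
  by rewrite mulrA ler_pdivrMr// mulrC ler_wpM2l ?(ltW d0)// lerDl.
have fin : in_hspace M f.
  split=> [z|c].
    have [c [U /vnorm_nbhs[r r0 rO] [a a0 H]]] := nd z.
    apply: (@entire_filter_lim _ _ _ F FF (fun g : hspace M => g : _ -> C) f z r r0).
      by move=> g; have [] := hspaceP g.
    move=> e e0; have [A FA HA] := unif c _ (mulr_gt0 a0 e0).
    exists A => // g Ag w wr; rewrite -(ler_pM2l a0); apply: le_trans (HA g Ag w).
    by rewrite ler_wpM2r ?cmod_ge0//; exact: H (rO _ wr).
  have [A FA HA] := unif c 1 ltr01; have [g Ag] := filter_ex FA.
  exists (1 + hnorm M c g) => _ [z _ <-].
  have -> : f z = g z - (g z - f z) by ring.
  apply: (@le_trans _ _ ((M c z)%:num * (cmod (g z) + cmod (g z - f z)))).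
    by rewrite ler_wpM2l// cmodB.
  by rewrite mulrDr addrC lerD//; [exact: HA|exact: hnorm_ub].
have /asboolP fP' := fin.
exists (HSpace (fP' : f \in hpred M)) => A [s [e e0 sA]].
apply: filterS sA _; rewrite /hball.
elim: s {A} => [|c s IH].
  by apply: filterS filterT => g _ /=; rewrite /hseminorm big_nil.
have e20 : 0 < e / 2 by rewrite divr_gt0.
have [B FB HB] := unif c _ e20.
apply: filterS (filterI FB IH) => g [Bg]; rewrite /= /hseminorm big_cons gt_max => ->.
rewrite andbT; apply: (@le_lt_trans _ _ (e / 2)); last by rewrite ltr_pdivrMr// ltr_pMr// ltr1n.
by apply: hnorm_le => z; exact: HB.
Qed.

End HspaceComplete.

(** * Directed families and families on products *)

Section Directed.
Context {R : realType} {Gam : Type} {k : nat} (M : Gam -> 'rV[R[i]]_k -> {nonneg R}).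

Definition directed := forall c1 c2, exists c, exists2 a : R, 0 < a &
  forall z, a * ((M c1 z)%:num + (M c2 z)%:num) <= (M c z)%:num.

Lemma hnorm_le_family (c c' : Gam) (a : R) : 0 <= a ->
  (forall z, (M c z)%:num <= a * (M c' z)%:num) ->
  forall h : hspace M, hnorm M c h <= a * hnorm M c' h.
Proof.
move=> a0 H h; apply: hnorm_le => z.
apply: (@le_trans _ _ (a * (M c' z)%:num * cmod (h z))).
  by rewrite ler_wpM2r ?cmod_ge0.
by rewrite -mulrA ler_wpM2l// hnorm_ub.
Qed.

(** The index [c0] answers for the empty family, whose maximum is 0. *)
Lemma hseminorm_dominated (c0 : Gam) (s : seq Gam) : directed ->
  exists c, exists2 a : R, 0 < a & forall h : hspace M, hseminorm s h <= a * hnorm M c h.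
Proof.
move=> dM; elim: s => [|i s [c [a a0 H]]].
  by exists c0, 1 => // h; rewrite /hseminorm big_nil mul1r hnorm_ge0.
have [c' [b b0 H']] := dM i c.
have Mi z : (M i z)%:num <= b^-1 * (M c' z)%:num.
  by rewrite ler_pdivlMl//; apply: le_trans (H' z); rewrite ler_wpM2l ?(ltW b0)// lerDl.
have Mc z : (M c z)%:num <= b^-1 * (M c' z)%:num.
  by rewrite ler_pdivlMl//; apply: le_trans (H' z); rewrite ler_wpM2l ?(ltW b0)// lerDr.
have ib0 : 0 <= b^-1 by rewrite invr_ge0 ltW.
exists c', (Num.max 1 a * b^-1); first by rewrite mulr_gt0 ?invr_gt0// lt_max ltr01.
move=> h; rewrite /hseminorm big_cons ge_max -!mulrA; apply/andP; split.
  rewrite -[leLHS]mul1r; apply: ler_pM; rewrite ?hnorm_ge0 ?le_max ?lexx//.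
  exact: hnorm_le_family.
apply: (le_trans (H h)); apply: ler_pM; rewrite ?hnorm_ge0 ?(ltW a0) ?le_max ?lexx ?orbT//.
exact: hnorm_le_family.
Qed.

End Directed.

Section TensorFamily.
Context {R : realType} {Gam Om : Type} {k1 k2 : nat}.
Local Notation C := R[i].
Context (M : Gam -> 'rV[C]_k1 -> {nonneg R}) (N : Om -> 'rV[C]_k2 -> {nonneg R}).

Lemma directed_tensor : directed M -> directed N -> directed (family_tensor M N).
Proof.
move=> dM dN [c1 d1] [c2 d2]; have [c [a a0 H]] := dM c1 c2.
have [d [b b0 H']] := dN d1 d2; exists (c, d), (a * b); first exact: mulr_gt0.
move=> z /=; apply: le_trans (ler_pM _ _ (H _) (H' _)); rewrite ?mulr_ge0 ?(ltW a0) ?(ltW b0)//.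
rewrite mulrACA ler_wpM2l ?mulr_ge0 ?(ltW a0) ?(ltW b0)//.
rewrite mulrDl !mulrDr.
by apply: lerD; rewrite ?lerDl ?lerDr mulr_ge0.
Qed.

Lemma vnorm_lsubmx (z : 'rV[C]_(k1 + k2)) : vnorm (lsubmx z) <= vnorm z.
Proof.
apply/ler_addgt0Pr => e e0; have ze : 0 < vnorm z + e by rewrite ltr_wpDl ?vnorm_ge0.
apply/ltW/(vnorm_lt _ ze) => j; rewrite mxE.
by apply: (le_lt_trans (vnorm_coord _ _)); rewrite ltrDl.
Qed.

Lemma vnorm_rsubmx (z : 'rV[C]_(k1 + k2)) : vnorm (rsubmx z) <= vnorm z.
Proof.
apply/ler_addgt0Pr => e e0; have ze : 0 < vnorm z + e by rewrite ltr_wpDl ?vnorm_ge0.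
apply/ltW/(vnorm_lt _ ze) => j; rewrite mxE.
by apply: (le_lt_trans (vnorm_coord _ _)); rewrite ltrDl.
Qed.

Lemma nondegenerate_tensor : nondegenerate M -> nondegenerate N ->
  nondegenerate (family_tensor M N).
Proof.
move=> nM nN z; have [c [U /vnorm_nbhs[r r0 rU] [a a0 H]]] := nM (lsubmx z).
have [d [V /vnorm_nbhs[t t0 tV] [b b0 H']]] := nN (rsubmx z).
exists (c, d), [set w | vnorm (w - z) < Num.min r t].
  by apply/vnorm_nbhs; exists (Num.min r t) => //; rewrite lt_min r0.
exists (a * b); first exact: mulr_gt0.
move=> w /=; rewrite lt_min => /andP[wr wt].
apply: ler_pM; rewrite ?(ltW a0) ?(ltW b0)//.
  by apply/H/rU; rewrite -linearB; apply: le_lt_trans wr; exact: vnorm_lsubmx.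
by apply/H'/tV; rewrite -linearB; apply: le_lt_trans wt; exact: vnorm_rsubmx.
Qed.

End TensorFamily.

(** * Nuclearity *)

Section Cells.
Context {R : realType}.
Variable eta : R.
Hypothesis eta0 : 0 < eta.
Local Notation mR := (measurableTypeR R).

(** Half-open, so that the boxes at the corners of the lattice partition the space. *)
Definition box m (a : m.-tuple R) : set (m.-tuple mR) :=
  [set x | forall j, tnth a j <= tnth x j < tnth a j + eta].

Lemma measurable_box m (a : m.-tuple R) : measurable (box a).
Proof.
have -> : box a = \bigcap_(j in [set: 'I_m])
    ([set: _] `&` (fun x : m.-tuple mR => tnth x j) @^-1` `[tnth a j, tnth a j + eta[).
  apply/seteqP; split=> [x h j _|x h j].
    by split=> //; rewrite /= in_itv /=.
  by have [_] := h j I; rewrite /= in_itv.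
apply: fin_bigcap_measurable => // j _.
exact: (measurable_tnth j measurableT).
Qed.

Lemma lebesgue_box m (a : m.-tuple R) : lebesgue_tuple R m (box a) = (eta ^+ m)%:E.
Proof.
elim: m a => [|m IH] a.
  rewrite expr0 /= diracE mem_set// => -[]; by [].
pose b : m.-tuple R := [tuple of behead a].
have -> : lebesgue_tuple R m.+1 (box a) =
    (lebesgue_tuple R m \x @lebesgue_measure R)%E (@tuple_snoc R m @^-1` (box a)) by [].
have -> : @tuple_snoc R m @^-1` (box a) = box b `*` `[thead a, thead a + eta[%classic.
  apply/seteqP; split=> [[x y] /= h|[x y] /= [hx hy] j].
    split=> [j|].
      have := h (lift ord0 j); rewrite /tuple_snoc /= tnthS /=.
      by rewrite (tuple_eta a) tnthS.
    by have := h ord0; rewrite in_itv /=.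
  rewrite in_itv /= in hy; have [j' ->|->] := unliftP ord0 j; last exact: hy.
  by have := hx j'; rewrite /tuple_snoc /= tnthS (tuple_eta a) !tnthS.
rewrite product_measure1E//; last exact: measurable_box.
have E : @lebesgue_measure R `[thead a, thead a + eta[%classic = eta%:E.
  by rewrite lebesgue_measure_itv /= lte_fin ltrDl eta0 -EFinD [thead a + _]addrC addrK.
rewrite IH; apply: etrans (congr1 (fun u => ((eta ^+ m)%:E * u)%E) E) _.
by rewrite -EFinM exprSr.
Qed.

(** Read off from the supremum over simple functions, so that it applies to an integrand that is
    only Lebesgue measurable while the measure lives on the Borel sets. *)
Lemma integral_mono d (T : measurableType d) (mu : {measure set T -> \bar R}) (f g : T -> \bar R) :
  (forall x, 0 <= g x)%E -> (forall x, g x <= f x)%E ->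
  (\int[mu]_x g x <= \int[mu]_x f x)%E.
Proof.
move=> g0 gf; rewrite !ge0_integralTE//; last by move=> x; exact: le_trans (gf x).
apply: ereal_sup_le => _ [h hg <-]; exists h => // x.
exact: le_trans (gf x).
Qed.

Definition cell m (x : m.-tuple R) : m.-tuple int :=
  [tuple Num.floor (tnth x j / eta) | j < m].

Definition corner m (n : m.-tuple int) : m.-tuple R := [tuple (tnth n j)%:~R * eta | j < m].

Lemma cellE m (x : m.-tuple R) (n : m.-tuple int) : box (corner n) x <-> cell x = n.
Proof.
split=> [h|<- j].
  apply/eq_from_tnth => j; rewrite tnth_mktuple; apply: floor_def.
  have := h j; rewrite tnth_mktuple intrD rmorph1 ler_pdivlMr// ltr_pdivrMr//.
  by rewrite mulrDl mul1r.
rewrite !tnth_mktuple -[X in _ < _ + X]mul1r -mulrDl -ler_pdivlMr// -ltr_pdivrMr//.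
by have := floor_itv (tnth x j / eta); rewrite intrD.
Qed.

(** The sum is the integral of a step function below [f]. *)
Lemma sum_cells m (f : m.-tuple mR -> \bar R) (c : m.-tuple int -> R) (s : seq (m.-tuple int)) :
  (forall n, 0 <= c n) -> (forall x, (c (cell x))%:E <= f x)%E -> uniq s ->
  ((\sum_(n <- s) c n * eta ^+ m)%:E <= \int[lebesgue_tuple R m]_x f x)%E.
Proof.
move=> c0 cf us.
pose g x := (\sum_(n <- s) (c n)%:E * (\1_(box (corner n)) x)%:E)%E.
apply: (@le_trans _ _ (\int[lebesgue_tuple R m]_x g x)%E).
  rewrite ge0_integral_sum//=.
  - rewrite -sumEFin; apply: lee_sum => n _.
    rewrite ge0_integralZl//.
    + rewrite integral_indic//; last exact: measurable_box.
      by rewrite setIT lebesgue_box EFinM.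
    + apply/measurable_EFinP; apply: measurable_indic; exact: measurable_box.
    + by rewrite lee_fin.
  - move=> n; apply: measurable_funeM.
    by apply/measurable_EFinP; apply: measurable_indic; exact: measurable_box.
  - by move=> n x _; rewrite mule_ge0// lee_fin.
have gE x : g x = if cell x \in s then (c (cell x))%:E else 0%E.
  rewrite /g; case: ifP => [xs|/negP xs].
    rewrite (bigD1_seq (cell x))//= big1 ?adde0.
      by rewrite indicE mem_set ?mule1//; apply/cellE.
    move=> n nx; rewrite indicE memNset ?mule0// => /cellE E.
    by move: nx; rewrite -E eqxx.
  rewrite big_seq big1// => n ns; rewrite indicE memNset ?mule0// => /cellE E.
  by apply: xs; rewrite E.
apply: integral_mono => x; rewrite gE.
  by case: ifP; rewrite // lee_fin.
case: ifP => // _; apply: le_trans (cf x).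
by rewrite lee_fin.
Qed.

End Cells.

(** * Newton expansions on a polydisc *)

Section Polydisc.
Context {R : realType} {k : nat}.
Local Notation C := R[i].
Variable tau : R.
Hypothesis tau0 : 0 < tau.
Local Notation V := 'rV[C]_k.
Implicit Types (f : V -> C) (w : V) (i : 'I_k).

(** Infinitely many distinct points of the disc of radius [tau]; repeated nodes would call for
    derivatives. *)
Definition node (j : nat) : C := (tau / j.+1%:R)%:C%C.

Lemma node_inj : injective node.
Proof.
move=> i j [] /(mulfI (lt0r_neq0 tau0)) /invr_inj /eqP.
by rewrite eqr_nat => /eqP [].
Qed.

Lemma cmod_node j : cmod (node j) <= tau.
Proof.
rewrite cmodR ger0_norm ?divr_ge0 ?(ltW tau0)//.
by rewrite ler_pdivrMr// ler_peMr ?(ltW tau0)// ler1n.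
Qed.

Definition upd i (x : C) w : V := \row_j (if j == i then x else w 0 j).

Lemma upd_same i x y w : upd i x (upd i y w) = upd i x w.
Proof. by apply/rowP => j; rewrite !mxE; case: eqP. Qed.

Lemma updC i i' x y w : i != i' -> upd i x (upd i' y w) = upd i' y (upd i x w).
Proof.
move=> ii'; apply/rowP => j; rewrite !mxE; case: eqVneq => // ->.
by rewrite (negPf ii').
Qed.

Lemma upd_id i w : upd i (w 0 i) w = w.
Proof. by apply/rowP => j; rewrite !mxE; case: eqVneq => // ->. Qed.

(** The variables are expanded one at a time, and [coef] preserves this property. *)
Definition sep_entire f := forall i w x, cdiff (fun x => f (upd i x w)) x.

Definition polydisc (r : R) w := forall j, cmod (w 0 j) <= r.

Lemma polydisc_upd r i x w : cmod x <= r -> polydisc r w -> polydisc r (upd i x w).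
Proof. by move=> xr wr j; rewrite mxE; case: ifP. Qed.

(* The factor (8 tau) ^+ j makes a bound of f on the polydisc of radius 17 tau a bound
   of the coefficients. *)
Definition coef i (j : nat) f w : C :=
  (8 * tau)%:C%C ^+ j * newton node j (fun x => f (upd i x w)) (node j).

Lemma newton_comb (t : nat -> C) j (z : C) : exists l : seq (C * C), forall phi,
  newton t j phi z = \sum_(q <- l) q.1 * phi q.2.
Proof.
elim: j z => [|j IH] z; first by exists [:: (1, z)] => phi; rewrite big_seq1 mul1r.
have [l1 H1] := IH z; have [l2 H2] := IH (t j).
exists ([seq (q.1 / (z - t j), q.2) | q <- l1] ++ [seq (- q.1 / (z - t j), q.2) | q <- l2]).
move=> phi /=; rewrite H1 H2 big_cat !big_map /= mulrBl !mulr_suml -sumrN.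
by congr (_ + _); apply: eq_bigr => q _; rewrite ?mulNr mulrAC.
Qed.

Lemma coef_comb i j w : exists l : seq (C * V), forall f,
  coef i j f w = \sum_(q <- l) q.1 * f q.2.
Proof.
have [l H] := newton_comb node j (node j).
exists [seq ((8 * tau)%:C%C ^+ j * q.1, upd i q.2 w) | q <- l] => f.
by rewrite /coef H big_map mulr_sumr; apply: eq_bigr => q _; rewrite mulrA.
Qed.

Lemma coef_upd i j f x w : coef i j f (upd i x w) = coef i j f w.
Proof. by rewrite /coef; under eq_fun do rewrite upd_same. Qed.

Lemma cdiff_cst (c z : C) : cdiff (fun=> c) z.
Proof. by exists 0 => e e0; exists 1 => // h _; rewrite mul0r !subrr cmod0 mulr_ge0 ?cmod_ge0 ?ltW. Qed.

Lemma coef_sep i j f : sep_entire f -> sep_entire (coef i j f).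
Proof.
move=> sf i' w x; have [<-|ii'] := eqVneq i i'.
  by under eq_fun do rewrite coef_upd; exact: cdiff_cst.
have [l H] := newton_comb node j (node j).
have E y : coef i j f (upd i' y w) =
    \sum_(q <- [seq ((8 * tau)%:C%C ^+ j * q.1, q.2) | q <- l])
       q.1 * f (upd i' y (upd i q.2 w)).
  rewrite /coef H big_map mulr_sumr; apply: eq_bigr => q _ /=.
  by rewrite mulrA updC.
under eq_fun do rewrite E.
elim: [seq _ | q <- l] => [|q s IH].
  by under eq_fun do rewrite big_nil; exact: cdiff_cst.
under eq_fun do rewrite big_cons; apply: cdiffD IH.
have [d Hd] := sf i' (upd i q.2 w) x; exists (q.1 * d) => e e0.
have q1 : 0 < cmod q.1 + 1 by rewrite ltr_wpDl ?cmod_ge0.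
have [r r0 Hr] := Hd _ (divr_gt0 e0 q1); exists r => // h /Hr.
rewrite -mulrA -!mulrBr cmodM => /(ler_wpM2l (cmod_ge0 q.1))/le_trans; apply.
rewrite !mulrA ler_wpM2r ?cmod_ge0// ler_pdivrMr// mulrC ler_wpM2l ?(ltW e0)//.
by rewrite lerDl.
Qed.

(** The radius 17 tau is chosen for this value: a division costs 1 / (8 tau), a factor z - t_i is at
    most 2 tau for |z| <= tau, and the Newton terms decay like (1 / 4) ^ j. *)
Lemma rate : (2 / (17 * tau - tau)) = (8 * tau)^-1.
Proof. by field; apply/andP; split; rewrite gt_eqF//; have := tau0; lra. Qed.

(** The coefficients obey the same bound [S] on the same polydisc as [f], which allows iteration
    over the variables. *)
Lemma coef_step f i w (S : R) (n : nat) : sep_entire f ->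
  (forall w, polydisc (17 * tau) w -> cmod (f w) <= S) -> polydisc (17 * tau) w ->
  (forall j, cmod (coef i j f w) <= S) /\
  (cmod (w 0 i) <= tau ->
    cmod (f w) <= \sum_(j < n) (1 / 4) ^+ j * cmod (coef i j f w) + (1 / 4) ^+ n * S).
Proof.
move=> sf fS wP; pose phi x := f (upd i x w).
have t17 : tau < 17 * tau by have := tau0; lra.
have phiS z : cmod z <= 17 * tau -> cmod (phi z) <= S.
  by move=> hz; apply/fS/polydisc_upd.
have ext := newton_ext node_inj cmod_node t17 (sf i w) phiS.
rewrite rate in ext.
have t8 : 0 < 8 * tau by rewrite mulr_gt0.
have c8 j : cmod ((8 * tau)%:C%C ^+ j : C) = (8 * tau) ^+ j.
  by rewrite cmodX cmodR gtr0_norm.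
split=> [j|wt].
  have [G [_ _ GB GE _]] := ext j.
  rewrite /coef cmodM c8 -GE.
    have hG := GB (node j) (le_trans (cmod_node j) (ltW t17)).
    apply: (le_trans (ler_wpM2l (exprn_ge0 j (ltW t8)) hG)).
    by rewrite mulrA exprVn divff ?mul1r// gt_eqF// exprn_gt0.
  by rewrite (mem_map node_inj) mem_iota ltnn.
have [G [_ _ GB _ fE]] := ext n.
have prodB j : cmod (\prod_(l < j) (w 0 i - node l)) <= (2 * tau) ^+ j.
  rewrite -[X in _ ^+ X]card_ord -prodr_const.
  elim/big_ind2: _ => [|x1 y1 x2 y2 h1 h2|l _]; first by rewrite cmod1.
    by rewrite cmodM ler_pM ?cmod_ge0.
  apply: (le_trans (cmodB _ _)); have := cmod_node l; have := wt; lra.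
have fE' := fE (w 0 i); rewrite upd_id in fE'.
rewrite fE'; apply: (le_trans (cmodD _ _)); apply: lerD.
  apply: (le_trans (cmod_sum _ _ _)); apply: ler_sum => j _.
  rewrite /coef !cmodM c8 -/phi [leLHS]mulrC mulrA.
  apply: ler_wpM2r; first exact: cmod_ge0.
  apply: (le_trans (prodB j)); rewrite -exprMn le_eqVlt; apply/orP; left; apply/eqP.
  by congr (_ ^+ _); field.
rewrite cmodM; have h1 := GB (w 0 i) (le_trans wt (ltW t17)).
apply: (le_trans (ler_pM (cmod_ge0 _) (cmod_ge0 _) h1 (prodB n))).
rewrite mulrAC -exprMn le_eqVlt; apply/orP; left; apply/eqP; congr (_ ^+ _ * _).
by field; rewrite gt_eqF.
Qed.

Fixpoint coefs (p : seq ('I_k * nat)) f : V -> C :=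
  if p is q :: p' then coefs p' (coef q.1 q.2 f) else f.

Fixpoint zeros (cs : seq 'I_k) w : V := if cs is i :: cs' then zeros cs' (upd i 0 w) else w.

Fixpoint orders (n m : nat) : seq (seq nat) :=
  if m is m'.+1 then [seq j :: a | j <- iota 0 n, a <- orders n m'] else [:: [::]].

Lemma mem_orders n m a : (a \in orders n m) = (size a == m) && all (ltn^~ n) a.
Proof.
elim: m a => [|m IH] [|j a] /=; rewrite ?inE//.
  by apply/allpairsP => -[[x y] [_ _]].
apply/allpairsP/andP => [[[x y] /= [hx hy [-> ->]]]|[sa /andP[jn na]]].
  by move: hx hy; rewrite mem_iota IH eqSS add0n /= => -> /andP[-> ->].
by exists (j, a); rewrite mem_iota IH -eqSS add0n /= sa jn na.
Qed.

Lemma uniq_orders n m : uniq (orders n m).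
Proof.
elim: m => [|m IH] //=; apply: allpairs_uniq; rewrite ?iota_uniq//.
by move=> [x y] [x' y'] _ _ /= [-> ->].
Qed.

Lemma sum_geo (q : R) n : 0 <= q <= 1 / 2 -> \sum_(j <- iota 0 n) q ^+ j <= 2.
Proof.
move=> /andP[q0 q1]; have -> : iota 0 n = index_iota 0 n by rewrite /index_iota subn0.
rewrite big_mkord.
suff : \sum_(j < n) q ^+ j <= 2 - 2 * (1 / 2) ^+ n.
  by move=> /le_trans; apply; rewrite gerBl mulr_ge0// exprn_ge0.
elim: n => [|n IH]; first by rewrite big_ord0 expr0 mulr1 subrr.
rewrite big_ord_recr /=; have qn : q ^+ n <= (1 / 2) ^+ n by apply: lerXn2r; rewrite ?nnegrE.
rewrite exprS.
move: IH qn; move: (\sum_(j < n) _) (q ^+ n) ((1 / 2) ^+ n) => x y h; clear; lra.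
Qed.

Lemma sum_orders (q : R) n m : 0 <= q <= 1 / 2 ->
  \sum_(a <- orders n m) q ^+ sumn a <= 2 ^+ m.
Proof.
move=> q01; have q0 : 0 <= q by case/andP: q01.
elim: m => [|m IH]; first by rewrite /= big_seq1 /=.
rewrite /= big_allpairs_dep /=; under eq_bigr do under eq_bigr do rewrite exprD.
under eq_bigr do rewrite -mulr_sumr.
rewrite -mulr_suml exprS; apply: ler_pM => //.
- by apply: sumr_ge0 => j _; exact: exprn_ge0.
- by apply: sumr_ge0 => j _; exact: exprn_ge0.
exact: sum_geo.
Qed.

(** A coefficient taken in one variable no longer depends on it, so this variable may be set to 0,
    whence [zeros cs w]. The truncation error e of one variable meets the error E >= e of the
    others, amplified by a geometric sum: 2 E + e <= 3 E. *)
Lemma coefs_bound (cs : seq 'I_k) f w (S : R) (n : nat) : sep_entire f ->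
  (forall w, polydisc (17 * tau) w -> cmod (f w) <= S) -> polydisc tau w ->
  cmod (f w) <= \sum_(a <- orders n (size cs))
     (1 / 4) ^+ sumn a * cmod (coefs (zip cs a) f (zeros cs w)) + 3 ^+ size cs * ((1 / 4) ^+ n * S).
Proof.
elim: cs f w => [|i cs IH] f w sf fS wt.
  rewrite /= big_seq1 /= [leRHS](_ : _ = cmod (f w) + (1 / 4) ^+ n * S); last by ring.
  rewrite lerDl mulr_ge0 ?exprn_ge0//.
  apply: le_trans (fS 0 _); rewrite ?cmod_ge0// => j.
  by rewrite mxE cmod0 mulr_ge0 ?(ltW tau0).
have wt17 : polydisc (17 * tau) w.
  by move=> j; apply: (le_trans (wt j)); have := tau0; lra.
have S0 : 0 <= S by apply: le_trans (fS w wt17); exact: cmod_ge0.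
have [_ /(_ (wt i)) H] := @coef_step f i w S n sf fS wt17.
apply: (le_trans H); rewrite /= big_allpairs_dep /=.
have -> : iota 0 n = index_iota 0 n by rewrite /index_iota subn0.
rewrite big_mkord.
pose E := 3 ^+ size cs * ((1 / 4) ^+ n * S).
apply: (@le_trans _ _ (\sum_(j < n) ((1 / 4) ^+ j * (\sum_(a <- orders n (size cs))
   (1 / 4) ^+ sumn a * cmod (coefs (zip cs a) (coef i j f) (zeros cs (upd i 0 w))) + E))
   + (1 / 4) ^+ n * S)).
  rewrite lerD2r; apply: ler_sum => j _; rewrite ler_wpM2l ?exprn_ge0//.
  rewrite -(coef_upd i j f 0 w); apply: IH.
  - exact: coef_sep.
  - by move=> v hv; exact: (@coef_step f i v S n sf fS hv).1.
  - by apply: polydisc_upd => //; rewrite cmod0 ltW.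
under eq_bigr do rewrite mulrDr mulr_sumr.
rewrite big_split /= -addrA; apply: lerD.
  apply: ler_sum => j _; apply: ler_sum => a _.
  by rewrite mulrA -exprD.
rewrite -mulr_suml exprS -mulrA -/E.
have E0 : (1 / 4) ^+ n * S <= E.
  by rewrite /E ler_peMl ?mulr_ge0 ?exprn_ge0// exprn_ege1// ler1n.
have E1 : 0 <= E by rewrite !mulr_ge0 ?exprn_ge0.
have E2 : (\sum_(j < n) (1 / 4) ^+ j) * E <= 2 * E.
  rewrite ler_wpM2r// -(big_mkord xpredT (fun j => (1 / 4) ^+ j)) /index_iota subn0.
  by apply: sum_geo; apply/andP; split; lra.
by clear -E0 E1 E2; lra.
Qed.

Lemma zeros_enum w : zeros (enum 'I_k) w = 0.
Proof.
have H cs v j : (zeros cs v) 0 j = if j \in cs then 0 else v 0 j.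
  elim: cs v => [|i cs IH] v //=; rewrite IH inE mxE.
  by case: eqP => //= _; case: ifP.
by apply/rowP => j; rewrite H mem_enum mxE.
Qed.

Lemma coefs_comb p w : exists l : seq (C * V), forall f,
  coefs p f w = \sum_(q <- l) q.1 * f q.2.
Proof.
elim: p => [|[i j] p [l IH]]; first by exists [:: (1, w)] => f; rewrite big_seq1 mul1r.
have /choice[m Hm] := coef_comb i j.
exists (flatten [seq [seq (q.1 * q'.1, q'.2) | q' <- m q.2] | q <- l]) => f.
rewrite /= IH big_flatten big_map; apply: eq_bigr => q _.
by rewrite Hm big_map mulr_sumr; apply: eq_bigr => q' _; rewrite mulrA.
Qed.

Lemma coefs_le p f (S : R) w : sep_entire f ->
  (forall w, polydisc (17 * tau) w -> cmod (f w) <= S) -> polydisc (17 * tau) w ->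
  cmod (coefs p f w) <= S.
Proof.
elim: p f => [|[i j] p IH] f sf fS wP; first exact: fS.
apply: IH => //; first exact: coef_sep.
by move=> v vP; exact: (@coef_step f i v S 0 sf fS vP).1.
Qed.

End Polydisc.

(** * Lattice points, their weights, and nuclearity *)

Section Lattice.
Context {R : realType} {k : nat}.
Local Notation C := R[i].
Variable eta : R.
Hypothesis eta0 : 0 < eta.

Definition lattice (n : (k + k).-tuple int) : 'rV[C]_k := complex_of_tuple (corner eta n).

Lemma vnorm_cell (x : (k + k).-tuple R) :
  vnorm (complex_of_tuple x - lattice (cell eta x)) < 2 * eta.
Proof.
have /(cellE eta0) H := erefl (cell eta x).
apply/vnorm_lt; first by rewrite mulr_gt0.
move=> j; apply: (le_lt_trans (cmod_le_ReIm _)).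
rewrite !mxE /= mulr_natl mulr2n.
apply: ltrD; rewrite ger0_norm ?subr_ge0 ?ltrBlDl.
- by have /andP[] := H (lshift k j).
- by have /andP[] := H (lshift k j).
- by have /andP[] := H (rshift k j).
- by have /andP[] := H (rshift k j).
Qed.

Lemma lattice_near (z : 'rV[C]_k) : exists n, vnorm (z - lattice n) < 2 * eta.
Proof.
pose x : (k + k).-tuple R := [tuple (match fintype.split j with
  | inl a => Re (z 0 a) | inr b => Im (z 0 b) end) | j < k + k].
exists (cell eta x); rewrite (_ : z = complex_of_tuple x); first exact: vnorm_cell.
apply/rowP => j; rewrite mxE !tnth_mktuple.
have -> : fintype.split (lshift k j) = inl j by exact: (unsplitK (inl j)).
have -> : fintype.split (rshift k j) = inr j by exact: (unsplitK (inr j)).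
by case: (z 0 j).
Qed.

End Lattice.

Section Nuclear.
Context {R : realType} {Gam : Type} {k : nat} (M : Gam -> 'rV[R[i]]_k -> {nonneg R}).
Local Notation C := R[i].
Hypothesis cI : condition_I M.
Hypothesis cII : condition_II M.

Lemma condition_II_ball c : exists c' (r : R) (a : R), [/\ 0 < r, 0 < a &
  forall z w, vnorm w < r -> (M c z)%:num <= a * (M c' (z + w))%:num].
Proof.
have [c' [B /vnorm_nbhs0[r r0 rB] [a a0 H]]] := cII c.
by exists c', r, a; split=> // z w /rB; exact: H.
Qed.

(** On a cell, (II) moves the weight from the corner to any point x, (I) brings in L(x), and (II)
    moves back. So the ratio of the two weights at the corner is at most a constant times L on the
    whole cell, and [sum_cells] bounds the sum of the ratios by the integral of L. *)
Lemma lattice_weight c : exists c' (r : R), 0 < r /\ forall eta, 0 < eta -> 2 * eta <= r ->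
  exists (l : (k + k).-tuple int -> R) (W : R), [/\ forall n, 0 <= l n,
    forall s, uniq s -> \sum_(n <- s) l n <= W &
    forall n, (M c (lattice eta n))%:num <= l n * (M c' (lattice eta n))%:num].
Proof.
have [c1 [r1 [a1 [r10 a10 H1]]]] := condition_II_ball c.
have [c2 [L [[_ Lint] HL _]]] := cI c1.
have [c3 [r3 [a3 [r30 a30 H3]]]] := condition_II_ball c2.
exists c3, (Num.min r1 r3); split; first by rewrite lt_min r10.
move=> eta eta0; rewrite le_min => /andP[er1 er3].
(* If the denominator vanishes then, by [key], so does the numerator, and the value 0 of the
   quotient is the right one. *)
pose l n : R := (M c (lattice eta n))%:num / (M c3 (lattice eta n))%:num.
have key x : (M c (lattice eta (cell eta x)))%:num <=
    a1 * a3 * (L (complex_of_tuple x))%:num * (M c3 (lattice eta (cell eta x)))%:num.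
  set z := lattice _ _; set w := complex_of_tuple x.
  have zw : vnorm (w - z) < 2 * eta by exact: vnorm_cell.
  have := H1 z (w - z) (lt_le_trans zw er1).
  rewrite [z + _]addrC subrK => /le_trans; apply.
  rewrite -!mulrA ler_wpM2l ?(ltW a10)//; apply: (le_trans (HL w)).
  rewrite mulrCA ler_wpM2l//; have := H3 w (z - w); rewrite [w + _]addrC subrK; apply.
  by rewrite -vnormN opprB (lt_le_trans zw).
have a13 : 0 < a1 * a3 by rewrite mulr_gt0.
have l0 n : 0 <= l n by rewrite divr_ge0.
have lL x : l (cell eta x) / (a1 * a3) <= (L (complex_of_tuple x))%:num.
  rewrite ler_pdivrMr// /l; have := key x.
  set p := (M c3 _)%:num; have pn : 0 <= p by rewrite /p.
  have [->|p0] := eqVneq p 0.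
    by move=> _; rewrite invr0 mulr0 mulr_ge0 ?(ltW a13).
  have {}p0 : 0 < p by rewrite lt_def p0.
  by move=> H; rewrite ler_pdivrMr//; apply: (le_trans H); rewrite ler_wpM2r// mulrC.
pose I := (\int[lebesgue_tuple R (k + k)]_x `|(L (complex_of_tuple x))%:num|%:E)%E.
have I0 : (0 <= I)%E by apply: integral_ge0 => x _; rewrite lee_fin.
have Ifin : I = (fine I)%:E by rewrite fineK// ge0_fin_numE.
exists l, (fine I * (a1 * a3) / eta ^+ (k + k)); split=> //.
  move=> s us; rewrite ler_pdivlMr ?exprn_gt0//.
  have := @sum_cells R eta eta0 (k + k) (fun x => `|(L (complex_of_tuple x))%:num|%:E)
    (fun n => l n / (a1 * a3)) s.
  rewrite -/I Ifin lee_fin => /(_ _ _ us) H.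
  rewrite mulr_suml -ler_pdivrMr// mulr_suml.
  under eq_bigr do rewrite mulrAC.
  apply: H => [n|x]; first by rewrite divr_ge0// ltW.
  by rewrite lee_fin ger0_norm.
move=> n; have := key (corner eta n).
have -> : cell eta (corner eta n) = n.
  by apply/(cellE eta0) => j; rewrite lexx /= ltrDl.
rewrite /l; set p := (M c3 _)%:num; have [->|p0] := eqVneq p 0.
  by rewrite !mulr0.
by rewrite divfK.
Qed.

(* Weights are squared so that one factor bounds the functionals of [nuclear] and the
   other one is left in front of them. *)
Lemma lattice_weight2 c : exists c' (r : R), 0 < r /\ forall eta, 0 < eta -> 2 * eta <= r ->
  exists (l : (k + k).-tuple int -> R) (W : R), [/\ forall n, 0 <= l n,
    forall s, uniq s -> \sum_(n <- s) l n <= W &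
    forall n, (M c (lattice eta n))%:num <= l n ^+ 2 * (M c' (lattice eta n))%:num].
Proof.
have [c1 [r1 [r10 H1]]] := lattice_weight c.
have [c2 [r2 [r20 H2]]] := lattice_weight c1.
exists c2, (Num.min r1 r2); split; first by rewrite lt_min r10.
move=> eta eta0; rewrite le_min => /andP[er1 er2].
have [l1 [W1 [l10 l1W Hl1]]] := H1 eta eta0 er1.
have [l2 [W2 [l20 l2W Hl2]]] := H2 eta eta0 er2.
(* Both terms are summable, and l1 l2 <= (l1 + l2)^2. *)
exists (fun n => l1 n + l2 n), (W1 + W2); split=> [n|s us|n]; first exact: addr_ge0.
  by rewrite big_split; apply: lerD; [exact: l1W|exact: l2W].
apply: (le_trans (Hl1 n)).
apply: (@le_trans _ _ (l1 n * (l2 n * (M c2 (lattice eta n))%:num))).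
  by rewrite ler_wpM2l.
rewrite mulrA ler_wpM2r// expr2; apply: ler_pM => //; by rewrite ?lerDl ?lerDr.
Qed.

Lemma sum_subseq_le (I : eqType) (s t : seq I) (F : I -> R) : (forall i, 0 <= F i) ->
  uniq s -> {subset s <= t} -> \sum_(i <- s) F i <= \sum_(i <- t) F i.
Proof.
move=> F0; elim: s t => [|i s IH] t /=; first by move=> _ _; rewrite big_nil sumr_ge0.
move=> /andP[iNs us] st; have it : i \in t by apply: st; rewrite inE eqxx.
rewrite big_cons (perm_big _ (perm_to_rem it)) big_cons lerD2l; apply: IH => // j js.
have := st j; rewrite inE js orbT => /(_ isT); rewrite (perm_mem (perm_to_rem it)) inE.
by case/orP => // /eqP ji; move: iNs; rewrite -ji js.
Qed.

Lemma mem_le_sumn (a : seq nat) j : j \in a -> (j <= sumn a)%N.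
Proof.
elim: a => //= x a IH; rewrite inE => /orP[/eqP->|/IH h]; first exact: leq_addr.
exact: leq_trans h (leq_addl _ _).
Qed.

Definition comb (l : seq (C * 'rV[C]_k)) (f : 'rV[C]_k -> C) : C :=
  \sum_(q <- l) q.1 * f q.2.

Lemma nuclear c : exists c' (J : choiceType) (w : J -> R) (l : J -> seq (C * 'rV[C]_k)) (W : R),
  [/\ forall j, 0 <= w j, forall s, uniq s -> \sum_(j <- s) w j <= W,
    forall j (f : hspace M), cmod (comb (l j) f) <= w j * hnorm M c' f
  & forall (f : hspace M) z (e : R), 0 < e -> exists2 s, uniq s &
     (M c z)%:num * cmod (f z) <= \sum_(j <- s) w j * cmod (comb (l j) f) + e].
Proof.
have [c1 [r1 [a1 [r10 a10 H1]]]] := condition_II_ball c.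
have [c2 [r2 [r20 H2]]] := lattice_weight2 c1.
have [c3 [r3 [a3 [r30 a30 H3]]]] := condition_II_ball c2.
pose r := Num.min (Num.min r1 r2) r3.
have r_gt0 : 0 < r by rewrite !lt_min r10 r20.
(* Then tau = r / 20, so that 17 tau < r. *)
pose eta := r / 40.
have eta0 : 0 < eta by rewrite divr_gt0.
pose tau := 2 * eta; have tau0 : 0 < tau by rewrite mulr_gt0.
have [tr1 tr2 tr3] : [/\ tau < r1, tau <= r2 & 17 * tau < r3].
  have : tau < r by rewrite /tau /eta; clear -r_gt0; lra.
  have : 17 * tau < r by rewrite /tau /eta; clear -r_gt0; lra.
  by rewrite !lt_min => /andP[_ ->] /andP[/andP[-> /ltW ->] _].
have {H2} [l0 [W [l00 l0W Hl0]]] := H2 eta eta0 tr2.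
pose J : choiceType := ((k + k).-tuple int * seq nat)%type.
pose A := a1 + a3 + 1.
have A0 : 0 < A by rewrite /A; clear -a10 a30; lra.
have a1A : a1 <= A by rewrite /A -addrA lerDl addr_ge0// ltW.
have a3A : a3 <= A by rewrite /A [a1 + a3]addrC -addrA lerDl addr_ge0// ltW.
(* The decay (1 / 4) ^ |a| is split evenly between [w] and the normalisation [s0] of the functionals
   below. As M_c1 <= l0^2 M_c2, dividing by [l0] in [s0] leaves the functionals bounded by one
   factor [l0]; the factor [l0] in [w] then gives w * s0 = A M_c1 (1 / 4) ^ |a|. *)
pose w (j : J) : R := if size j.2 == k then A * (l0 j.1 * (1 / 2) ^+ sumn j.2) else 0.
have w0 j : 0 <= w j.
  by rewrite /w; case: ifP => // _; rewrite !mulr_ge0 ?exprn_ge0 ?(ltW A0).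
pose Th (j : J) (f : 'rV[C]_k -> C) :=
  coefs tau (zip (enum 'I_k) j.2) (fun v => f (lattice eta j.1 + v)) 0.
pose s0 (j : J) : R := if size j.2 == k then
  (M c1 (lattice eta j.1))%:num / l0 j.1 * (1 / 2) ^+ sumn j.2 else 0.
have s00 j : 0 <= s0 j.
  by rewrite /s0; case: ifP => // _; rewrite !mulr_ge0 ?invr_ge0 ?exprn_ge0.
have /choice[l lE] : forall j, exists l, forall f, (s0 j)%:C%C * Th j f = comb l f.
  move=> j; have [l Hl] := coefs_comb tau (zip (enum 'I_k) j.2) (0 : 'rV[C]_k).
  exists [seq ((s0 j)%:C%C * q.1, lattice eta j.1 + q.2) | q <- l] => f.
  by rewrite /Th Hl /comb big_map mulr_sumr; apply: eq_bigr => q _; rewrite mulrA.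
have sepf n (f : hspace M) : sep_entire (fun v => f (lattice eta n + v)).
  move=> i v x; have [ef _] := hspaceP f.
  have E y : lattice eta n + upd i y v = (lattice eta n + upd i 0 v) + y *: delta_mx 0 i.
    rewrite -addrA; congr (_ + _); apply/rowP => j; rewrite !mxE eqxx /=.
    by case: eqVneq => _; rewrite ?mulr1 ?mulr0 ?addr0 ?add0r.
  under eq_fun do rewrite E.
  by eexists; apply: diff_line; exact: ef.
have polyv (q : R) (v : 'rV[C]_k) : polydisc q v -> 0 < q -> forall q', q < q' -> vnorm v < q'.
  by move=> h q0 q' qq'; apply/vnorm_lt; [exact: lt_trans qq'|move=> j; exact: le_lt_trans (h j) qq'].
have bound n (f : hspace M) v : polydisc (17 * tau) v ->
    (M c2 (lattice eta n))%:num * cmod (f (lattice eta n + v)) <= a3 * hnorm M c3 f.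
  move=> hv; have v3 : vnorm v < r3 by apply: (polyv _ _ hv) => //; rewrite mulr_gt0.
  apply: (@le_trans _ _ (a3 * (M c3 (lattice eta n + v))%:num * cmod (f (lattice eta n + v)))).
    by rewrite ler_wpM2r ?cmod_ge0//; exact: H3.
  by rewrite -mulrA ler_wpM2l ?(ltW a30)// hnorm_ub.
(* Where M_c1 does not vanish at the lattice point, [f] is bounded on the polydisc around it.
   Otherwise [s0] is 0, and M_c vanishes near the lattice point. *)
have pos n (f : hspace M) : (M c1 (lattice eta n))%:num != 0 ->
    [/\ 0 < l0 n, 0 < (M c2 (lattice eta n))%:num & exists2 S : R,
       (M c2 (lattice eta n))%:num * S = a3 * hnorm M c3 f &
       forall v, polydisc (17 * tau) v -> cmod (f (lattice eta n + v)) <= S].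
  move=> m0; have mp : 0 < (M c1 (lattice eta n))%:num by rewrite lt_def m0 /=.
  have := lt_le_trans mp (Hl0 n).
  have [->|ln] := eqVneq (l0 n) 0; first by rewrite expr0n mul0r ltxx.
  rewrite pmulr_rgt0 ?exprn_even_gt0// => mup.
  split=> //; first by rewrite lt_def ln l00.
  exists (a3 * hnorm M c3 f / (M c2 (lattice eta n))%:num).
    by rewrite mulrC divfK// gt_eqF.
  by move=> v /bound Hv; rewrite ler_pdivlMr// mulrC; exact: Hv.
exists c3, J, w, l, (A * (W * 2 ^+ k)); split=> //.
(* The indices of nonzero weight lie in a product of lattice points and multi-indices with entries
   below [N], where the sum factorises. *)
- move=> s us; pose N := (\max_(j <- s) sumn j.2).+1.
  pose t : seq J := [seq (n, a) | n <- undup (map fst s), a <- orders N k].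
  apply: (@le_trans _ _ (\sum_(j <- [seq j <- s | size j.2 == k]) w j)).
    rewrite big_filter [leLHS](bigID (fun j : J => size j.2 == k))/=.
    by rewrite gerDl big1// => j; rewrite /w => /negPf ->.
  apply: (@le_trans _ _ (\sum_(j <- t) w j)).
    apply: sum_subseq_le => //; first exact: filter_uniq.
    move=> [n a]; rewrite mem_filter /= => /andP[sa ns].
    apply/allpairsP; exists (n, a); split=> //=.
      by rewrite mem_undup; apply/mapP; exists (n, a).
    rewrite mem_orders sa /=; apply/allP => j ja; rewrite /= ltnS.
    apply: (@leq_trans (sumn a)); first exact: mem_le_sumn.
    rewrite -[X in (X <= _)%N]/((fun j : J => sumn j.2) (n, a)).
    exact: leq_bigmax_seq.
  rewrite big_allpairs_dep /=.
  apply: (@le_trans _ _ (\sum_(n <- undup (map fst s)) A * (l0 n * 2 ^+ k))).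
    apply: ler_sum => n _; rewrite big_seq.
    apply: (@le_trans _ _ (\sum_(a <- orders N k | a \in orders N k) A * l0 n * (1 / 2) ^+ sumn a)).
      apply: ler_sum => a; rewrite mem_orders /w /= => /andP[-> _].
      by rewrite mulrA.
    rewrite -mulr_sumr -mulrA -big_seq ler_wpM2l ?(ltW A0)// ler_wpM2l//.
    by apply: sum_orders; apply/andP; split=> //; clear; lra.
  rewrite -mulr_sumr -mulr_suml ler_wpM2l ?(ltW A0)// ler_wpM2r ?exprn_ge0//.
  by apply: l0W; exact: undup_uniq.
- move=> j f; rewrite -lE cmodM cmodR ger0_norm// /s0 /w; case: ifP => [sk|_]; last first.
    by rewrite mul0r mul0r.
  have /eqP := sk; move=> {}sk.
  have [m0|m0] := eqVneq (M c1 (lattice eta j.1))%:num 0.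
    by rewrite m0 !mul0r !mulr_ge0 ?exprn_ge0 ?hnorm_ge0 ?(ltW A0).
  have [lp mup [S SE SB]] := pos j.1 f m0.
  have TB : cmod (Th j f) <= S.
    apply: (@coefs_le R k tau tau0 _ (fun v => f (lattice eta j.1 + v))) => //.
    by move=> i; rewrite mxE cmod0 mulr_ge0// ltW.
  apply: (@le_trans _ _ (l0 j.1 * (M c2 (lattice eta j.1))%:num * (1 / 2) ^+ sumn j.2 * S)).
    apply: ler_pM; rewrite ?cmod_ge0 ?mulr_ge0 ?invr_ge0 ?exprn_ge0//.
    rewrite ler_wpM2r ?exprn_ge0// ler_pdivrMr//; apply: (le_trans (Hl0 _)).
    by rewrite expr2 mulrAC.
  move: ((1 / 2) ^+ sumn j.2) (exprn_ge0 (sumn j.2) (ltW (@divr_gt0 R 1 2 ltr01 (ltr0Sn _ _)))).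
  move=> q q0; set mu := (M c2 _)%:num in SE *.
  have -> : l0 j.1 * mu * q * S = (l0 j.1 * q) * (mu * S) by ring.
  have -> : A * (l0 j.1 * q) * hnorm M c3 f = (l0 j.1 * q) * (A * hnorm M c3 f) by ring.
  by rewrite SE ler_wpM2l ?mulr_ge0// ler_wpM2r ?hnorm_ge0.
- move=> f z e e0; have [n zn] := lattice_near eta0 z.
  have [m0|m0] := eqVneq (M c1 (lattice eta n))%:num 0.
    exists [::] => //; rewrite big_nil add0r; apply: le_trans (ltW e0).
    rewrite mulr_le0_ge0 ?cmod_ge0//; have := H1 z (lattice eta n - z).
    rewrite [z + _]addrC subrK m0 mulr0; apply.
    by rewrite -vnormN opprB (lt_trans zn).
  have [lp mup [S SE SB]] := pos n f m0.
  have mp : 0 < (M c1 (lattice eta n))%:num by rewrite lt_def m0 /=.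
  have S0 : 0 <= S.
    apply: le_trans (SB 0 _); rewrite ?cmod_ge0// => i.
    by rewrite mxE cmod0 mulr_ge0// ltW.
  pose Q := a1 * (M c1 (lattice eta n))%:num * (3 ^+ k * S).
  have Q0 : 0 <= Q by rewrite !mulr_ge0 ?exprn_ge0 ?(ltW a10).
  have [N QN] : exists N, Q * (1 / 4) ^+ N <= e.
    exists (Num.bound (Q / e)); rewrite mul1r exprVn ler_pdivrMr ?exprn_gt0//.
    rewrite mulrC -ler_pdivrMr//; apply: (le_trans (ltW (archi_boundP _))).
      by rewrite divr_ge0// ltW.
    by rewrite -natrX ler_nat ltnW// ltn_expl.
  exists [seq (n, a) | a <- orders N k].
    by rewrite map_inj_uniq ?uniq_orders// => a b [].
  have vt : polydisc tau (z - lattice eta n).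
    by move=> i; apply: (le_trans (vnorm_coord _ _)); exact: ltW.
  have := @coefs_bound R k tau tau0 (enum 'I_k) (fun v => f (lattice eta n + v))
    (z - lattice eta n) S N (sepf n f) SB vt.
  rewrite [lattice eta n + (_ - _)]addrC subrK zeros_enum size_enum_ord => H.
  apply: (@le_trans _ _ (a1 * (M c1 (lattice eta n))%:num * cmod (f z))).
    rewrite ler_wpM2r ?cmod_ge0//; have := H1 z (lattice eta n - z).
    rewrite [z + _]addrC subrK; apply.
    by rewrite -vnormN opprB (lt_trans zn).
  apply: (le_trans (ler_wpM2l _ H)); first by rewrite mulr_ge0// ltW.
  rewrite mulrDr; apply: lerD; last first.
    apply: le_trans QN; rewrite le_eqVlt; apply/orP; left; apply/eqP; rewrite /Q; ring.
  rewrite big_map mulr_sumr big_seq [leRHS]big_seq; apply: ler_sum => a.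
  rewrite mem_orders => /andP[sa _].
  rewrite -lE cmodM cmodR ger0_norm// /s0 /w /= sa /Th /=.
  move: (cmod (coefs _ _ _ _)) (cmod_ge0 (coefs tau (zip (enum 'I_k) a)
    (fun v => f (lattice eta n + v)) 0)) => T T0.
  set h := (1 / 2) ^+ sumn a; set m := (M c1 _)%:num.
  have -> : A * (l0 n * h) * (m / l0 n * h * T) = A * m * (h * h) * T.
    by field; rewrite gt_eqF.
  rewrite /h -exprMn (_ : 1 / 2 * (1 / 2) = 1 / 4 :> R); last by field.
  by rewrite mulrA ler_wpM2r// ler_wpM2r ?exprn_ge0// ler_wpM2r// /m.
Qed.

End Nuclear.

(** * Finite-rank maps with bounds independent of the dimension *)

Section GramSchmidt.
Local Open Scope sesquilinear_scope.
Context {K : numClosedFieldType}.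

(** Q = U^t* U is an orthogonal projection, so its diagonal entry t satisfies t^2 <= sum_l |Q_ml|^2
    = t. *)
Lemma unitary_col_le1 (d N : nat) (U : 'M[K]_(d, N)) (m : 'I_N) :
  U *m U^t* = 1%:M -> \sum_(n < d) `|U n m| ^+ 2 <= 1.
Proof.
move=> UU; set t := \sum_(n < d) _.
pose Q := U^t* *m U.
have QQ : Q *m Q = Q by rewrite /Q mulmxA -[U^t* *m U *m U^t*]mulmxA UU mulmx1.
have Qh i j : Q i j = (Q j i)^*.
  rewrite !mxE rmorph_sum; apply: eq_bigr => n _.
  by rewrite !mxE rmorphM /= conjCK mulrC.
have Qmm : Q m m = t.
  rewrite mxE; apply: eq_bigr => n _.
  by rewrite !mxE mulrC normCK.
have t0 : 0 <= t by apply: sumr_ge0 => n _; rewrite exprn_ge0.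
have t2 : t ^+ 2 <= t.
  rewrite -[leRHS]Qmm -QQ mxE (bigD1 m)//= Qmm expr2 lerDl.
  by apply: sumr_ge0 => l _; rewrite [Q l m]Qh -normCK exprn_ge0.
rewrite real_leNgt ?ger0_real//; apply/negP => t1; move: t2.
rewrite real_leNgt ?ger0_real ?exprn_ge0//; apply/negP/negPn.
by rewrite expr2 ltr_pMr// (lt_trans ltr01).
Qed.

(** [X] serves twice: it expresses the orthonormal rows through those of [A], and it recovers
    coefficients with respect to the rows of [A]. *)
Lemma gram_schmidt (d N : nat) (A : 'M[K]_(d, N)) : row_free A ->
  exists (U : 'M[K]_(d, N)) (X : 'M[K]_d), [/\ U = X *m A, A *m U^t* *m X = 1%:M
    & forall m, \sum_(n < d) `|U n m| ^+ 2 <= 1].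
Proof.
move=> fA; have dN : (d <= N)%N by move: fA; rewrite /row_free => /eqP <-; exact: rank_leq_col.
have /unitarymxP UU := schmidt_unitarymx A dN.
have AU := eqmx_schmidt_free fA.
have /submxP[X XE] : (schmidt A <= A)%MS by rewrite AU.
have /submxP[Y YE] : (A <= schmidt A)%MS by rewrite AU.
exists (schmidt A), X; split=> // [|m]; last exact: unitary_col_le1.
have YX : Y *m X = 1%:M.
  by apply: (row_free_inj fA); rewrite mul1mx -mulmxA -XE -YE.
by rewrite {1}YE -[Y *m _ *m _]mulmxA UU mulmx1.
Qed.

End GramSchmidt.

Section CauchySchwarz.
Context {R : realType}.

Lemma cauchy_schwarz_weighted (I : Type) (s : seq I) (w x : I -> R) : (forall i, 0 <= w i) ->
  (\sum_(i <- s) w i * x i) ^+ 2 <= (\sum_(i <- s) w i) * (\sum_(i <- s) w i * x i ^+ 2).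
Proof.
move=> w0; set B := \sum_(i <- s) w i * x i; set T := \sum_(i <- s) w i.
set S := \sum_(i <- s) _.
have T0 : 0 <= T by apply: sumr_ge0.
have key t : 0 <= S - 2 * t * B + t ^+ 2 * T.
  have -> : S - 2 * t * B + t ^+ 2 * T = \sum_(i <- s) w i * (x i - t) ^+ 2.
    rewrite /S /B /T !mulr_sumr -sumrB -big_split /=; apply: eq_bigr => i _; ring.
  by apply: sumr_ge0 => i _; rewrite mulr_ge0// sqr_ge0.
have [TE|T1] := eqVneq T 0.
  have -> : B = 0.
    (* For T = 0 an affine function of t remains; at this t it equals -1. *)
    have h1 := key ((S + 1) / 2 / B); have [//|B0] := eqVneq B 0.
    exfalso; move: h1; rewrite TE mulr0 addr0.
    have -> : S - 2 * ((S + 1) / 2 / B) * B = - 1 by field.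
    by rewrite ler0N1.
  by rewrite TE expr0n mul0r.
have Tp : 0 < T by rewrite lt_def T1.
have := key (B / T).
have -> : S - 2 * (B / T) * B + (B / T) ^+ 2 * T = (T * S - B ^+ 2) / T by field.
by rewrite pmulr_lge0 ?invr_gt0// subr_ge0.
Qed.

End CauchySchwarz.

Section FiniteRank.
Local Open Scope sesquilinear_scope.
Context {R : realType} {E : lmodType R[i]} {J : choiceType}.
Local Notation C := R[i].
Context (p0 p1 : E -> R) (w : J -> R) (psi : J -> E -> C) (W : R).

Record seminorm (p : E -> R) : Prop := Seminorm {
  seminorm_ge0 : forall f, 0 <= p f ;
  seminormD : forall f g, p (f + g) <= p f + p g ;
  seminormZ : forall a f, p (a *: f) <= cmod a * p f }.

Hypothesis (P0 : seminorm p0) (P1 : seminorm p1).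
Hypothesis (w_ge0 : forall j, 0 <= w j) (psi_lin : forall j, linear (psi j)).
Hypothesis (w_sum : forall s, uniq s -> \sum_(j <- s) w j <= W).
Hypothesis (psi_le : forall j f, cmod (psi j f) <= w j * p1 f).
Hypothesis tail : forall de, 0 < de -> exists2 s, uniq s & forall t f, uniq t ->
  {subset s <= t} -> p0 f <= \sum_(j <- t) w j * cmod (psi j f) + de * p1 f.

Lemma psiD j f g : psi j (f + g) = psi j f + psi j g.
Proof. by have := psi_lin j 1 f g; rewrite !scale1r. Qed.

Lemma psi0 j : psi j 0 = 0.
Proof. by apply: (addrI (psi j 0)); rewrite -psiD !addr0. Qed.

Lemma psiZ j a f : psi j (a *: f) = a * psi j f.
Proof. by have := psi_lin j a f 0; rewrite !addr0 psi0 addr0. Qed.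

Lemma psi_sum j I (r : seq I) (F : I -> E) : psi j (\sum_(i <- r) F i) = \sum_(i <- r) psi j (F i).
Proof.
elim: r => [|i r IH]; first by rewrite !big_nil psi0.
by rewrite !big_cons psiD IH.
Qed.

Lemma psiB j f g : psi j (f - g) = psi j f - psi j g.
Proof. by rewrite psiD -scaleN1r psiZ mulN1r. Qed.

Lemma seminorm0 p : seminorm p -> p 0 = 0.
Proof.
move=> sp; apply/eqP; rewrite eq_le seminorm_ge0// andbT.
by have := seminormZ sp 0 0; rewrite scale0r cmod0 mul0r.
Qed.

Lemma seminorm_sum p I (r : seq I) (F : I -> E) : seminorm p ->
  p (\sum_(i <- r) F i) <= \sum_(i <- r) p (F i).
Proof.
move=> sp; elim: r => [|i r IH]; first by rewrite !big_nil seminorm0.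
by rewrite !big_cons; apply: (le_trans (seminormD sp _ _)); rewrite lerD2l.
Qed.

(** Gaussian elimination in which vectors are told apart only by the [psi]: a residual seen by some
    psi_i is normalised into a new vector, and the old ones are corrected to vanish under psi_i. *)
Lemma biorthogonal (fs : seq E) : exists (d : nat) (e : 'I_d -> E) (k : 'I_d -> J),
  (forall a b, psi (k a) (e b) = (a == b)%:R) /\
  forall f, f \in fs -> forall i, psi i (f - \sum_(a < d) psi (k a) f *: e a) = 0.
Proof.
elim: fs => [|f fs [d [e [k [ke fe]]]]].
  have /choice[k _] : forall a : 'I_0, exists j : J, True by case.
  by exists 0%N, (fun=> 0), k; split=> [[]|].
pose g := f - \sum_(a < d) psi (k a) f *: e a.
have kg b : psi (k b) g = 0.
  rewrite /g psiB psi_sum (bigD1 b)//= psiZ ke eqxx mulr1 big1 ?addr0 ?subrr// => a ab.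
  by rewrite psiZ ke eq_sym (negPf ab) mulr0.
have [g0|] := pselect (forall i, psi i g = 0).
  by exists d, e, k; split=> // h; rewrite inE => /orP[/eqP->|/fe].
move=> /existsNP[i /eqP ig].
pose u := (psi i g)^-1 *: g.
have iu : psi i u = 1 by rewrite psiZ mulVf.
have ku b : psi (k b) u = 0 by rewrite psiZ kg mulr0.
pose e' (a : 'I_d.+1) := if unlift ord0 a is Some b then e b - psi i (e b) *: u else u.
pose k' (a : 'I_d.+1) := if unlift ord0 a is Some b then k b else i.
exists d.+1, e', k'; split.
  move=> a b; rewrite /e' /k'.
  have [a' ->|->] := unliftP ord0 a; have [b' ->|->] := unliftP ord0 b;
    rewrite ?liftK ?unlift_none ?(inj_eq (@lift_inj _ _)).
  - by rewrite psiB psiZ ke ku mulr0 subr0.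
  - by rewrite ku eq_sym (negPf (neq_lift ord0 a')).
  - by rewrite psiB psiZ iu mulr1 subrr (negPf (neq_lift ord0 b')).
  - by rewrite iu eqxx.
have EE h : h - \sum_(a < d.+1) psi (k' a) h *: e' a =
    (h - \sum_(a < d) psi (k a) h *: e a) - psi i (h - \sum_(a < d) psi (k a) h *: e a) *: u.
  rewrite big_ord_recl /e' /k' unlift_none.
  under eq_bigr do rewrite liftK scalerBr scalerA.
  rewrite sumrB -scaler_suml psiB psi_sum scalerBl.
  move: (psi i h *: u) (\sum_(a < d) _ *: e _) (_ *: u) => x y z.
  rewrite opprD opprB addrA addrACA opprB [RHS]addrACA; congr (_ + _); last exact: addrC.
  by congr (_ + _ *: _); apply: eq_bigr => a _; rewrite psiZ.
move=> h hs j; rewrite EE psiB psiZ; move: hs; rewrite inE => /orP[/eqP->|hs].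
  rewrite -/g /u psiZ mulrA mulfV// mul1r subrr//.
by rewrite !fe// mul0r subr0.
Qed.

(** Put a_n = sum_m w_m |U n m| with orthonormal rows U. Then |phi_n f| <= a_n p1 f, and p0 (u_n) is
    at most a_n up to a tail. Cauchy-Schwarz and the column bound give sum_n a_n^2 <= W^2 whatever
    [d] is; the extra 1 pays for the tails. *)
Lemma finite_rank (fs : seq E) : exists (d : nat) (u : 'I_d -> E) (a : 'I_d -> R)
    (l : 'I_d -> seq (C * J)), let phi n f := \sum_(q <- l n) q.1 * psi q.2 f in
  [/\ forall n, 0 <= a n, forall n f, cmod (phi n f) <= a n * p1 f,
    \sum_(n < d) a n * p0 (u n) <= W ^+ 2 + 1
  & forall f, f \in fs -> p0 (f - \sum_(n < d) phi n f *: u n) = 0].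
Proof.
have [d [e [k [ke fe]]]] := biorthogonal fs.
have W0 : 0 <= W by have := @w_sum [::] isT; rewrite big_nil.
pose K := \sum_(a < d) p1 (e a).
have K0 : 0 <= K by apply: sumr_ge0 => a _; exact: seminorm_ge0.
(* As psi_k (u_n) has modulus at most 1, [K] will bound p1 (u_n). Each tail is then de * K, and the
   [d] tails, weighted by a_n <= W, add up to at most 1. *)
pose de := (K * (d%:R * W) + 1)^-1.
have de0 : 0 < de by rewrite invr_gt0 ltr_wpDl// !mulr_ge0.
have [s0 us0 Hs0] := tail de0.
(* Having the dual indices among the coordinates makes the rows of [A] independent. *)
pose s := undup (s0 ++ codom k).
have us : uniq s by exact: undup_uniq.
have ks a : k a \in s by rewrite mem_undup mem_cat codom_f orbT.
have Hs f : p0 f <= \sum_(j <- s) w j * cmod (psi j f) + de * p1 f.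
  by apply: Hs0 => // j js; rewrite mem_undup mem_cat js.
pose N := size s; pose S (m : 'I_N) : J := tnth (in_tuple s) m.
have sumS (F : J -> R) : \sum_(j <- s) F j = \sum_(m < N) F (S m).
  by rewrite big_tnth.
have kS a : exists m, S m = k a.
  by have /tnthP[m ->] : k a \in in_tuple s by []; exists m.
pose v f : 'rV[C]_N := \row_m psi (S m) f.
pose A : 'M[C]_(d, N) := \matrix_(a, m) psi (S m) (e a).
have vA (c : 'rV[C]_d) : v (\sum_(a < d) c 0 a *: e a) = c *m A.
  by apply/rowP => m; rewrite !mxE psi_sum; apply: eq_bigr => a _; rewrite psiZ mxE.
have fA : row_free A.
  apply/row_freeP; have /choice[mk mkE] := kS.
  exists (\matrix_(m, b) (m == mk b)%:R); apply/matrixP => a b; rewrite !mxE.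
  rewrite (bigD1 (mk b))//= !mxE eqxx mulr1 mkE ke big1 ?addr0 1?eq_sym// => m mb.
  by rewrite !mxE (negPf mb) mulr0.
have [U [X [UE AX UU]]] := gram_schmidt fA.
pose u n := \sum_(a < d) X n a *: e a.
have vu n : v (u n) = row n U.
  have -> : u n = \sum_(a < d) (row n X) 0 a *: e a.
    by apply: eq_bigr => a _; rewrite mxE.
  by rewrite vA -row_mul -UE.
have psiu n m : psi (S m) (u n) = U n m.
  by have := congr1 (fun r : 'rV[C]_N => r 0 m) (vu n); rewrite !mxE.
have UU' m : \sum_(n < d) cmod (U n m) ^+ 2 <= 1.
  have := UU m; rewrite -lecR rmorph_sum /=.
  by under eq_bigr do rewrite cmodE -rmorphXn.
have U1 n m : cmod (U n m) <= 1.
  rewrite -(@expr_le1 _ 2)// ?cmod_ge0//; apply: le_trans (UU' m).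
  by rewrite (bigD1 n)//= lerDl sumr_ge0// => n' _; rewrite exprn_ge0// cmod_ge0.
pose a n := \sum_(m < N) w (S m) * cmod (U n m).
have a0 n : 0 <= a n by apply: sumr_ge0 => m _; rewrite mulr_ge0 ?cmod_ge0.
have sW : \sum_(m < N) w (S m) <= W by rewrite -sumS; exact: w_sum.
have aW n : a n <= W.
  by apply: le_trans sW; apply: ler_sum => m _; rewrite ler_piMr.
pose l n : seq (C * J) := [seq ((U n m)^*, S m) | m <- enum 'I_N].
have phiE n f : \sum_(q <- l n) q.1 * psi q.2 f = \sum_(m < N) (U n m)^* * psi (S m) f.
  by rewrite big_map big_enum.
exists d, u, a, l; split=> //.
- move=> n f; rewrite phiE; apply: (le_trans (cmod_sum _ _ _)).
  rewrite mulr_suml; apply: ler_sum => m _; rewrite cmodM.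
  have -> : cmod (U n m)^* = cmod (U n m) by rewrite /cmod norm_conjC.
  by rewrite mulrC mulrAC ler_wpM2r ?cmod_ge0.
- have p1u n : p1 (u n) <= K.
    have -> : u n = \sum_(b < d) psi (k b) (u n) *: e b.
      apply: eq_bigr => b _; congr (_ *: _).
      rewrite psi_sum (bigD1 b)//= psiZ ke eqxx mulr1 big1 ?addr0// => c cb.
      by rewrite psiZ ke eq_sym (negPf cb) mulr0.
    apply: (le_trans (seminorm_sum _ _ P1)); apply: ler_sum => b _.
    apply: (le_trans (seminormZ P1 _ _)); rewrite ler_piMl ?seminorm_ge0//.
    by have [m <-] := kS b; rewrite psiu.
  have p0u n : p0 (u n) <= a n + de * K.
    apply: (le_trans (Hs _)); apply: lerD; last by rewrite ler_wpM2l// ltW.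
    by rewrite sumS; apply: ler_sum => m _; rewrite psiu.
  apply: (@le_trans _ _ (\sum_(n < d) (a n ^+ 2 + W * (de * K)))).
    apply: ler_sum => n _; apply: (@le_trans _ _ (a n * (a n + de * K))).
      by rewrite ler_wpM2l.
    by rewrite mulrDr -expr2 lerD2l ler_wpM2r// mulr_ge0// ltW.
  rewrite big_split /= sumr_const card_ord; apply: lerD.
    apply: (@le_trans _ _ (\sum_(n < d) (W * \sum_(m < N) w (S m) * cmod (U n m) ^+ 2))).
      apply: ler_sum => n _; apply: (le_trans (cauchy_schwarz_weighted _ _ _)) => //.
      by rewrite ler_wpM2r// sumr_ge0// => m _; rewrite mulr_ge0// exprn_ge0// cmod_ge0.
    rewrite -mulr_sumr expr2 ler_wpM2l// exchange_big /=.
    by apply: le_trans sW; apply: ler_sum => m _; rewrite -mulr_sumr ler_piMr.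
  rewrite -[leLHS]mulr_natr.
  have -> : W * (de * K) * d%:R = de * (K * (d%:R * W)) by ring.
  have Z0 : 0 < K * (d%:R * W) + 1 by rewrite ltr_wpDl// !mulr_ge0.
  have E1 : de * (K * (d%:R * W) + 1) = 1 by rewrite /de mulVf// gt_eqF.
  rewrite -[leRHS]E1.
  by apply: ler_wpM2l; [exact: ltW|rewrite lerDl].
- move=> f ffs.
  (* In the coordinates [c] the left side is c A U^t* X, and A U^t* X = 1. *)
  have -> : \sum_(n < d) (\sum_(q <- l n) q.1 * psi q.2 f) *: u n =
     \sum_(b < d) psi (k b) f *: e b.
    pose c : 'rV[C]_d := \row_b psi (k b) f.
    have vf : v f = c *m A.
      rewrite -vA; apply/rowP => m; rewrite !mxE; apply/eqP; rewrite -subr_eq0 -psiB.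
      apply/eqP; have := fe f ffs (S m); congr (psi _ (_ - _) = _).
      by apply: eq_bigr => b _; rewrite mxE.
    have phiv n : \sum_(q <- l n) q.1 * psi q.2 f = (c *m A *m U^t*) 0 n.
      by rewrite phiE -vf mxE; apply: eq_bigr => m _; rewrite !mxE mulrC.
    under eq_bigr do rewrite phiv.
    rewrite /u; under eq_bigr do rewrite scaler_sumr.
    rewrite exchange_big; apply: eq_bigr => b _ /=.
    under eq_bigr do rewrite scalerA.
    rewrite -scaler_suml; congr (_ *: _).
    have := congr1 (fun r : 'rV[C]_d => r 0 b) (congr1 (mulmx c) AX).
    rewrite /= mulmx1 !mulmxA mxE => ->.
    by rewrite mxE.
  (* All the psi_j vanish on the residual, so only the tail remains, with an arbitrarily small
     factor. *)
  apply/eqP; rewrite eq_le seminorm_ge0// andbT; apply/ler_addgt0Pr => eps eps0.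
  rewrite add0r; set g := f - _.
  have p1g : 0 < p1 g + 1 by rewrite ltr_wpDl ?seminorm_ge0.
  have [t ut Ht] := tail (divr_gt0 eps0 p1g).
  apply: (le_trans (Ht t g ut (fun _ h => h))).
  rewrite big1 ?add0r => [|j _]; last by rewrite fe// cmod0 mulr0.
  by rewrite mulrAC ler_pdivrMr// ler_wpM2l ?(ltW eps0)// lerDl.
Qed.

End FiniteRank.

Section Affine.
Context {R : realType}.
Local Notation C := R[i].

(** For restricting a function on the product to either variable. *)
Lemma entire_affine k k' (f : 'rV[C]_k -> C) (b : 'rV[C]_k) (A : 'M[C]_(k', k)) :
  entire f -> entire (fun v => f (b + v *m A)).
Proof.
move=> ef z; have := ef (b + z *m A) => /diff_small H.
pose K := \sum_(j < k') vnorm (delta_mx 0 j *m A) + 1.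
have K0 : 0 < K by rewrite ltr_wpDl// sumr_ge0// => j _; exact: vnorm_ge0.
have vA (v : 'rV[C]_k') : vnorm (v *m A) <= K * vnorm v.
  rewrite {1}[v]row_sum_delta mulmx_suml.
  have vs (F : 'I_k' -> 'rV[C]_k) : vnorm (\sum_(j < k') F j) <= \sum_(j < k') vnorm (F j).
    elim/big_rec2: _ => [|j x y _ h]; first by rewrite vnorm0.
    by apply: (le_trans (vnormD _ _)); rewrite lerD2l.
  apply: (le_trans (vs _)).
  apply: (@le_trans _ _ (\sum_(j < k') vnorm (delta_mx 0 j *m A) * vnorm v)).
    apply: ler_sum => j _; rewrite -scalemxAl vnormZ mulrC ler_wpM2l ?vnorm_ge0//.
    exact: vnorm_coord.
  by rewrite -mulr_suml ler_wpM2r ?vnorm_ge0// lerDl.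
pose D := 'd f (b + z *m A).
apply: (@small_diff _ _ _ _ (\col_j D (delta_mx 0 j *m A))) => e e0.
have [r r0 Hr] := H _ (divr_gt0 e0 K0).
exists (r / K); first exact: divr_gt0.
move=> w; rewrite ltr_pdivlMr// mulrC => wr.
have {Hr} := Hr (w *m A) (le_lt_trans (vA w) wr).
have -> : (w *m (\col_j D (delta_mx 0 j *m A))) 0 0 = D (w *m A).
  rewrite mxE {2}[w]row_sum_delta mulmx_suml linear_sum; apply: eq_bigr => j _.
  by rewrite mxE -scalemxAl linearZ.
rewrite mulmxDl addrA => /le_trans; apply.
by rewrite -mulrA ler_wpM2l ?(ltW e0)// ler_pdivrMl.
Qed.

End Affine.

(** * Finite-rank maps on H(M) *)

Section FiniteRankHspace.
Context {R : realType} {Gam : Type} {k : nat} (M : Gam -> 'rV[R[i]]_k -> {nonneg R}).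
Local Notation C := R[i].

Lemma hnorm_seminorm c : seminorm (fun f : hspace M => hnorm M c f).
Proof. split=> [f|f g|a f]; [exact: hnorm_ge0|exact: Defs.hnormD|exact: hnormZ_le]. Qed.

Lemma hnormN c (f : hspace M) : hnorm M c (- f) <= hnorm M c f.
Proof.
by rewrite -scaleN1r; apply: (le_trans (hnormZ_le _ _ _)); rewrite cmodN cmod1 mul1r.
Qed.

Lemma hspaceDZE (a : C) (f g : hspace M) x : (a *: f + g) x = a * f x + g x.
Proof. by []. Qed.

Lemma comb_linear (l : seq (C * 'rV[C]_k)) : linear (fun f : hspace M => comb l f : C).
Proof.
move=> a f g; rewrite /comb.
have -> : a *: (\sum_(q <- l) q.1 * f q.2) = a * (\sum_(q <- l) q.1 * f q.2) by [].
rewrite mulr_sumr -big_split; apply: eq_bigr => q _.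
by rewrite hspaceDZE mulrDr mulrCA.
Qed.

(** A finite sum within [de] of the supremum of all finite sums leaves no room for more. *)
Lemma uniq_sum_tail (J : choiceType) (w : J -> R) (W : R) : (forall j, 0 <= w j) ->
  (forall s, uniq s -> \sum_(j <- s) w j <= W) ->
  forall de, 0 < de -> exists2 s, uniq s & forall t, uniq t ->
    \sum_(j <- [seq j <- t | j \notin s]) w j <= de.
Proof.
move=> w0 wW de de0; pose S := [set \sum_(j <- s) w j | s in [set s : seq J | uniq s]].
have S0 : has_sup S.
  split; first by exists 0, [::] => //; rewrite big_nil.
  by exists W => _ [s us <-]; exact: wW.
have [_ [s us <-] hs] := sup_adherent de0 S0.
exists s => // t ut; have : \sum_(j <- s ++ [seq j <- t | j \notin s]) w j <= sup S.
  apply: ub_le_sup; first by case: S0.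
  exists (s ++ [seq j <- t | j \notin s]) => //=; rewrite cat_uniq us filter_uniq// andbT /=.
  by apply/hasPn => j; rewrite mem_filter => /andP[].
by rewrite big_cat /= => h; move: hs h; lra.
Qed.

Hypothesis cI : condition_I M.
Hypothesis cII : condition_II M.

(** The finite families of [nuclear] depend on [f] and on the point. As psi_j is bounded by w_j
    times a seminorm, they can be cut down to a single finite family at the price of a tail
    proportional to this seminorm. *)
Lemma nuclear_tail c : exists c' (J : choiceType) (w : J -> R) (l : J -> seq (C * 'rV[C]_k)) (W : R),
  [/\ forall j, 0 <= w j, forall s, uniq s -> \sum_(j <- s) w j <= W,
    forall j (f : hspace M), cmod (comb (l j) f) <= w j * hnorm M c' f
  & forall de, 0 < de -> exists2 s, uniq s & forall t (f : hspace M), uniq t ->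
     {subset s <= t} -> hnorm M c f <= \sum_(j <- t) w j * cmod (comb (l j) f) + de * hnorm M c' f].
Proof.
have [c' [J [w [l [W [w0 wW lw H]]]]]] := nuclear cI cII c.
exists c', J, w, l, W; split=> // de de0.
have W0 : 0 <= W by have := wW [::] isT; rewrite big_nil.
have W1 : 0 < W + 1 by rewrite ltr_wpDl.
have [s us Hs] := uniq_sum_tail w0 wW (divr_gt0 de0 W1).
exists s => // t f ut st; apply: hnorm_le => z; apply/ler_addgt0Pr => e e0.
have [v uv Hv] := H f z e e0; apply: (le_trans Hv); rewrite lerD2r.
rewrite (bigID (fun j => j \in s)) /=; apply: lerD.
  rewrite -big_filter; apply: sum_subseq_le; rewrite ?filter_uniq//.
    by move=> j; rewrite mulr_ge0 ?cmod_ge0.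
  by move=> j; rewrite mem_filter => /andP[/st].
have wj j : w j <= W by have := wW [:: j] isT; rewrite big_seq1.
apply: (@le_trans _ _ (\sum_(j <- [seq j <- v | j \notin s]) w j * (W * hnorm M c' f))).
  rewrite big_filter; apply: ler_sum => j _; rewrite ler_wpM2l//.
  by apply: (le_trans (lw j f)); rewrite ler_wpM2r ?hnorm_ge0.
rewrite -mulr_suml mulrA ler_wpM2r ?hnorm_ge0//.
apply: (@le_trans _ _ (de / (W + 1) * W)); first by rewrite ler_wpM2r// Hs.
by rewrite mulrAC ler_pdivrMr// ler_wpM2l ?(ltW de0)// lerDl.
Qed.

Lemma finite_rank_hspace c : exists c' (B : R), 0 <= B /\ forall fs : seq (hspace M),
  exists (d : nat) (u : 'I_d -> hspace M) (a : 'I_d -> R) (l : 'I_d -> seq (C * 'rV[C]_k)),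
  [/\ forall n, 0 <= a n, forall n (f : hspace M), cmod (comb (l n) f) <= a n * hnorm M c' f,
    \sum_(n < d) a n * hnorm M c (u n) <= B
  & forall f, f \in fs -> hnorm M c (f - \sum_(n < d) comb (l n) f *: u n) = 0].
Proof.
have [c' [J [w [l [W [w0 wW lw H]]]]]] := nuclear_tail c.
exists c', (W ^+ 2 + 1); split; first by rewrite addr_ge0 ?sqr_ge0.
move=> fs; have [d [u [a [m [a0 la Ba Hf]]]]] := finite_rank (hnorm_seminorm c)
  (hnorm_seminorm c') w0 (fun j => comb_linear (l j)) wW lw H fs.
exists d, u, a, (fun n => flatten [seq [seq (q.1 * r.1, r.2) | r <- l q.2] | q <- m n]).
have E n (f : hspace M) : comb (flatten [seq [seq (q.1 * r.1, r.2) | r <- l q.2] | q <- m n]) f =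
    \sum_(q <- m n) q.1 * comb (l q.2) f.
  rewrite /comb big_flatten big_map; apply: eq_bigr => q _.
  by rewrite big_map mulr_sumr; apply: eq_bigr => r _; rewrite mulrA.
split=> // [n f|f /Hf <-]; first by rewrite E; exact: la.
by congr (hnorm M c (f - _)); apply: eq_bigr => n _; rewrite E.
Qed.

End FiniteRankHspace.

(** * Slices and contractions of functions on the product *)

Section Slices.
Context {R : realType} {Gam Om : Type} {k1 k2 : nat}.
Local Notation C := R[i].
Context (M : Gam -> 'rV[C]_k1 -> {nonneg R}) (N : Om -> 'rV[C]_k2 -> {nonneg R}).
Hypothesis nN : nondegenerate N.
Local Notation H := (hspace (family_tensor M N)).

(** Condition (c) for [N] provides an index [d] with N_d(y) > 0, by which the bounds of [h] can be
    divided. *)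
Lemma slice_subproof (h : H) (y : 'rV[C]_k2) : (fun x => h (row_mx x y)) \in hpred M.
Proof.
have [eh bh] := hspaceP h; apply/asboolP; split.
  have -> : (fun x => h (row_mx x y)) = (fun x => h (row_mx 0 y + x *m row_mx 1%:M 0)).
    by apply/funext => x; rewrite mul_mx_row mulmx1 mulmx0 add_row_mx add0r addr0.
  exact: entire_affine.
move=> c; have [d d0] := nondegenerate_gt0 nN y; have [B HB] := bh (c, d).
exists (B / (N d y)%:num) => _ [x _ <-]; rewrite ler_pdivlMr//.
apply: HB; exists (row_mx x y) => //=.
by rewrite row_mxKl row_mxKr mulrAC.
Qed.

Definition slice (h : H) (y : 'rV[C]_k2) : hspace M := HSpace (slice_subproof h y).

Lemma hnorm_slice (h : H) c d y : (N d y)%:num * hnorm M c (slice h y) <=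
  hnorm (family_tensor M N) (c, d) h.
Proof.
have [->|n0] := eqVneq (N d y)%:num 0; first by rewrite mul0r hnorm_ge0.
have np : 0 < (N d y)%:num by rewrite lt_def n0 /=.
rewrite mulrC -ler_pdivlMr//; apply: hnorm_le => x; rewrite ler_pdivlMr// mulrAC.
have := hnorm_ub (c, d) h (row_mx x y).
by rewrite /= row_mxKl row_mxKr.
Qed.

Lemma hnorm_tensor_le (h : H) c d (B : R) :
  (forall y, (N d y)%:num * hnorm M c (slice h y) <= B) ->
  hnorm (family_tensor M N) (c, d) h <= B.
Proof.
move=> HB; apply: hnorm_le => z; apply: le_trans (HB (rsubmx z)).
rewrite /= [_ * (N d _)%:num]mulrC -mulrA ler_wpM2l//.
have := hnorm_ub c (slice h (rsubmx z)) (lsubmx z).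
by rewrite /= hsubmxK.
Qed.

(** Entire in y because [comb l] evaluates at finitely many points; the growth in y is controlled by
    the seminorm bound on [comb l]. *)
Lemma contract_subproof (h : H) (l : seq (C * 'rV[C]_k1)) (a : R) (c : Gam) :
  0 <= a -> (forall f : hspace M, cmod (comb l f) <= a * hnorm M c f) ->
  (fun y => comb l (slice h y)) \in hpred N.
Proof.
move=> a0 la; have [eh bh] := hspaceP h; apply/asboolP; split.
  move=> z; rewrite /comb.
  have -> : (fun y => \sum_(q <- l) q.1 * slice h y q.2) =
     \sum_(q <- l) (fun y => q.1 *: (h (row_mx q.2 0 + y *m row_mx 0 1%:M) : C)).
    apply/funext => y; rewrite fct_sumE; apply: eq_bigr => q _ /=.
    by rewrite mul_mx_row mulmx1 mulmx0 add_row_mx add0r addr0.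
  elim/big_ind: _ => [|f g df dg|q _].
  - exact: differentiable_cst.
  - exact: differentiableD.
  - by apply: differentiableZ; exact: entire_affine.
move=> d; exists (a * hnorm (family_tensor M N) (c, d) h) => _ [y _ <-].
apply: (@le_trans _ _ (a * ((N d y)%:num * hnorm M c (slice h y)))).
  by rewrite mulrCA ler_wpM2l.
by rewrite ler_wpM2l// hnorm_slice.
Qed.

Lemma hnorm_contract (h : H) (l : seq (C * 'rV[C]_k1)) (a : R) (c : Gam) (d : Om) (g : hspace N) :
  0 <= a -> (forall f : hspace M, cmod (comb l f) <= a * hnorm M c f) ->
  (forall y, g y = comb l (slice h y)) ->
  hnorm N d g <= a * hnorm (family_tensor M N) (c, d) h.
Proof.
move=> a0 la gE; apply: hnorm_le => y; rewrite gE.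
apply: (@le_trans _ _ (a * ((N d y)%:num * hnorm M c (slice h y)))).
  by rewrite mulrCA ler_wpM2l.
by rewrite ler_wpM2l// hnorm_slice.
Qed.

End Slices.

(** * The projective tensor product inside H(M (x) N) *)

Section Gauge.
Context {R : realType} {T : tvsType R[i]}.
Local Notation C := R[i].
Implicit Types (U : set T) (x y : T) (s t : R).

Lemma locally_convex0 (V : set T) : nbhs (0 : T) V ->
  exists2 U, convex_set U & nbhs (0 : T) U /\ U `<=` V.
Proof.
have [B cB [oB bB]] := @locally_convex C T.
move=> /(bB 0)[U [BU U0] UV]; exists U; first by apply: cB; rewrite inE.
by split=> //; apply: open_nbhs_nbhs; split=> //; exact: oB.
Qed.

Lemma convex_setP U (k : R) x y : convex_set U -> 0 <= k -> k <= 1 -> U x -> U y ->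
  U (k%:C%C *: x + (1 - k)%:C%C *: y).
Proof.
move=> cU k0 k1 Ux Uy; have k0' : 0 <= k%:C%C by rewrite ler0c.
have k1' : k%:C%C <= 1 :> C by rewrite (lecR k 1).
have := cU x y (Itv01 k0' k1'); rewrite !inE => /(_ Ux Uy).
rewrite /conv/= /isConvexSpace.conv/= /unstable.onem.
by rewrite rmorphB.
Qed.

(* For a convex neighborhood [U] of 0: the gauge of [U] at [x] is at most [s]. *)
Definition within_scale U s x := U (s^-1%:C%C *: x).

Lemma within_scaleD U s t x y : convex_set U -> 0 < s -> 0 < t ->
  within_scale U s x -> within_scale U t y -> within_scale U (s + t) (x + y).
Proof.
move=> cU s0 t0 Ux Uy; have st0 : 0 < s + t by rewrite addr_gt0.
have k0 : 0 <= s / (s + t) by rewrite divr_ge0 ?ltW.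
have k1 : s / (s + t) <= 1 by rewrite ler_pdivrMr// mul1r lerDl ltW.
have := convex_setP cU k0 k1 Ux Uy.
rewrite /within_scale !scalerA -!rmorphM /= scalerDr.
congr (U (_ *: _ + _ *: _)); congr (_%:C%C); field; rewrite !gt_eqF//.
Qed.

(** The extra [s0] keeps the scale positive when the sum is empty. *)
Lemma within_scale_sum U I (r : seq I) (s : I -> R) (x : I -> T) (s0 : R) : convex_set U ->
  U 0 -> 0 < s0 -> (forall i, 0 < s i) -> (forall i, within_scale U (s i) (x i)) ->
  within_scale U (\sum_(i <- r) s i + s0) (\sum_(i <- r) x i).
Proof.
move=> cU U0 s00 sp Ux; elim: r => [|i r IH].
  by rewrite !big_nil add0r /within_scale scaler0.
rewrite !big_cons -addrA; apply: within_scaleD => //.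
by rewrite ltr_wpDl// sumr_ge0// => j _; exact: ltW.
Qed.

Lemma within_scale_le1 U s x : convex_set U -> U 0 -> 0 < s -> s <= 1 ->
  within_scale U s x -> U x.
Proof.
move=> cU U0 s0 s1 Ux; have := convex_setP cU (ltW s0) s1 Ux U0.
by rewrite scaler0 addr0 scalerA -rmorphM /= divff ?gt_eqF// scale1r.
Qed.

End Gauge.

(** * The projective topology against the seminorms of H(M (x) N) *)

Section Embedding.
Context {R : realType} {Gam Om : Type} {k1 k2 : nat}.
Local Notation C := R[i].
Context (M : Gam -> 'rV[C]_k1 -> {nonneg R}) (N : Om -> 'rV[C]_k2 -> {nonneg R}).
Hypothesis (dM : directed M) (dN : directed N) (c0 : Gam) (d0 : Om).
Hypothesis nN : nondegenerate N.
Hypothesis (cI : condition_I M) (cII : condition_II M).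
Local Notation F := (hspace M).
Local Notation G := (hspace N).
Local Notation H := (hspace (family_tensor M N)).
Local Notation MN := (family_tensor M N).

Lemma hprod_bilinear : @is_bilinear C F G H (@hprod R Gam Om k1 k2 M N).
Proof.
split=> [g a f1 f2|f a g1 g2]; apply: val_inj; apply/funext => z.
  rewrite -[LHS]/((a * f1 _ + f2 _) * g _).
  by rewrite -[RHS]/(a * (f1 (lsubmx z) * g (rsubmx z)) + f2 (lsubmx z) * g (rsubmx z)); ring.
rewrite -[LHS]/(f _ * (a * g1 _ + g2 _)).
by rewrite -[RHS]/(a * (f (lsubmx z) * g1 (rsubmx z)) + f (lsubmx z) * g2 (rsubmx z)); ring.
Qed.

Definition tmap : ptensor F G -> H := tensor_lift (@hprod R Gam Om k1 k2 M N).

Lemma tmap_linear : linear tmap.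
Proof. exact: tensor_lift_linear hprod_bilinear. Qed.

Lemma tmap_tens f g : tmap (ptens f g) = hprod f g.
Proof. exact: tensor_lift_tens hprod_bilinear _ _. Qed.

Lemma linear_fun_sum (U V : lmodType C) (u : U -> V) I (r : seq I) (x : I -> U) : linear u ->
  u (\sum_(i <- r) x i) = \sum_(i <- r) u (x i).
Proof.
move=> lu; have uD a b : u (a + b) = u a + u b by rewrite -{1}[a]scale1r lu scale1r.
have u0 : u 0 = 0 by apply: (addrI (u 0)); rewrite -uD !addr0.
by elim: r => [|i r IH]; rewrite ?big_nil// !big_cons uD IH.
Qed.

Lemma linear_fun_scale (U V : lmodType C) (u : U -> V) a x : linear u -> u (a *: x) = a *: u x.
Proof.
move=> lu; have uD b c : u (b + c) = u b + u c by rewrite -{1}[b]scale1r lu scale1r.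
have u0 : u 0 = 0 by apply: (addrI (u 0)); rewrite -uD !addr0.
by rewrite -[a *: x]addr0 lu u0 addr0.
Qed.

Lemma ptensor_sum (x : ptensor F G) : exists s : seq (F * G), x = \sum_(p <- s) ptens p.1 p.2.
Proof. by exists (repr x); exact: tensorE. Qed.

Lemma hspace_sumE k Ga (Q : Ga -> 'rV[C]_k -> {nonneg R}) I (r : seq I) (f : I -> hspace Q) z :
  (\sum_(i <- r) f i) z = \sum_(i <- r) f i z.
Proof. by elim: r => [|i r IH]; rewrite ?big_nil// !big_cons -IH. Qed.

Lemma hspace_scaleE k Ga (Q : Ga -> 'rV[C]_k -> {nonneg R}) a (f : hspace Q) z :
  (a *: f) z = a * f z.
Proof. by []. Qed.

Lemma tmap_sumE (s : seq (F * G)) z :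
  tmap (\sum_(p <- s) ptens p.1 p.2) z = \sum_(p <- s) p.1 (lsubmx z) * p.2 (rsubmx z).
Proof.
rewrite (linear_fun_sum _ _ tmap_linear) hspace_sumE; apply: eq_bigr => p _.
by rewrite tmap_tens.
Qed.

Lemma comb_slice (s : seq (F * G)) (l : seq (C * 'rV[C]_k1)) y :
  comb l (slice nN (tmap (\sum_(p <- s) ptens p.1 p.2)) y) =
  (\sum_(p <- s) comb l p.1 *: p.2 : G) y.
Proof.
rewrite hspace_sumE /comb.
under eq_bigr => q _ do rewrite [slice _ _ _ _]tmap_sumE row_mxKl row_mxKr mulr_sumr.
rewrite exchange_big; apply: eq_bigr => p _.
by rewrite -[RHS]/((\sum_(q <- l) q.1 * p.1 q.2) * p.2 y) mulr_suml; apply: eq_bigr => q _; rewrite mulrA.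
Qed.

Lemma admissible_scale (T : tvsType C) (u : ptensor F G -> T) (U : set T) :
  ptensor_admissible u -> nbhs (0 : T) U ->
  exists c d (eta : R), 0 < eta /\ forall (f : F) (g : G), hnorm M c f < eta -> hnorm N d g < eta ->
    U (u (ptens f g)).
Proof.
move=> [lu cu] nU.
have u0 : u (ptens 0 0) = 0.
  have -> : ptens 0 0 = 0 *: ptens 0 0 :> ptensor F G.
    by rewrite -(linear_fun_scale _ _ ((@tens_bilinear C F G).1 0)) scale0r.
  by rewrite linear_fun_scale ?scale0r.
have := cu (0, 0) U; rewrite /= u0 => /(_ nU)[[/= A B] [[s [e e0 sA]] [t [e' e0' tB]]] AB].
have [c [a a0 Ha]] := hseminorm_dominated c0 s dM.
have [d [b b0 Hb]] := hseminorm_dominated d0 t dN.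
exists c, d, (Num.min (e / a) (e' / b)); split; first by rewrite lt_min !divr_gt0.
move=> f g; rewrite !lt_min !ltr_pdivlMr// => /andP[fe _] /andP[_ ge].
apply: (AB (f, g)); split; [apply: sA|apply: tB]; rewrite /hball /= subr0.
  by apply: le_lt_trans (Ha f) _; rewrite mulrC.
by apply: le_lt_trans (Hb g) _; rewrite mulrC.
Qed.

Lemma hnormZR k Ga (Q : Ga -> 'rV[C]_k -> {nonneg R}) c (a : R) (f : hspace Q) : 0 <= a ->
  hnorm Q c (a%:C%C *: f) <= a * hnorm Q c f.
Proof. by move=> a0; apply: (le_trans (hnormZ_le _ _ _)); rewrite cmodR ger0_norm. Qed.

(* Only the product of the norms matters since t f (x) g / (s t) = (f (x) g) / s; the
   choice t = eta / (|f| + e) also covers the case |f| = 0. *)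
Lemma admissible_within (T : tvsType C) (u : ptensor F G -> T) (U : set T) c d (eta : R) :
  linear u -> 0 < eta ->
  (forall (f : F) (g : G), hnorm M c f < eta -> hnorm N d g < eta -> U (u (ptens f g))) ->
  forall (f : F) (g : G) s, 0 < s -> hnorm M c f * hnorm N d g < eta ^+ 2 * s ->
    within_scale U s (u (ptens f g)).
Proof.
move=> lu eta0 HU f g s s0; set a := hnorm M c f; set b := hnorm N d g => ab.
have a0 : 0 <= a by exact: hnorm_ge0.
have b0 : 0 <= b by exact: hnorm_ge0.
have b1 : 0 < b + 1 by rewrite ltr_wpDl.
pose e := (eta ^+ 2 * s - a * b) / (b + 1).
have e0 : 0 < e by rewrite divr_gt0// subr_gt0.
have ae : 0 < a + e by rewrite ltr_wpDl.
pose t := eta / (a + e); have t0 : 0 < t by rewrite divr_gt0.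
have be : b * (a + e) < eta ^+ 2 * s.
  have eE : e * (b + 1) = eta ^+ 2 * s - a * b by rewrite divfK// gt_eqF.
  have -> : b * (a + e) = a * b + e * (b + 1) - e by ring.
  by rewrite eE [a * b + _]addrC subrK ltrBlDr ltrDl.
have := HU (t%:C%C *: f) ((s * t)^-1%:C%C *: g).
have st0 : 0 < s * t by rewrite mulr_gt0.
have -> : ptens (t%:C%C *: f) ((s * t)^-1%:C%C *: g) = s^-1%:C%C *: ptens f g :> ptensor F G.
  have [bl br] := @tens_bilinear C F G.
  rewrite /ptens (linear_fun_scale t%:C%C f (bl _)) (linear_fun_scale _ g (br f)) scalerA -rmorphM /=.
  by congr (_%:C%C *: _); field; rewrite !gt_eqF.
rewrite (linear_fun_scale s^-1%:C%C (ptens f g) lu) => HU'; rewrite /within_scale; apply: HU'.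
  apply: (le_lt_trans (hnormZR _ _ (ltW t0))); rewrite -/a /t mulrAC ltr_pdivrMr//.
  by rewrite ltr_pM2l// ltrDl.
apply: (le_lt_trans (hnormZR _ _ _)); first by rewrite invr_ge0 ltW.
rewrite -/b ltr_pdivrMl// /t.
have -> : s * (eta / (a + e)) * eta = eta ^+ 2 * s / (a + e) by field; rewrite gt_eqF.
by rewrite ltr_pdivlMr.
Qed.

(** The finite-rank map for the first factors rewrites x as an equal tensor whose second factors are
    contractions of [tmap x], hence controlled by one of its seminorms. The residual terms have a
    first factor of zero seminorm and lie in every positive scale of the neighborhood. *)
Lemma admissible_bound (T : tvsType C) (u : ptensor F G -> T) (U : set T) :
  ptensor_admissible u -> nbhs (0 : T) U ->
  exists i (e : R), 0 < e /\ forall x, hnorm MN i (tmap x) < e -> U (u x).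
Proof.
have num : 1 / 8 + 1 / 8 + (1 / 4 + 1 / 8 + 1 / 8) <= 1 :> R by lra.
move=> au /locally_convex0[V cV [nV VU]].
have V0 : V 0 by exact: nbhs_singleton.
have [c [d [eta [eta0 HV]]]] := admissible_scale au nV.
have [lu _] := au; have within := admissible_within lu eta0 HV.
have [c' [B [B0 HB]]] := finite_rank_hspace cI cII c.
have eta20 : 0 < eta ^+ 2 by rewrite exprn_gt0.
have B1 : 0 < B + 1 by rewrite ltr_wpDl.
(* So that the scales of the rewritten terms, apart from the slacks below, sum to at most B e /
   eta^2 <= 1 / 4. *)
pose e := eta ^+ 2 / (4 * (B + 1)).
have e0 : 0 < e by rewrite divr_gt0// mulr_gt0.
exists (c', d), e; split=> // x hx; apply: VU.
have [s sx] := ptensor_sum x; subst x.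
set h := tmap _ in hx; set P := hnorm MN (c', d) h in hx.
have P0 : 0 <= P by exact: hnorm_ge0.
have [n [v [a [l [a0 la aB res]]]]] := HB (map fst s).
pose Gn j : G := \sum_(p <- s) comb (l j) p.1 *: p.2.
have GnP j : hnorm N d (Gn j) <= a j * P.
  by apply: hnorm_contract (la j) _ => // y; rewrite comb_slice.
pose r (p : F * G) : F := p.1 - \sum_(j < n) comb (l j) p.1 *: v j.
have xE : \sum_(p <- s) ptens p.1 p.2 = \sum_(p <- s) ptens (r p) p.2 +
    \sum_(j < n) ptens (v j) (Gn j) :> ptensor F G.
  have [bl br] := @tens_bilinear C F G.
  have -> : \sum_(j < n) ptens (v j) (Gn j) =
      \sum_(p <- s) \sum_(j < n) comb (l j) p.1 *: ptens (v j) p.2 :> ptensor F G.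
    rewrite exchange_big; apply: eq_bigr => j _ /=.
    rewrite /Gn /ptens (linear_fun_sum _ _ (br (v j))); apply: eq_bigr => p _.
    by rewrite (linear_fun_scale _ _ (br (v j))).
  rewrite -big_split; apply: eq_bigr => p _ /=.
  rewrite {1}[p.1](_ : _ = 1 *: r p + \sum_(j < n) comb (l j) p.1 *: v j); last first.
    by rewrite scale1r subrK.
  rewrite /ptens (bl p.2) scale1r; congr (_ + _).
  rewrite (linear_fun_sum _ _ (bl p.2)); apply: eq_bigr => j _.
  by rewrite (linear_fun_scale _ _ (bl p.2)).
have uD a' b' : u (a' + b') = u a' + u b' by rewrite -{1}[a']scale1r lu scale1r.
rewrite xE uD !(linear_fun_sum _ _ lu).
(* [within] asks for a strict inequality, so each term of the two sums gets a positive slack, at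
   most 1 / 8 in total for either sum. *)
pose s1 : R := 1 / (8 * (size s).+1%:R).
have s10 : 0 < s1 by rewrite divr_gt0// mulr_gt0.
pose s2 j : R := hnorm M c (v j) * (a j * P) / eta ^+ 2 + 1 / (8 * n.+1%:R).
have s20 j : 0 < s2 j.
  apply: ltr_wpDl; last by rewrite divr_gt0// mulr_gt0.
  by apply: divr_ge0; [rewrite !mulr_ge0// hnorm_ge0|exact: ltW].
have R1 : within_scale V (\sum_(p <- s) s1 + 1 / 8) (\sum_(p <- s) u (ptens (r p) p.2)).
  (* Terms outside [s] are replaced by 0, as the residual has zero seminorm only for members of
     [s]. *)
  rewrite [X in within_scale _ _ X]big_seq [X in within_scale _ _ X]big_mkcond.
  apply: (@within_scale_sum _ _ V _ s (fun=> s1)) => // p.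
  case: ifP => [ps|_]; last by rewrite /within_scale scaler0.
  apply: within => //; rewrite /r res ?mul0r ?mulr_gt0//.
  by apply/mapP; exists p.
have R2 : within_scale V (\sum_(j <- index_enum 'I_n) s2 j + 1 / 8)
    (\sum_(j < n) u (ptens (v j) (Gn j))).
  apply: (@within_scale_sum _ _ V _ _ s2) => // j; apply: within => //.
  apply: (@le_lt_trans _ _ (hnorm M c (v j) * (a j * P))).
    by rewrite ler_wpM2l ?hnorm_ge0.
  rewrite /s2 mulrDr [X in _ < X + _]mulrCA divff ?gt_eqF// mulr1 ltrDl.
  by rewrite mulr_gt0// divr_gt0// mulr_gt0.
have small m : 1 / (8 * m.+1%:R) * m%:R <= 1 / 8 :> R.
  rewrite !mul1r mulrC ler_pdivrMr ?mulr_gt0// mulrA mulVf ?pnatr_eq0// mul1r.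
  by rewrite ler_nat.
have S1 : \sum_(p <- s) s1 <= 1 / 8.
  rewrite big_const_seq count_predT iter_addr_0 -[s1 *+ _]mulr_natr.
  exact: small.
have S2 : \sum_(j < n) s2 j <= 1 / 4 + 1 / 8.
  rewrite big_split /=; apply: lerD.
    rewrite -mulr_suml.
    under eq_bigr do rewrite mulrA.
    rewrite -mulr_suml ler_pdivrMr//.
    apply: (@le_trans _ _ (B * e)).
      apply: ler_pM => //; last exact: ltW.
        by apply: sumr_ge0 => j _; rewrite mulr_ge0 ?hnorm_ge0.
      by under eq_bigr do rewrite mulrC.
    rewrite /e mulrA ler_pdivrMr ?mulr_gt0//.
    have -> : 1 / 4 * eta ^+ 2 * (4 * (B + 1)) = eta ^+ 2 * (B + 1) by field.
    by rewrite mulrC ler_wpM2l ?(ltW eta20)// lerDl.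
  rewrite sumr_const card_ord -[X in X <= _]mulr_natr.
  exact: small.
have Z1 : 0 <= \sum_(p <- s) s1 by apply: sumr_ge0 => p _; exact: ltW.
have Z2 : 0 <= \sum_(j < n) s2 j by apply: sumr_ge0 => p _; exact: ltW.
have p1 : 0 < \sum_(p <- s) s1 + 1 / 8 by rewrite ltr_wpDl.
have p2 : 0 < \sum_(j < n) s2 j + 1 / 8 by rewrite ltr_wpDl.
apply: within_scale_le1 cV V0 (addr_gt0 p1 p2) _ (within_scaleD cV p1 p2 R1 R2).
apply: (le_trans (lerD (lerD S1 (lexx _)) (lerD S2 (lexx _)))).
exact: num.
Qed.

End Embedding.

(** * Finite nets *)

Section FiniteNet.
Context {R : realType} {Y : Type}.
Local Notation C := R[i].

(** Total boundedness as a finite partition of [Y]: the code numbers the interval of length [eta]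
    that contains p y. *)
Lemma real_finite_code (p : Y -> R) (B eta : R) : 0 < eta -> (forall y, `|p y| <= B) ->
  exists (T : finType) (code : Y -> T), forall y y', code y = code y' -> `|p y - p y'| <= eta.
Proof.
move=> eta0 pB; have q0 y : 0 <= (p y + B) / eta.
  apply: divr_ge0; last exact: ltW.
  by rewrite -lerBlDr sub0r; have := pB y; rewrite ler_norml => /andP[].
have qB y : (p y + B) / eta <= (B + B) / eta.
  by rewrite ler_pM2r ?invr_gt0// lerD2r; apply: le_trans (ler_norm _) (pB y).
pose m := Num.truncn ((B + B) / eta).
exists 'I_m.+1, (fun y => inord (Num.truncn ((p y + B) / eta))) => y y' /(congr1 val).
have tm z : (Num.truncn ((p z + B) / eta) < m.+1)%N by rewrite ltnS le_truncn.
rewrite /= !inordK// => tE.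
have /andP[a1 a2] := truncn_itv (q0 y); have /andP[b1 b2] := truncn_itv (q0 y').
rewrite tE in a1 a2; set t := Num.truncn _ in a1 a2 b1 b2.
have E : p y - p y' = ((p y + B) / eta - (p y' + B) / eta) * eta.
  by rewrite mulrBl !divfK ?gt_eqF//; ring.
rewrite E normrM [X in _ * X]gtr0_norm// -[leRHS]mul1r ler_wpM2r ?(ltW eta0)//.
rewrite ler_norml; move: a1 a2 b1 b2; rewrite -natr1.
set u := (p y + B) / eta; set v := (p y' + B) / eta; set r := t%:R.
by clear; lra.
Qed.

Lemma finite_code (J : eqType) (s : seq J) (p : J -> Y -> C) (B eta : R) : 0 < eta ->
  (forall j y, cmod (p j y) <= B) ->
  exists (T : finType) (code : Y -> T), forall y y', code y = code y' ->
    forall j, j \in s -> cmod (p j y - p j y') <= eta.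
Proof.
move=> eta0 pB; have eta20 : 0 < eta / 2 by rewrite divr_gt0.
elim: s => [|j s [T [code codeP]]]; first by exists unit, (fun=> tt).
have reB y : `|Re (p j y)| <= B by apply: le_trans (pB j y); exact: Re_le_cmod.
have imB y : `|Im (p j y)| <= B by apply: le_trans (pB j y); exact: Im_le_cmod.
have [T1 [code1 codeP1]] := real_finite_code eta20 reB.
have [T2 [code2 codeP2]] := real_finite_code eta20 imB.
exists ((T1 * T2) * T)%type, (fun y => ((code1 y, code2 y), code y)) => y y' [e1 e2 e3] i.
rewrite in_cons => /orP[/eqP ->|]; last exact: codeP.
apply: (le_trans (cmod_le_ReIm _)); rewrite ReB ImB [eta]splitr.
by apply: lerD; [exact: codeP1|exact: codeP2].
Qed.

End FiniteNet.

(** * H(M (x) N) as a completion of the tensor product *)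

Section Completion.
Context {R : realType} {Gam Om : Type} {k1 k2 : nat}.
Local Notation C := R[i].
Context (M : Gam -> 'rV[C]_k1 -> {nonneg R}) (N : Om -> 'rV[C]_k2 -> {nonneg R}).
Hypothesis (dM : directed M) (dN : directed N) (c0 : Gam) (d0 : Om).
Hypothesis (nM : nondegenerate M) (nN : nondegenerate N).
Hypothesis (cI : condition_I M) (cII : condition_II M).
Local Notation F := (hspace M).
Local Notation G := (hspace N).
Local Notation H := (hspace (family_tensor M N)).
Local Notation MN := (family_tensor M N).
Local Notation tmap := (@tmap R Gam Om k1 k2 M N).

Lemma tmapB x y : tmap (x - y) = tmap x - tmap y.
Proof. by rewrite -scaleN1r addrC (tmap_linear _ y x) scaleN1r addrC. Qed.

(** [biorthogonal], applied to point evaluations, writes each first factor as f = sum_a f(k a) e_a.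
    The tensor becomes sum_a e_a (x) h(k a, .), which vanishes with h. *)
Lemma tmap_injective : injective tmap.
Proof.
have ker0 x : tmap x = 0 -> x = 0.
  have [s ->] := ptensor_sum x; move=> tx.
  have psi_lin (z : 'rV[C]_k1) : linear (fun f : F => f z : C) by [].
  have [d [e [k [_ fe]]]] := biorthogonal psi_lin (map fst s).
  have fE p : p \in s -> p.1 = \sum_(a < d) p.1 (k a) *: e a.
    move=> ps; apply: hspace_ext => z; apply/eqP; rewrite -subr_eq0; apply/eqP.
    exact: (fe p.1 (map_f fst ps) z).
  have [bl br] := @tens_bilinear C F G.
  have -> : \sum_(p <- s) ptens p.1 p.2 =
      \sum_(a < d) ptens (e a) (\sum_(p <- s) p.1 (k a) *: p.2) :> ptensor F G.
    rewrite /ptens; under [RHS]eq_bigr => a _ do rewrite (linear_fun_sum _ _ (br (e a))).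
    rewrite exchange_big [LHS]big_seq [RHS]big_seq; apply: eq_bigr => p ps.
    rewrite {1}(fE p ps) (linear_fun_sum _ _ (bl p.2)); apply: eq_bigr => a _.
    by rewrite (linear_fun_scale _ _ (bl p.2)) (linear_fun_scale _ _ (br (e a))).
  apply: big1 => a _.
  have -> : \sum_(p <- s) p.1 (k a) *: p.2 = 0 :> G.
    apply: hspace_ext => y; rewrite hspace_sumE.
    have : tmap (\sum_(p <- s) ptens p.1 p.2) (row_mx (k a) y) = 0 by rewrite tx.
    by rewrite tmap_sumE row_mxKl row_mxKr.
  by rewrite -(scale0r (0 : G)) /ptens (linear_fun_scale _ _ (br (e a))) scale0r.
move=> x y xy; apply/eqP; rewrite -subr_eq0; apply/eqP/ker0.
by rewrite tmapB xy subrr.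
Qed.

Lemma hnorm_hprod c d (f : F) (g : G) :
  hnorm MN (c, d) (hprod f g) <= hnorm M c f * hnorm N d g.
Proof.
apply: hnorm_le => z; rewrite /= /hprod_fun cmodM mulrACA.
by apply: ler_pM; rewrite ?mulr_ge0 ?cmod_ge0 ?hnorm_ub.
Qed.

Lemma tmap_continuous : continuous tmap.
Proof.
apply: (ptensor_universal (@tmap_linear _ _ _ _ _ M N)) => -[f g] A [s [e e0 sA]].
have [[c d] [a a0 Ha]] := hseminorm_dominated (c0, d0) s (directed_tensor dM dN).
pose K := hnorm M c f + hnorm N d g + 2.
have K0 : 0 < K by rewrite ltr_wpDl// addr_ge0// hnorm_ge0.
pose r := Num.min 1 (e / (a * K)).
have r0 : 0 < r by rewrite lt_min ltr01 divr_gt0// mulr_gt0.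
exists (hball [:: c] r f, hball [:: d] r g).
  by split; apply: hball_nbhs; exact: hballxx.
move=> [f' g'] [/=]; rewrite /hball /= !hseminorm1 => fr gr; apply: sA.
rewrite /hball /= in fr gr *; apply: (le_lt_trans (Ha _)).
rewrite tmap_tens -[X in _ - X]/(tmap (ptens f g)) tmap_tens.
have [bl br] := hprod_bilinear M N.
have -> : hprod f' g' - hprod f g = hprod f' (g' - g) + hprod (f' - f) g.
  apply: hspace_ext => z.
  rewrite -[LHS]/(f' (lsubmx z) * g' (rsubmx z) - f (lsubmx z) * g (rsubmx z)).
  rewrite -[RHS]/(f' (lsubmx z) * (g' (rsubmx z) - g (rsubmx z)) +
    (f' (lsubmx z) - f (lsubmx z)) * g (rsubmx z)); ring.
have f'1 : hnorm M c f' <= hnorm M c f + 1.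
  rewrite -{1}[f'](subrK f) addrC; apply: (le_trans (Defs.hnormD _ _ _)).
  by rewrite lerD2l; apply: (le_trans (ltW fr)); rewrite ge_min lexx.
have rK : a * (r * K) <= e.
  have : r <= e / (a * K) by rewrite ge_min lexx orbT.
  by rewrite ler_pdivlMr ?mulr_gt0// mulrCA.
apply: lt_le_trans rK; rewrite ltr_pM2l//.
apply: (le_lt_trans (Defs.hnormD _ _ _)).
apply: (@le_lt_trans _ _ ((hnorm M c f + 1) * r + r * hnorm N d g)).
  apply: lerD; apply: (le_trans (hnorm_hprod _ _ _ _)); apply: ler_pM; rewrite ?hnorm_ge0//.
    exact: ltW.
  exact: ltW.
rewrite mulrC -mulrDr ltr_pM2l// /K -addrA [1 + _]addrC addrA ltrD2l.
by rewrite ltr1n.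
Qed.

Lemma nbhs_shift (T : tvsType C) (x : T) U : nbhs x U -> nbhs (0 : T) [set t | U (x + t)].
Proof.
move=> nU; have := @add_continuous T (x, 0) U; rewrite /= addr0 => /(_ nU)[[A B] /= [nA nB] AB].
by apply: filterS nB => t Bt; apply: (AB (x, t)); split=> //=; exact: nbhs_singleton.
Qed.

Lemma tmap_embedding : top_embedding tmap.
Proof.
split; first exact: tmap_injective.
move=> x A; split; last first.
  move=> [U nU UA]; apply: filterS UA _; exact: tmap_continuous.
move=> [T [u [au [U /nbhs_shift nU UA]]]].
have [[c d] [e [e0 He]]] := admissible_bound dM dN c0 d0 nN cI cII au nU.
exists (hball [:: (c, d)] e (tmap x)); first exact/hball_nbhs/hballxx.
move=> y; rewrite /hball /= hseminorm1 -tmapB => /He /=.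
have [lu _] := au; rewrite -scaleN1r [y + _]addrC lu scaleN1r addrA subrr add0r.
exact: UA.
Qed.

Lemma hnorm_ext k Ga (Q : Ga -> 'rV[C]_k -> {nonneg R}) c (f g : hspace Q) :
  (forall z, f z = g z) -> hnorm Q c f = hnorm Q c g.
Proof. by move=> fg; congr (hnorm Q c _); exact/funext. Qed.

Lemma combB (l : seq (C * 'rV[C]_k1)) (f g : F) : comb l (f - g) = comb l f - comb l g.
Proof.
by rewrite /comb -sumrB; apply: eq_bigr => q _; rewrite -mulrBr -hspaceBE.
Qed.

(** The seminorms of the weighted slices are bounded by that of h, so the tail in [nuclear_tail] is
    uniformly small, and the finitely many functionals left take bounded values, which a finite code
    distinguishes up to a small error. *)
Lemma slice_net (h : H) c d (eta : R) : 0 < eta -> exists ys : seq 'rV[C]_k2,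
  forall y, exists2 y', y' \in ys & hnorm M c
    ((N d y)%:num%:C%C *: slice nN h y - (N d y')%:num%:C%C *: slice nN h y' : F) <= eta.
Proof.
move=> eta0; have [c' [J [w [l [W [w0 wW lw tail]]]]]] := nuclear_tail cI cII c.
pose p y : F := (N d y)%:num%:C%C *: slice nN h y.
pose Q := hnorm MN (c', d) h; have Q0 : 0 <= Q by exact: hnorm_ge0.
have pQ y : hnorm M c' (p y) <= Q.
  by apply: (le_trans (hnormZR _ _ _)) => //; exact: hnorm_slice.
have W0 : 0 <= W by have := wW [::] isT; rewrite big_nil.
have wj j : w j <= W by have := wW [:: j] isT; rewrite big_seq1.
have bd j y : cmod (comb (l j) (p y)) <= W * Q.
  by apply: (le_trans (lw j _)); apply: ler_pM => //; exact: hnorm_ge0.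
have Q1 : 0 < 4 * (Q + 1) by rewrite mulr_gt0// ltr_wpDl.
have W1 : 0 < 2 * (W + 1) by rewrite mulr_gt0// ltr_wpDl.
have [s us tail_s] := tail _ (divr_gt0 eta0 Q1).
have [T [code codeP]] := finite_code s (divr_gt0 eta0 W1) bd.
(* One representative for each code; a code that is not attained gets 0. *)
have /choice[rep repP] : forall t : T, exists y, forall y', code y' = t -> code y = t.
  move=> t; have [[y yt]|no] := pselect (exists y, code y = t); first by exists y.
  by exists 0 => y' yt; case: no; exists y'.
exists (map rep (enum T)) => y; exists (rep (code y)).
  by apply: map_f; rewrite mem_enum.
set y' := rep _; have yy' : code y = code y' by rewrite (repP _ y).
rewrite -/(p y) -/(p y'); apply: (le_trans (tail_s s _ us (fun _ => id))).
rewrite [leRHS]splitr; apply: lerD.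
  apply: (@le_trans _ _ (\sum_(j <- s) w j * (eta / (2 * (W + 1))))).
    rewrite big_seq [leRHS]big_seq; apply: ler_sum => j js; rewrite ler_wpM2l//.
    by rewrite combB; exact: codeP.
  rewrite -mulr_suml mulrC.
  apply: (@le_trans _ _ (eta / (2 * (W + 1)) * (W + 1))).
    apply: ler_wpM2l; first by rewrite ltW// divr_gt0.
    by apply: (le_trans (wW s us)); rewrite lerDl.
  by rewrite invfM mulrA -mulrA mulVf ?mulr1// gt_eqF// ltr_wpDl.
apply: (@le_trans _ _ (eta / (4 * (Q + 1)) * (Q + Q))).
  apply: ler_wpM2l; first by rewrite ltW// divr_gt0.
  apply: (le_trans (Defs.hnormD _ _ _)); apply: lerD => //.
  exact: le_trans (hnormN _ _) (pQ _).
rewrite -mulrA ler_wpM2l ?(ltW eta0)// ler_pdivrMl// -[2]/(1 + 1).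
have -> : 4 * (Q + 1) / 2 = Q + Q + 2 by field.
by rewrite lerDl.
Qed.

(** A finite-rank map P that is exact on the net turns h into a finite tensor. For a slice p y near
    p y' in the net, P (p y) - p y = (P v - v) - (p y' - P (p y')) with v = p y - p y', and the last
    bracket has zero seminorm. *)
Lemma tmap_approx (h : H) c d (eta : R) : 0 < eta ->
  exists x, hnorm MN (c, d) (tmap x - h) <= eta.
Proof.
move=> eta0; have [c' [B [B0 HB]]] := finite_rank_hspace cI cII c.
have B1 : 0 < 2 * (B + 1) by rewrite mulr_gt0// ltr_wpDl.
have [ys ysP] := slice_net h c' d (divr_gt0 eta0 B1).
pose p y : F := (N d y)%:num%:C%C *: slice nN h y.
have rank_le n (u : 'I_n -> F) (a : 'I_n -> R) l (f : F) : (forall j, 0 <= a j) ->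
    (forall j (g : F), cmod (comb (l j) g) <= a j * hnorm M c' g) ->
    \sum_(j < n) a j * hnorm M c (u j) <= B ->
    hnorm M c (\sum_(j < n) comb (l j) f *: u j) <= B * hnorm M c' f.
  move=> a0 la aB; apply: (le_trans (seminorm_sum _ _ (hnorm_seminorm M c))).
  apply: (@le_trans _ _ (\sum_(j < n) a j * hnorm M c (u j) * hnorm M c' f)).
    apply: ler_sum => j _; apply: (le_trans (hnormZ_le _ _ _)).
    by rewrite mulrAC ler_wpM2r ?hnorm_ge0.
  by rewrite -mulr_suml ler_wpM2r ?hnorm_ge0.
(* Exactness on a single vector also compares the two seminorms. *)
have cc' (f : F) : hnorm M c f <= B * hnorm M c' f.
  have [n [u [a [l [a0 la aB res]]]]] := HB [:: f].
  rewrite -{1}[f](subrK (\sum_(j < n) comb (l j) f *: u j)).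
  apply: (le_trans (Defs.hnormD _ _ _)); rewrite res ?mem_head// add0r.
  exact: rank_le.
have [n [u [a [l [a0 la aB res]]]]] := HB (map p ys).
pose P f : F := \sum_(j < n) comb (l j) f *: u j.
pose g j : G := HSpace (contract_subproof nN h (a0 j) (la j)).
exists (\sum_(j < n) ptens (u j) (g j)).
pose w : H := tmap (\sum_(j < n) ptens (u j) (g j)) - h.
rewrite -/w; apply: (@hnorm_tensor_le _ _ _ _ _ _ _ nN w) => y.
have wE : forall x, ((N d y)%:num%:C%C *: slice nN w y) x = (P (p y) - p y) x.
  move=> x; rewrite hspaceBE /P hspace_sumE.
  rewrite -[LHS]/((N d y)%:num%:C%C * (tmap (\sum_(j < n) ptens (u j) (g j)) (row_mx x y) - h (row_mx x y))).
  rewrite (linear_fun_sum _ _ (@tmap_linear _ _ _ _ _ M N)) hspace_sumE mulrBr; congr (_ - _).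
  rewrite mulr_sumr; apply: eq_bigr => j _; rewrite tmap_tens.
  rewrite -[hprod _ _ _]/(u j (lsubmx (row_mx x y)) * comb (l j) (slice nN h (rsubmx (row_mx x y)))).
  rewrite row_mxKl row_mxKr hspace_scaleE mulrCA mulrC; congr (_ * _).
  rewrite /comb mulr_sumr; apply: eq_bigr => q _.
  by rewrite mulrCA.
have NP : (N d y)%:num * hnorm M c (slice nN w y) <= hnorm M c (P (p y) - p y).
  have [N0|N0] := eqVneq (N d y)%:num 0; first by rewrite N0 mul0r hnorm_ge0.
  have Np : 0 < (N d y)%:num by rewrite lt_def N0 /=.
  rewrite -ler_pdivlMl// -(hnorm_ext _ wE).
  have {1}-> : slice nN w y = (N d y)%:num^-1%:C%C *: ((N d y)%:num%:C%C *: slice nN w y).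
    by rewrite scalerA -rmorphM /= mulVf// scale1r.
  by apply: hnormZR; rewrite invr_ge0.
apply: (le_trans NP); have [y' y'ys yy'] := ysP y.
pose v : F := p y - p y'.
have vE : P (p y) - p y = (P v - v) - (p y' - P (p y')).
  have PB : P v = P (p y) - P (p y').
    rewrite /P -sumrB; apply: eq_bigr => j _; rewrite -scalerBl; congr (_ *: _).
    by rewrite combB.
  by rewrite PB /v !opprB !addrA; apply: hspace_ext => x; rewrite -[LHS]/(P (p y) x - p y x) -[RHS]/(P (p y) x - P (p y') x + p y' x - p y x + P (p y') x - p y' x); ring.
rewrite vE; apply: (le_trans (Defs.hnormD _ _ _)).
have /(le_trans (hnormN _ _)) r0 : hnorm M c (p y' - P (p y')) <= 0.
  by rewrite /P res//; apply: map_f.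
apply: (le_trans (lerD (lexx _) r0)); rewrite addr0.
apply: (le_trans (Defs.hnormD _ _ _)).
apply: (@le_trans _ _ (B * hnorm M c' v + B * hnorm M c' v)).
  by apply: lerD; [exact: rank_le|exact: le_trans (hnormN _ _) (cc' v)].
apply: (@le_trans _ _ ((B + B) * (eta / (2 * (B + 1))))).
  by rewrite -mulrDl ler_wpM2l// addr_ge0.
rewrite mulrA ler_pdivrMr// mulrC ler_wpM2l ?(ltW eta0)//.
by rewrite mulr2n mulrDl !mul1r; apply: lerD; rewrite lerDl.
Qed.

Lemma tmap_dense : dense (range tmap).
Proof.
move=> U [h Uh] oU; have [s [e e0 sU]] : nbhs h U by exact: open_nbhs_nbhs.
have [[c d] [a a0 Ha]] := hseminorm_dominated (c0, d0) s (directed_tensor dM dN).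
have e2 : 0 < e / 2 / a by rewrite !divr_gt0.
have [x hx] := tmap_approx h c d e2; exists (tmap x); split; last by exists x.
apply: sU; rewrite /hball /=; apply: (le_lt_trans (Ha _)).
apply: (@le_lt_trans _ _ (e / 2)); first by rewrite mulrC -ler_pdivlMr.
by rewrite ltr_pdivrMr// ltr_pMr// ltr1n.
Qed.

Lemma tmap_completion : is_completion tmap.
Proof.
have nMN := nondegenerate_tensor nM nN.
split; [exact: hspace_hausdorff|exact: hspace_complete|exact: tmap_linear| |].
  exact: tmap_embedding.
exact: tmap_dense.
Qed.

End Completion.

(** * Uniqueness of completions *)

Section CompletionUnique.
Context {K : numFieldType}.
Implicit Types S E H T : tvsType K.

Lemma nbhs_affine T (a : K) (e f : T) W : nbhs (a *: e + f) W ->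
  exists A B, [/\ nbhs e A, nbhs f B & forall x y, A x -> B y -> W (a *: x + y)].
Proof.
move=> /(@add_continuous T (a *: e, f))[[V B] /= [nV nB] VB].
have [[D A] /= [nD nA] DA] := @scale_continuous K T (a, e) V nV.
exists A, B; split=> // x y Ax By; apply: (VB (a *: x, y)); split=> //=.
by apply: (DA (a, x)); split=> //=; exact: nbhs_singleton.
Qed.

Lemma dense_nbhs (S T : topologicalType) (i : S -> T) (e : T) W : dense (range i) ->
  nbhs e W -> exists x, W (i x).
Proof.
move=> di nW; have [] := di (interior W).
- by exists e.
- exact: open_interior.
- by move=> z [/interior_subset Wz [x _ xz]]; exists x; rewrite xz.
Qed.

Lemma linear_fun_sub S T (u : S -> T) (x y : S) : linear u -> u (x - y) = u x - u y.
Proof. by move=> lu; rewrite -scaleN1r addrC lu scaleN1r addrC. Qed.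

(** [i] and [j] induce the same neighborhoods of 0 on [S], so the traces on [S] of the neighborhoods
    of e give a Cauchy filter in [H]; u e is its limit. *)
Lemma completion_extend S E H (i : S -> E) (j : S -> H) :
  is_completion i -> is_completion j ->
  exists u : E -> H, [/\ linear u, continuous u & forall x, u (i x) = j x].
Proof.
move=> [_ _ li [_ ni] di] [hH cH lj [_ nj] _].
have lim (e : E) : exists h : H, forall U, nbhs h U ->
    exists2 W, nbhs e W & forall x, W (i x) -> U (j x).
  pose F : set_system H := [set A | exists2 W, nbhs e W & forall x, W (i x) -> A (j x)].
  have FF : ProperFilter F.
    split; first by move=> [W nW WA]; have [x /WA] := dense_nbhs di nW.
    split; first by exists setT => //; exact: filterT.
    - move=> A B [V nV VA] [W nW WB]; exists (V `&` W); first exact: filterI.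
      by move=> x [Vx Wx]; split; [exact: VA|exact: WB].
    - by move=> A B AB [W nW WA]; exists W => // x /WA/AB.
  have FC : tvs_cauchy F.
    move=> U nU; have : nbhs (0 : S) (j @^-1` U).
      apply/nj; exists U => //.
      by rewrite -(subrr (0 : S)) linear_fun_sub// subrr.
    move=> /ni[W nW WU].
    have : nbhs (-1 *: e + e) W.
      by rewrite scaleN1r addNr -(subrr (i 0)) -linear_fun_sub// subrr.
    move=> /nbhs_affine[A [B [nA nB AB]]].
    exists (j @` (i @^-1` B), j @` (i @^-1` A)).
      by split; [exists B => // x Bx; exists x|exists A => // x Ax; exists x].
    move=> [_ _] [/= [x Bx <-] [y Ay <-]]; rewrite -linear_fun_sub//.
    by apply: WU; rewrite /= linear_fun_sub// addrC -scaleN1r; exact: AB.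
  by have [h hF] := cH F FF FC; exists h => U /hF.
have {lim} /choice[u uP] := lim; exists u; split.
- move=> a e f; apply: hH => U V /uP[W nW WU].
  move=> /nbhs_affine[A [B [/uP[A' nA' A'A] /uP[B' nB' B'B] ABV]]].
  have [A2 [B2 [nA2 nB2 ABW]]] := nbhs_affine nW.
  have [x [A'x A2x]] := dense_nbhs di (filterI nA' nA2).
  have [y [B'y B2y]] := dense_nbhs di (filterI nB' nB2).
  exists (j (a *: x + y)); split; first by apply: WU; rewrite li; exact: ABW.
  by rewrite lj; apply: ABV; [exact: A'A|exact: B'B].
(* By regularity [U] contains the closure of [V], where the limits of values in [V] lie. *)
- move=> e U /(@uniform_regular H)[V nV VU]; have [W nW WV] := uP _ _ nV.
  apply: filterS (nbhs_interior nW) => e' nW'; apply: VU => O /uP[W' nW'' WO].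
  have [x [Wx W'x]] := dense_nbhs di (filterI nW' nW'').
  by exists (j x); split; [exact: WV|exact: WO].
- move=> x; apply: hH => U V /uP[W nW WU] nV; exists (j x).
  by split; [apply: WU; exact: nbhs_singleton|exact: nbhs_singleton].
Qed.

Lemma completion_id S E (i : S -> E) (w : E -> E) : is_completion i -> continuous w ->
  (forall x, w (i x) = i x) -> forall e, w e = e.
Proof.
move=> [hE _ _ _ di] cw wi e; apply: hE => U V /cw /= nU nV.
have {}nU : nbhs e (w @^-1` U) by [].
have [x [Ux Vx]] := dense_nbhs di (filterI nU nV).
by exists (i x); split=> //; rewrite -wi.
Qed.

Lemma completion_unique S E H (i : S -> E) (j : S -> H) :
  is_completion i -> is_completion j ->
  exists u : E -> H, (forall x, u (i x) = j x) /\ top_iso u.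
Proof.
move=> ci cj; have [u [lu cu ui]] := completion_extend ci cj.
have [v [_ cv vj]] := completion_extend cj ci.
exists u; split=> //; split=> //; exists v; split=> //.
  apply: (completion_id ci); last by move=> x /=; rewrite ui vj.
  by move=> e; apply: continuous_comp; [exact: cu|exact: cv].
apply: (completion_id cj); last by move=> x /=; rewrite vj ui.
by move=> e; apply: continuous_comp; [exact: cv|exact: cu].
Qed.

End CompletionUnique.

Theorem theorem15 (R : realType) (k1 k2 : nat) (Gam Om : Type)
    (M : Gam -> 'rV[R[i]]_k1 -> {nonneg R})
    (N : Om -> 'rV[R[i]]_k2 -> {nonneg R}) :
  defining_family M -> defining_family N ->
  condition_I M -> condition_II M -> condition_I N -> condition_II N ->
  induces_top_iso
    (@hprod R Gam Om k1 k2 M N : hspace M -> hspace N -> hspace (family_tensor M N)).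
Proof.
move=> fM fN cI cII _ _.
have [dM nM] : directed M /\ nondegenerate M by split; [exact: df_directed|exact: df_nondegenerate].
have [dN nN] : directed N /\ nondegenerate N by split; [exact: df_directed|exact: df_nondegenerate].
(* Condition (c) at the origin shows that both index sets are inhabited. *)
have [c0 _] := nM 0; have [d0 _] := nN 0.
have completion_tmap := tmap_completion dM dN c0 d0 nM nN cI cII.
exists (@tmap R Gam Om k1 k2 M N); split.
- exact: tmap_linear.
- exact: tmap_tens.
- exact: tmap_continuous.
- by exists (hspace (family_tensor M N)), (@tmap R Gam Om k1 k2 M N).
- by move=> E i ci; exact: completion_unique ci completion_tmap.
Qed.
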